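(* Let $\pi$ be the left regular representation of the twisted product algebra $(\mathcal{S}_2,\times)$ on $L^2(\mathbb{R}^2)$, $\pi(f)g:=f\times g$, let $\pi_s$ be the Schrödinger representation of $\mathcal{S}_2$ on $L^2(\mathbb{R})$, defined by $\pi_s(f):=PWV^{-1}\pi_\omega(f)VW^{-1}Q$, and let $W$ be the Wigner transformation on $L^2(\mathbb{R}^2)=L^2(\mathbb{R})\otimes L^2(\mathbb{R})$. Then $$W\pi(f)W^{-1}=\pi_s(f)\otimes\mathbb{1}\qquad\text{for all } f\in\mathcal{S}_2,$$ where $\mathbb{1}$ is the identity operator on $L^2(\mathbb{R})$.
   Context: Notation. $\mathcal{S}_1=\mathcal{S}(\mathbb{R})$, $\mathcal{S}_2=\mathcal{S}(\mathbb{R}^2)$ are Schwartz spaces; $(\phi\otimes\psi)(q,p):=\phi(q)\psi(p)$; $f^*$ is the complex conjugate of $f$. Inner products are normalized: $(\phi\,|\,\psi)=(4\pi)^{-1/2}\int_{\mathbb{R}}\phi^*\psi\,dx$ on $L^2(\mathbb{R})$ and $(f\,|\,g)=(4\pi)^{-1}\int_{\mathbb{R}^2}f^*g\,dq\,dp$ on $L^2(\mathbb{R}^2)$. Twisted product: for $f,g\in\mathcal{S}_2$, $$(f\times g)(u)=\frac{1}{4\pi^2}\int_{\mathbb{R}^2}\int_{\mathbb{R}^2}f(v)g(w)\,e^{i(u'Jv+v'Jw+w'Ju)}\,dv\,dw,\qquad J=\begin{pmatrix}0&1\\-1&0\end{pmatrix},$$ where $u'Jv$ denotes transpose$(u)Jv$.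 It satisfies $\|f\times g\|\le\|f\|\,\|g\|$ for the norm of $(\cdot|\cdot)$, so it extends by continuity to $L^2(\mathbb{R}^2)$, and $\pi(f)$ is a bounded operator on $L^2(\mathbb{R}^2)$. Wigner transformation: for $f\in\mathcal{S}_2$, $$(Wf)(x,y)=\frac{1}{\sqrt{2\pi}}\int_{\mathbb{R}}f\Bigl(\frac{x+y}{\sqrt2},z\Bigr)e^{i(x-y)z/\sqrt2}\,dz;$$ it extends to a unitary operator on $L^2(\mathbb{R}^2)$. GNS construction. Let $f_0(u):=2e^{-|u|^2/2}$ on $\mathbb{R}^2$, which satisfies $f_0\times g\times f_0=(f_0\,|\,g)f_0$, and let $\omega(g):=(f_0\,|\,g\times f_0)$ for $g\in\mathcal{S}_2$. Let $\mathcal{K}:=\{g\in\mathcal{S}_2: g\times f_0=g\}$ and $\mathcal{K}_0:=\{g\in\mathcal{S}_2:g\times f_0=0\}$ (closed left ideals of $\mathcal{S}_2$), and let $\eta:\mathcal{S}_2\to\mathcal{S}_2/\mathcal{K}_0$ be the canonical projection. $\mathcal{S}_2/\mathcal{K}_0$ is a prehilbert space under $(\eta(g)\,|\,\eta(f)):=\omega(g^*\times f)=(g\times f_0\,|\,f\times f_0)$; its completion is $\mathcal{H}_\omega$. For $f\in\mathcal{S}_2$, $\pi_\omega(f)$ is the bounded operator on $\mathcal{H}_\omega$ extending $\eta(g)\mapsto\eta(f\times g)$. The restriction $\eta:\mathcal{K}\to\mathcal{H}_\omega$ is isometric for the $L^2(\mathbb{R}^2)$ norm and extends to a unitary map $V:\overline{\mathcal{K}}\to\mathcal{H}_\omega$,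 with $\overline{\mathcal{K}}$ the $L^2$-closure of $\mathcal{K}$. Let $h_0(x):=\sqrt2\,e^{-x^2/2}$ (a unit vector of $L^2(\mathbb{R})$ for the normalized inner product). Let $P:L^2(\mathbb{R}^2)\to L^2(\mathbb{R})$ be determined by $P(\phi\otimes\psi):=(h_0\,|\,\psi)\phi$, and $Q:L^2(\mathbb{R})\to L^2(\mathbb{R})\otimes\mathbb{C}h_0$ by $Q(\phi):=\phi\otimes h_0$. Then $PWV^{-1}:\mathcal{H}_\omega\to L^2(\mathbb{R})$ is unitary with inverse $VW^{-1}Q$. *)

(* Defs.v *)
From HB Require Import structures.
From mathcomp Require Import all_boot all_order all_algebra.
From mathcomp Require Import complex.
From mathcomp Require Import all_classical all_reals all_analysis.
From mathcomp Require Import ring.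

Set Implicit Arguments.
Unset Strict Implicit.
Unset Printing Implicit Defensive.

Import Order.TTheory GRing.Theory Num.Theory.
Import numFieldNormedType.Exports.

Local Open Scope classical_set_scope.
Local Open Scope ring_scope.

Local Notation Re := (@complex.Re _) (only parsing).
Local Notation Im := (@complex.Im _) (only parsing).

(* Inner products are conjugate-linear in the first argument. *)
HB.mixin Record NormedModule_isPreHilbert (R : realType) V
    & NormedModule R[i] V := {
  inner : V -> V -> R[i];
  inner_linear : forall (z : V) (a : R[i]) (x y : V),
    inner z (a *: x + y) = a * inner z x + inner z y;
  inner_conj : forall x y : V, inner y x = ((inner x y)^*)%C;
  inner_norm : forall x : V, inner x x = `|x| ^+ 2
}.

#[short(type="preHilbertType")]
HB.structure Definition PreHilbert (R : realType) :=
  { V of NormedModule R[i] V & NormedModule_isPreHilbert R V }.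

#[short(type="hilbertType")]
HB.structure Definition Hilbert (R : realType) :=
  { V of PreHilbert R V & Complete V }.

HB.factory Record Lmodule_isPreHilbert (R : realType) V
    & GRing.Lmodule R[i] V := {
  form : V -> V -> R[i];
  form_linear : forall (z : V) (a : R[i]) (x y : V),
    form z (a *: x + y) = a * form z x + form z y;
  form_conj : forall x y : V, form y x = ((form x y)^*)%C;
  form_ge0 : forall x : V, 0 <= form x x;
  form_eq0 : forall x : V, form x x = 0 -> x = 0
}.

HB.builders Context R V & Lmodule_isPreHilbert R V.

Let nrm (x : V) : R[i] := sqrtC (form x x).

Let formC x y : form y x = (form x y)^*.
Proof. exact: form_conj. Qed.

Let formD z x y : form z (x + y) = form z x + form z y.
Proof. by have := form_linear z 1 x y; rewrite scale1r mul1r. Qed.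

Let form0 z : form z 0 = 0.
Proof. by apply: (addrI (form z 0)); rewrite -formD !addr0. Qed.

Let formZ z a x : form z (a *: x) = a * form z x.
Proof. by have := form_linear z a x 0; rewrite !addr0 form0 addr0. Qed.

Let formDl x y z : form (x + y) z = form x z + form y z.
Proof. by rewrite (formC z) formD rmorphD/= -(formC z x) -(formC z y). Qed.

Let formZl a x z : form (a *: x) z = a^* * form x z.
Proof. by rewrite (formC z) formZ rmorphM/= -(formC z x). Qed.

Let nrm_sqr x : nrm x ^+ 2 = form x x.
Proof. exact: sqrtCK. Qed.

Let nrm_ge0 x : 0 <= nrm x.
Proof. by rewrite sqrtC_ge0 form_ge0. Qed.

Let cauchy_schwarz x y : `|form x y| <= nrm x * nrm y.
Proof.
rewrite -(@ler_pXn2r _ 2) ?qualifE/= ?normr_ge0 ?mulr_ge0 ?nrm_ge0//.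
rewrite exprMn !nrm_sqr normCK -formC.
have [y0|y0] := eqVneq (form y y) 0.
  by rewrite (form_eq0 y0) !form0 mul0r mulr0.
have yy0 : 0 < form y y by rewrite lt_def y0 form_ge0.
have yyr : (form y y)^* = form y y by rewrite -(formC y y).
have := form_ge0 (form y y *: x + (- form y x) *: y).
rewrite !formD !formDl !formZ !formZl rmorphN/= yyr -(formC y x).
rewrite -subr_ge0 -(pmulr_rge0 _ yy0); congr (0 <= _); ring.
Qed.

Let nrmD x y : nrm (x + y) <= nrm x + nrm y.
Proof.
rewrite -(@ler_pXn2r _ 2) ?qualifE/= ?addr_ge0 ?nrm_ge0//.
rewrite nrm_sqr formD !formDl (formC x y).
have Re_le : 'Re (form x y) <= nrm x * nrm y.
  exact: le_trans (leif_Re_Creal _) (cauchy_schwarz x y).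
have Re2 : form x y + (form x y)^* = 2 * 'Re (form x y).
  by rewrite ReE mulrC divfK ?pnatr_eq0.
rewrite -subr_ge0.
have -> : (nrm x + nrm y) ^+ 2
    - (form x x + (form x y)^* + (form x y + form y y))
    = 2 * (nrm x * nrm y - 'Re (form x y)).
  by rewrite mulrBr -Re2 -(nrm_sqr x) -(nrm_sqr y); ring.
by rewrite mulr_ge0 ?subr_ge0.
Qed.

Let nrmZ a x : nrm (a *: x) = `|a| * nrm x.
Proof.
rewrite /nrm formZ formZl mulrA -normCK sqrtCM ?qualifE/= ?form_ge0 ?exprn_ge0//.
by rewrite sqrCK.
Qed.

Let nrm0_eq0 x : nrm x = 0 -> x = 0.
Proof. by move=> /eqP; rewrite sqrtC_eq0 => /eqP /form_eq0. Qed.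

HB.instance Definition _ := Lmodule_isNormed.Build R[i] V nrmD nrmZ nrm0_eq0.

Let form_nrm x : form x x = `|x| ^+ 2.
Proof. by rewrite [`|x|]/(nrm x) nrm_sqr. Qed.

HB.instance Definition _ :=
  NormedModule_isPreHilbert.Build R V form_linear form_conj form_nrm.

HB.end.

Section integral.
Context d (T : measurableType d) (R : realType).
Variable mu : {measure set T -> \bar R}.
Implicit Types f g : T -> R[i].

Definition Cintegral f : R[i] :=
  ((\int[mu]_x Re (f x))%R +i* (\int[mu]_x Im (f x))%R)%C.

Definition Cintegrable f :=
  mu.-integrable setT (EFin \o (Re \o f)) /\
  mu.-integrable setT (EFin \o (Im \o f)).

Lemma CintegralD f g : Cintegrable f -> Cintegrable g ->
  Cintegral (f + g) = Cintegral f + Cintegral g.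
Proof.
move=> [f1 f2] [g1 g2]; apply/eqP; rewrite eq_complex /=.
apply/andP; split; apply/eqP.
  by rewrite -RintegralD//; apply: eq_Rintegral => x _; rewrite raddfD.
by rewrite -RintegralD//; apply: eq_Rintegral => x _; rewrite raddfD.
Qed.

Lemma CintegralZ (a : R[i]) f : Cintegrable f ->
  Cintegral (fun x => a * f x) = a * Cintegral f.
Proof.
case: a => a b [f1 f2]; rewrite /Cintegral; apply/eqP; rewrite eq_complex /=.
have iZ (c : R) (h : T -> R) : mu.-integrable setT (EFin \o h) ->
    mu.-integrable setT (EFin \o (fun x => c * h x)).
  by move=> ih; exact: (integrableZl _ c ih).
apply/andP; split; apply/eqP.
  rewrite -!RintegralZl// -RintegralB//; [|exact: iZ..].
  by apply: eq_Rintegral => x _; case: (f x).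
rewrite -!RintegralZl// -RintegralD//; [|exact: iZ..].
by apply: eq_Rintegral => x _; case: (f x).
Qed.

End integral.

Section L2.
Context d (T : measurableType d) (R : realType).
Variable mu : {measure set T -> \bar R}.
Implicit Types f g : T -> R[i].

Definition L2fun : {pred T -> R[i]} := [pred f |
  (Re \o f \in Lfun mu 2%:E) && (Im \o f \in Lfun mu 2%:E)].

Let p1 : (1 <= 2%:E :> \bar R)%E.
Proof. by rewrite lee_fin ler1n. Qed.

Lemma L2fun_submod_closed : submod_closed L2fun.
Proof.
have [z0 lin] := @Lfun_submod_closed _ T R mu 2%:E p1; split.
  by apply/andP; split; exact: z0.
move=> a f g /andP[f1 f2] /andP[g1 g2]; apply/andP; split.
  suff -> : Re \o (a *: f + g) =
      (Re a) *: (Re \o f) + ((- Im a) *: (Im \o f) + (Re \o g)).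
    by apply: (lin) => //; apply: (lin).
  apply/funext => x; rewrite /= !fctE /=.
  by case: a (f x) (g x) => [a b] [u v] [s t] /=; rewrite -addrA -mulNr.
suff -> : Im \o (a *: f + g) =
    (Re a) *: (Im \o f) + ((Im a) *: (Re \o f) + (Im \o g)).
  by apply: (lin) => //; apply: (lin).
apply/funext => x; rewrite /= !fctE /=.
by case: a (f x) (g x) => [a b] [u v] [s t] /=; rewrite -addrA.
Qed.

HB.instance Definition _ :=
  GRing.isSubmodClosed.Build _ _ L2fun L2fun_submod_closed.

Definition preL2 : Type := {f : T -> R[i] | f \in L2fun}.
HB.instance Definition _ := SubChoice.on preL2.
HB.instance Definition _ := [SubChoice_isSubLmodule of preL2 by <:].

Definition L2_eq (f g : preL2) := `[< val f = val g %[ae mu] >].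

Let L2_eq_refl : reflexive L2_eq.
Proof. by move=> f; apply/asboolP; exact: ae_eq_refl. Qed.

Let L2_eq_sym : symmetric L2_eq.
Proof. by move=> f g; apply/idP/idP => /asboolP h; apply/asboolP/ae_eq_sym. Qed.

Let L2_eq_trans : transitive L2_eq.
Proof.
by move=> g f h /asboolP fg /asboolP gh; apply/asboolP/(ae_eq_trans fg gh).
Qed.

Canonical L2_eq_canonical := EquivRel L2_eq L2_eq_refl L2_eq_sym L2_eq_trans.

Local Open Scope quotient_scope.

Definition L2 : Type := {eq_quot L2_eq}.
HB.instance Definition _ := Choice.on L2.
HB.instance Definition _ := EqQuotient.on L2.

Lemma L2P (f g : preL2) :
  (\pi_L2 f = \pi_L2 g) <-> (val f = val g %[ae mu]).
Proof.
split=> [/eqmodP/asboolP//|h]; by apply/eqmodP/asboolP.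
Qed.

(* The class of [f], or [0] if [f] is not square integrable. *)
Definition toL2 f : L2 := \pi_L2 (insubd (0 : preL2) f).
Definition ofL2 (x : L2) : T -> R[i] := val (repr x).

Definition L2_add (x y : L2) : L2 := \pi_L2 (repr x + repr y).
Definition L2_opp (x : L2) : L2 := \pi_L2 (- repr x).
Definition L2_scale (a : R[i]) (x : L2) : L2 := \pi_L2 (a *: repr x).
Definition L2_zero : L2 := \pi_L2 0.

Let repr_ae (f : preL2) : val (repr (\pi_L2 f)) = val f %[ae mu].
Proof. by apply/L2P; rewrite reprK. Qed.

Let piD (f g : preL2) : L2_add (\pi_L2 f) (\pi_L2 g) = \pi_L2 (f + g).
Proof.
apply/L2P; apply: filterS2 (repr_ae f) (repr_ae g) => x fx gx _.
by rewrite !raddfD /= !fctE fx ?gx.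
Qed.

Let piN (f : preL2) : L2_opp (\pi_L2 f) = \pi_L2 (- f).
Proof.
apply/L2P; apply: filterS (repr_ae f) => x fx _.
by rewrite !raddfN /= !fctE fx.
Qed.

Let piZ (a : R[i]) (f : preL2) : L2_scale a (\pi_L2 f) = \pi_L2 (a *: f).
Proof.
apply/L2P; apply: filterS (repr_ae f) => x fx _.
by rewrite !linearZ /= !fctE fx.
Qed.

Let addA : associative L2_add.
Proof.
move=> x y z; elim/quotW: x => x; elim/quotW: y => y; elim/quotW: z => z.
by rewrite (piD y z) (piD x y) !piD addrA.
Qed.
Let addC : commutative L2_add.
Proof.
by move=> x y; elim/quotW: x => x; elim/quotW: y => y; rewrite !piD addrC.
Qed.
Let add0 : left_id L2_zero L2_add.
Proof. by move=> x; elim/quotW: x => x; rewrite piD add0r. Qed.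
Let addN : left_inverse L2_zero L2_opp L2_add.
Proof. by move=> x; elim/quotW: x => x; rewrite piN piD addNr. Qed.

HB.instance Definition _ := GRing.isZmodule.Build L2 addA addC add0 addN.

Let scaleA a b x : L2_scale a (L2_scale b x) = L2_scale (a * b) x.
Proof. by elim/quotW: x => x; rewrite (piZ b x) !piZ scalerA. Qed.
Let scale1 : left_id 1 L2_scale.
Proof. by move=> x; elim/quotW: x => x; rewrite piZ scale1r. Qed.
Let scaleDr : right_distributive L2_scale +%R.
Proof.
move=> a x y; elim/quotW: x => x; elim/quotW: y => y.
by rewrite -![_ + _]/(L2_add _ _) (piD x y) (piZ a x) (piZ a y) piD piZ scalerDr.
Qed.
Let scaleDl x : {morph L2_scale^~ x : a b / a + b}.
Proof.
move=> a b; elim/quotW: x => x.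
by rewrite /= -[RHS]/(L2_add _ _) (piZ a x) (piZ b x) piD piZ scalerDl.
Qed.

HB.instance Definition _ := GRing.Zmodule_isLmodule.Build R[i] L2
  scaleA scale1 scaleDr scaleDl.

Let form (x y : L2) : R[i] :=
  Cintegral mu (fun t => (ofL2 x t)^* * ofL2 y t)%C.

Lemma Cintegrable_conjM f g : f \in L2fun -> g \in L2fun ->
  Cintegrable mu (fun t => (f t)^* * g t)%C.
Proof.
move=> /andP[f1 f2] /andP[g1 g2].
have M (u v : T -> R) : u \in Lfun mu 2%:E -> v \in Lfun mu 2%:E ->
    mu.-integrable setT (EFin \o (u \* v)).
  by move=> hu hv; apply/Lfun1_integrable/Lfun2_mul_Lfun1.
split.
  rewrite (_ : _ \o _ = (EFin \o ((Re \o f) \* (Re \o g))%R) \+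
                        (EFin \o ((Im \o f) \* (Im \o g))%R))%E.
    by apply: integrableD => //; exact: M.
  by apply/funext => t /=; case: (f t) (g t) => [a b] [c e] /=;
    rewrite mulNr opprK EFinD.
rewrite (_ : _ \o _ = (EFin \o ((Re \o f) \* (Im \o g))%R) \-
                      (EFin \o ((Im \o f) \* (Re \o g))%R))%E.
  by apply: integrableB => //; exact: M.
by apply/funext => t /=; case: (f t) (g t) => [a b] [c e] /=;
  rewrite mulNr EFinB.
Qed.

Lemma ofL2_in (x : L2) : ofL2 x \in L2fun.
Proof. exact: valP. Qed.

Lemma toL2K f : f \in L2fun -> ofL2 (toL2 f) = f %[ae mu].
Proof.
move=> fL2; have := repr_ae (insubd (0 : preL2) f).
by rewrite val_insubd fL2.
Qed.

Lemma ae_eq_Cintegral f g : Cintegrable mu f -> Cintegrable mu g ->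
  f = g %[ae mu] -> Cintegral mu f = Cintegral mu g.
Proof.
move=> [/measurable_int f1 /measurable_int f2].
move=> [/measurable_int g1 /measurable_int g2] fg.
congr Complex; congr fine; apply: ae_eq_integral => //;
  by apply: filterS fg => x fg _; rewrite /= fg.
Qed.

Let formE f g : f \in L2fun -> g \in L2fun ->
  form (toL2 f) (toL2 g) = Cintegral mu (fun t => (f t)^* * g t)%C.
Proof.
move=> fL2 gL2.
apply: ae_eq_Cintegral; [exact/Cintegrable_conjM/ofL2_in/ofL2_in| |].
  exact: Cintegrable_conjM.
by apply: filterS2 (toL2K fL2) (toL2K gL2) => x fx gx _; rewrite fx ?gx.
Qed.

Let ofL2K x : toL2 (ofL2 x) = x.
Proof. by rewrite /toL2 /ofL2 valKd reprK. Qed.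

Let form_linear z a x y : form z (a *: x + y) = a * form z x + form z y.
Proof.
have E : ofL2 (a *: x + y) = a *: ofL2 x + ofL2 y %[ae mu].
  have Exy : a *: x + y = \pi_L2 (a *: repr x + repr y).
    rewrite -[LHS]/(L2_add (L2_scale a x) y) -{1}(reprK x) -{1}(reprK y).
    by rewrite (piZ a (repr x)) piD.
  apply: filterS (repr_ae (a *: repr x + repr y)) => t Et _.
  by rewrite Exy /ofL2 Et// raddfD/= linearZ.
have iM u : Cintegrable mu (fun t => (ofL2 z t)^* * ofL2 u t)%C.
  by apply: Cintegrable_conjM; exact: ofL2_in.
rewrite /form -CintegralZ// -CintegralD//; last first.
  have := @Cintegrable_conjM (ofL2 z) (a *: ofL2 x).
  move=> /(_ (ofL2_in z)).
  have -> : a *: ofL2 x \in L2fun by rewrite rpredZ// ofL2_in.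
  move=> /(_ isT); congr (Cintegrable mu _); apply/funext => t.
  by rewrite mulrCA.
have EF : (fun t => (ofL2 z t)^* * (a *: ofL2 x + ofL2 y) t)%C =
    (fun t => a * ((ofL2 z t)^*%C * ofL2 x t)) +
    (fun t => (ofL2 z t)^*%C * ofL2 y t).
  by apply/funext => t; rewrite !fctE mulrDr mulrCA.
rewrite -EF; apply: ae_eq_Cintegral => //.
- by apply: Cintegrable_conjM; rewrite ?ofL2_in// rpredD ?rpredZ ?ofL2_in.
- by apply: filterS E => t E _; rewrite E.
Qed.

Let form_conj x y : form y x = ((form x y)^*)%C.
Proof.
have [i1 i2] : Cintegrable mu (fun t => (ofL2 x t)^* * ofL2 y t)%C.
  by apply: Cintegrable_conjM; exact: ofL2_in.
rewrite /form /Cintegral; apply/eqP; rewrite eq_complex /=.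
apply/andP; split; apply/eqP.
  apply: eq_Rintegral => t _.
  by case: (ofL2 x t) (ofL2 y t) => [a b] [u v] /=; ring.
rewrite -[RHS]mulN1r -RintegralZl//; apply: eq_Rintegral => t _.
by case: (ofL2 x t) (ofL2 y t) => [a b] [u v] /=; ring.
Qed.

Let formxx x :
  form x x = (\int[mu]_t (Re (ofL2 x t) ^+ 2 + Im (ofL2 x t) ^+ 2))%:C%C.
Proof.
rewrite /form /Cintegral; apply/eqP; rewrite eq_complex /=.
apply/andP; split; apply/eqP.
  by apply: eq_Rintegral => t _; case: (ofL2 x t) => [a b] /=; ring.
rewrite (@eq_Rintegral _ _ _ mu setT (cst 0)); first by rewrite Rintegral_cst ?mul0r.
by move=> t _; case: (ofL2 x t) => [a b] /=; ring.
Qed.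

Let form_ge0 x : 0 <= form x x.
Proof.
by rewrite formxx ler0c; apply: Rintegral_ge0 => t _; rewrite addr_ge0 ?sqr_ge0.
Qed.

Let form_eq0 x : form x x = 0 -> x = 0.
Proof.
rewrite formxx => -[]; set h := fun t => _ => h0.
have ih : mu.-integrable setT (EFin \o h).
  have /andP[x1 x2] := ofL2_in x.
  rewrite (_ : _ \o _ = (EFin \o (fun t => Re (ofL2 x t) ^+ 2)%R) \+
                        (EFin \o (fun t => Im (ofL2 x t) ^+ 2)%R))%E//.
  apply: integrableD => //; exact: Lfun2_integrable_sqr.
have h_ge0 t : 0 <= h t by rewrite addr_ge0 ?sqr_ge0.
have : (\int[mu]_t `|(h t)%:E|)%E = 0%E.
  under eq_integral do rewrite gee0_abs ?lee_fin//.
  by rewrite -[LHS]fineK ?(integrable_fin_num _ ih)// [fine _]h0.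
move/(ae_eq_integral_abs mu measurableT (measurable_int mu ih)) => ae0.
rewrite -(reprK x); apply/L2P; apply: filterS ae0 => t /(_ I) /= [ht] _.
rewrite -[RHS]/(0 : R[i]); apply/eqP; rewrite eq_complex /=.
by move/eqP: ht; rewrite paddr_eq0 ?sqr_ge0// !sqrf_eq0.
Qed.

HB.instance Definition _ := Lmodule_isPreHilbert.Build R L2
  form_linear form_conj form_ge0 form_eq0.

Lemma inner_toL2 f g : f \in L2fun -> g \in L2fun ->
  inner (toL2 f) (toL2 g) = Cintegral mu (fun t => (f t)^* * g t)%C.
Proof. exact: formE. Qed.

End L2.

Section extension.
Variables (R : realType) (U V : normedModType R[i]).

Definition bounded_op (A : U -> V) : Prop := linear A /\ continuous A.

(* Extension by continuity of [i t |-> A t], defined for [t] in [D]: its value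
   at [x] is the limit of [A t] as [i t] tends to [x] with [t] in [D]. *)
Definition ext_cont (X : Type) (D : set X) (i : X -> U) (A : X -> V) (x : U)
    : V :=
  lim (A @ filter_from (nbhs x) (fun B => D `&` (i @^-1` B))).

End extension.

Section schwartz.
Variable R : realType.

(* [false] stands for d/dq and [true] for d/dp *)
Definition partials (w : seq bool) (g : R * R -> R) : R * R -> R :=
  foldr (fun b h => 'D_(if b then (0, 1) else (1, 0) : R * R) h) g w.

Definition rschwartz (g : R * R -> R) : Prop :=
  (forall w u, differentiable (partials w g) u) /\
  (forall (a b : nat) w, exists M : R, forall q p : R,
     `|q ^+ a * p ^+ b * partials w g (q, p)| <= M).

Definition schwartz : set (R * R -> R[i]) :=
  [set f : R * R -> R[i] | rschwartz (Re \o f) /\ rschwartz (Im \o f)].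

End schwartz.
Arguments schwartz R : clear implicits.

Section twisted_product.
Variable R : realType.
Implicit Types f g : R * R -> R[i].

Local Notation leb := (@lebesgue_measure R).
Local Notation leb2 := (leb \x leb)%E.

Definition expi (t : R) : R[i] := (cos t +i* sin t)%C.

(* u'Jv *)
Definition symp (u v : R * R) : R := u.1 * v.2 - u.2 * v.1.

(* The inner integral is in [v], the outer one in [w]. *)
Definition twisted f g (u : R * R) : R[i] :=
  ((4 * pi ^+ 2)^-1)%:C%C *
  Cintegral leb2 (fun w => Cintegral leb2 (fun v =>
    f v * g w * expi (symp u v + symp v w + symp w u))).

Definition wigner f (u : R * R) : R[i] :=
  let: (x, y) := u in
  ((Num.sqrt (2 * pi))^-1)%:C%C *
  Cintegral leb (fun z =>
    f ((x + y) / Num.sqrt 2, z) * expi ((x - y) * z / Num.sqrt 2)).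

Definition f0 (u : R * R) : R[i] :=
  (2 * expR (- (u.1 ^+ 2 + u.2 ^+ 2) / 2))%:C%C.

Definition h0 (x : R) : R[i] := (Num.sqrt 2 * expR (- x ^+ 2 / 2))%:C%C.

Lemma norm1_ge0 : 0 <= (Num.sqrt (4 * pi : R))^-1.
Proof. by rewrite invr_ge0 sqrtr_ge0. Qed.

Lemma norm2_ge0 : 0 <= (4 * pi : R)^-1.
Proof. by rewrite invr_ge0 mulr_ge0// pi_ge0. Qed.

(* The normalizations (4 pi)^(-1/2) and (4 pi)^(-1) of the inner products are
   put in the measures. *)
Definition mu1 : {measure set _ -> \bar R} := mscale (NngNum norm1_ge0) leb.
Definition mu2 : {measure set _ -> \bar R} := mscale (NngNum norm2_ge0) leb2.

End twisted_product.

Notation L2R R := (L2 (mu1 R)).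
Notation L2R2 R := (L2 (mu2 R)).

Section operators.
Variable R : realType.
Implicit Types f g : R * R -> R[i].

Local Notation S2 := (schwartz R).
Local Notation cls1 := (@toL2 _ _ R (mu1 R)).
Local Notation cls2 := (@toL2 _ _ R (mu2 R)).

Definition lreg f : L2R2 R -> L2R2 R :=
  ext_cont S2 cls2 (fun g => cls2 (twisted f g)).

Definition W : L2R2 R -> L2R2 R :=
  ext_cont S2 cls2 (fun g => cls2 (wigner g)).

Definition Winv : L2R2 R -> L2R2 R := 'pinv_(fun=> 0) setT W.

Definition tensor (phi psi : L2R R) : L2R2 R :=
  cls2 (fun u => ofL2 phi u.1 * ofL2 psi u.2).

(* The bounded operator A (x) B of L^2(R) (x) L^2(R) = L^2(R^2), which is
   determined by its values on the elementary tensors. *)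
Definition tensor_op (A B : L2R R -> L2R R) : L2R2 R -> L2R2 R :=
  get [set T | bounded_op T /\
    forall phi psi, T (tensor phi psi) = tensor (A phi) (B psi)].

Definition Pop : L2R2 R -> L2R R :=
  get [set T | bounded_op T /\
    forall phi psi, T (tensor phi psi) = inner (cls1 (@h0 R)) psi *: phi].

Definition Qop (phi : L2R R) : L2R2 R := tensor phi (cls1 (@h0 R)).

Definition omega g : R[i] := inner (cls2 (@f0 R)) (cls2 (twisted g (@f0 R))).

Definition K : set (R * R -> R[i]) :=
  [set g | S2 g /\ twisted g (@f0 R) = g].

Definition K0 : set (R * R -> R[i]) :=
  [set g | S2 g /\ twisted g (@f0 R) = 0].

(* [eta] exhibits [H] as the completion of the prehilbert space S_2/K_0: it is
   the projection S_2 -> S_2/K_0 followed by the inclusion in the completion.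
   Only its values on Schwartz functions are relevant. *)
Record is_gns (H : hilbertType R) (eta : (R * R -> R[i]) -> H) : Prop := {
  gns_linear : forall (a : R[i]) f g, S2 f -> S2 g ->
    eta (a *: f + g) = a *: eta f + eta g;
  gns_ker : forall g, S2 g -> (eta g = 0 <-> K0 g);
  gns_inner : forall f g, S2 f -> S2 g ->
    inner (eta g) (eta f) = omega (twisted (fun u => (g u)^*%C) f);
  gns_dense : closure (eta @` S2) = setT }.

Section gns.
Variables (H : hilbertType R) (eta : (R * R -> R[i]) -> H).

Definition pi_omega f : H -> H := ext_cont S2 eta (fun g => eta (twisted f g)).

(* [V] is relevant only on the L^2-closure of [K], which it maps onto [H]. *)
Definition V : L2R2 R -> H := ext_cont K cls2 eta.

Definition Vinv : H -> L2R2 R := 'pinv_(fun=> 0) (closure (cls2 @` K)) V.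

Definition pi_s f : L2R R -> L2R R :=
  Pop \o W \o Vinv \o pi_omega f \o V \o Winv \o Qop.

End gns.

End operators.

(* Main.v *)
(* Write e_a(x) = exp(a x - x^2/2) for complex a. The Wigner transformation maps
   an explicit Gaussian, the wave w_(a,b), to e_a (x) e_b. Both families are total,
   by the injectivity of the Fourier transformation on L^1, and have the same Gram
   matrix, so W is unitary. By Fubini,
     (w_(a,b) | f x g) = (2 pi)^-1 int f(v) (G_v w_(a,b) | g) dv,
   where G_v w_(a,b) = k_a(v) w_(a',b) with a' = a'(a, v), and G_v preserves the
   Gram matrix of the waves. Hence pi(f) is bounded, and its matrix coefficient
   between w_(a',b') and w_(a,b) is a function of (a', a) times (e_b' | e_b): the
   operator W pi(f) W^-1 acts on the first factor only, as A (x) 1.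
   Since g x f_0 = W^-1 (1 (x) |h_0)(h_0|) W g, the space K corresponds under W to
   L^2(R) (x) h_0, where V intertwines pi(f) with pi_omega(f); thus A = pi_s(f). *)

From HB Require Import structures.
From mathcomp Require Import all_boot all_order all_algebra.
From mathcomp Require Import complex.
From mathcomp Require Import all_classical all_reals all_analysis.
From mathcomp Require Import measurable_realfun ring lra.
Require Import Defs.

Set Implicit Arguments.
Unset Strict Implicit.
Unset Printing Implicit Defensive.

Import Order.TTheory GRing.Theory Num.Theory.
Import numFieldNormedType.Exports.

Local Open Scope classical_set_scope.
Local Open Scope ring_scope.

Local Notation Re := (@complex.Re _).
Local Notation Im := (@complex.Im _).

(** * Complex-valued integrals *)

Section modulus.
Variable R : realType.
Implicit Types z w : R[i].

(** In the Wigner picture G_v is a reflection of phase space acting on the first tensor factor. It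
    is unitary, which is why Gram matrices are preserved, and left multiplication by f is an average
    of such reflections with density f / (2 pi), which is why the second factor is never touched.
    The obstacle is the nature of the operators in the statement: each is a limit along a filter, a
    choice by [get], or a partial inverse, and none is linear, bounded or well determined by
    definition. Each is therefore first pinned down by an estimate or by its values on a total
    family, and only that characterization is used afterwards. Moreover [toL2] sends a function that
    is not square integrable to 0, and [K] compares functions rather than classes. So f x g must be
    shown to be Schwartz, and the Wigner transform square integrable, before their classes say
    anything. Gaussians make all this computable: every integral reduces to the one of [coh],
    followed by algebra in which only s^2 = 1/2 and i^2 = -1 enter. *)

Lemma complex_ext z w : Re z = Re w -> Im z = Im w -> z = w.
Proof. by case: z w => [a b] [c d] /= -> ->. Qed.

(* Equivalent to the modulus, and free of square roots. *)
Definition n1 z : R := `|Re z| + `|Im z|.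

Lemma n1_ge0 z : 0 <= n1 z.
Proof. by rewrite addr_ge0. Qed.

Lemma Re_le_n1 z : `|Re z| <= n1 z.
Proof. by rewrite lerDl. Qed.

Lemma Im_le_n1 z : `|Im z| <= n1 z.
Proof. by rewrite lerDr. Qed.

Lemma n1D z w : n1 (z + w) <= n1 z + n1 w.
Proof.
case: z w => [a b] [c d]; rewrite /n1/=.
have := ler_normD a c; have := ler_normD b d; lra.
Qed.

Lemma n1M z w : n1 (z * w) <= n1 z * n1 w.
Proof.
case: z w => [a b] [c d]; rewrite /n1/=.
have := ler_normB (a * c) (b * d); have := ler_normD (a * d) (b * c).
rewrite !normrM; nra.
Qed.

Lemma n1N z : n1 (- z) = n1 z.
Proof. by case: z => a b; rewrite /n1/= !normrN. Qed.

Lemma n1_conj z : n1 (z^*)%C = n1 z.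
Proof. by case: z => a b; rewrite /n1/= !normrN. Qed.

Lemma n1_real (a : R) : n1 a%:C%C = `|a|.
Proof. by rewrite /n1/= normr0 addr0. Qed.

Lemma n1_eq0 z : n1 z <= 0 -> z = 0.
Proof.
case: z => a b; rewrite /n1/= => h.
have := normr_ge0 a; have := normr_ge0 b => hb ha.
have /eqP : `|a| = 0 by lra.
have /eqP : `|b| = 0 by lra.
by rewrite !normr_eq0 => /eqP -> /eqP ->.
Qed.

(** The factor 2 in the later bounds on oscillating integrands comes from here; the sharp constant
    would be sqrt 2. *)
Lemma n1_expi (t : R) : n1 (expi t) <= 2.
Proof.
rewrite /n1/=; have := cos_le1 t; have := cos_geN1 t.
have := sin_le1 t; have := sin_geN1 t => h1 h2 h3 h4.
have : `|cos t| <= 1 by rewrite ler_norml h3 h4.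
have : `|sin t| <= 1 by rewrite ler_norml h1 h2.
lra.
Qed.

Lemma expiD (s t : R) : expi (s + t) = expi s * expi t.
Proof. by apply: complex_ext => /=; rewrite ?cosD ?sinD //; ring. Qed.

Lemma expi0 : expi (0 : R) = 1.
Proof. by apply: complex_ext => /=; rewrite ?cos0 ?sin0. Qed.

Lemma expi_conj (t : R) : ((expi t)^*)%C = expi (- t).
Proof. by apply: complex_ext => /=; rewrite ?cosN ?sinN. Qed.

Definition cexp z : R[i] := (expR (Re z))%:C%C * expi (Im z).

Lemma cexpD z w : cexp (z + w) = cexp z * cexp w.
Proof.
case: z w => [a b] [c d]; rewrite /cexp/= expRD expiD rmorphM/=; ring.
Qed.

Lemma cexp0 : cexp 0 = 1.
Proof. by rewrite /cexp/= expR0 expi0 mulr1. Qed.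

Lemma cexp_conj z : ((cexp z)^*)%C = cexp (z^*)%C.
Proof.
case: z => a b; apply: complex_ext; rewrite /cexp/= !mul0r ?subr0 ?addr0 ?cosN//.
by rewrite sinN mulrN.
Qed.

Lemma n1_cexp z : n1 (cexp z) <= 2 * expR (Re z).
Proof.
rewrite (le_trans (n1M _ _))// n1_real ger0_norm ?expR_ge0// mulrC.
by rewrite ler_wpM2r ?expR_ge0// n1_expi.
Qed.

Lemma cexp_neq0 z : cexp z != 0.
Proof.
apply/eqP => h; have := cexpD z (- z); rewrite subrr cexp0 h mul0r => /eqP.
by rewrite oner_eq0.
Qed.

Lemma expiE (t : R) : expi t = cexp (0 +i* t)%C.
Proof. by rewrite /cexp/= expR0 mul1r. Qed.

Lemma expR_cexp (t : R) : (expR t)%:C%C = cexp t%:C%C.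
Proof. by rewrite /cexp/= expi0 mulr1. Qed.

Lemma halfC : 2^-1 = (2^-1 : R)%:C%C :> R[i].
Proof. by rewrite -[2]/(2%:R) -(rmorph_nat (real_complex R)) fmorphV. Qed.

End modulus.

Section Cmeasurable.
Context d (T : measurableType d) (R : realType).
Implicit Types f g : T -> R[i].

Definition cmeas f :=
  measurable_fun setT (Re \o f) /\ measurable_fun setT (Im \o f).

Lemma cmeasP f : measurable_fun setT (fun x => Re (f x)) ->
  measurable_fun setT (fun x => Im (f x)) -> cmeas f.
Proof. by []. Qed.

Lemma cmeas_cst z : cmeas (fun=> z).
Proof. by apply: cmeasP; exact: measurable_cst. Qed.

Lemma cmeasD f g : cmeas f -> cmeas g -> cmeas (fun x => f x + g x).
Proof.
move=> [f1 f2] [g1 g2]; split.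
  rewrite (_ : _ \o _ = (Re \o f) \+ (Re \o g)); first exact: measurable_funD.
  by apply/funext => x /=; rewrite raddfD.
rewrite (_ : _ \o _ = (Im \o f) \+ (Im \o g)); first exact: measurable_funD.
by apply/funext => x /=; rewrite raddfD.
Qed.

Lemma cmeasM f g : cmeas f -> cmeas g -> cmeas (fun x => f x * g x).
Proof.
move=> [f1 f2] [g1 g2]; split.
  rewrite (_ : _ \o _ = ((Re \o f) \* (Re \o g)) \- ((Im \o f) \* (Im \o g))).
    by apply: measurable_funB; exact: measurable_funM.
  by apply/funext => x /=; case: (f x) (g x) => [a b] [a' b'].
rewrite (_ : _ \o _ = ((Re \o f) \* (Im \o g)) \+ ((Im \o f) \* (Re \o g))).
  by apply: measurable_funD; exact: measurable_funM.
by apply/funext => x /=; case: (f x) (g x) => [a b] [a' b'].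
Qed.

Lemma cmeasZ z f : cmeas f -> cmeas (fun x => z * f x).
Proof. by move=> mf; apply: cmeasM => //; exact: cmeas_cst. Qed.

Lemma cmeasN f : cmeas f -> cmeas (fun x => - f x).
Proof.
move=> mf; rewrite (_ : (fun x => _) = fun x => -1 * f x).
  exact: cmeasZ.
by apply/funext => x; rewrite mulN1r.
Qed.

Lemma cmeas_conj f : cmeas f -> cmeas (fun x => (f x)^*)%C.
Proof.
move=> [f1 f2]; split.
  by rewrite (_ : _ \o _ = Re \o f)//; apply/funext => x /=; case: (f x).
rewrite (_ : _ \o _ = \- (Im \o f)); first exact: measurableT_comp.
by apply/funext => x /=; case: (f x).
Qed.

Lemma cmeas_real (f : T -> R) : measurable_fun setT f ->
  cmeas (fun x => (f x)%:C%C).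
Proof. by move=> mf; split => //; exact: measurable_cst. Qed.

Lemma cmeas_expi (f : T -> R) : measurable_fun setT f ->
  cmeas (fun x => expi (f x)).
Proof.
move=> mf; split; rewrite /expi/=.
  apply: (measurableT_comp (f:=@cos R)) => //.
  by apply: continuous_measurable_fun; exact: continuous_cos.
apply: (measurableT_comp (f:=@sin R)) => //.
by apply: continuous_measurable_fun; exact: continuous_sin.
Qed.

Lemma cmeas_cexp f : cmeas f -> cmeas (fun x => cexp (f x)).
Proof.
move=> [f1 f2]; apply: cmeasM; last exact: cmeas_expi.
by apply: cmeas_real; exact: measurableT_comp.
Qed.

End Cmeasurable.

Lemma cmeas_comp d1 d2 (T1 : measurableType d1) (T2 : measurableType d2)
    (R : realType) (h : T1 -> T2) (f : T2 -> R[i]) :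
  measurable_fun setT h -> cmeas f -> cmeas (fun x => f (h x)).
Proof.
by move=> mh [f1 f2]; split; [exact: (measurableT_comp f1)|
  exact: (measurableT_comp f2)].
Qed.

Section Cintegral_theory.
Context d (T : measurableType d) (R : realType).
Variable mu : {measure set T -> \bar R}.
Implicit Types f g : T -> R[i].

Lemma dominated_Cintegrable f (G : T -> R) : cmeas f ->
  mu.-integrable setT (EFin \o G) -> (forall x, n1 (f x) <= G x) ->
  Cintegrable mu f.
Proof.
move=> [f1 f2] iG fG; split.
  apply: (le_integrable _ _ _ iG) => //; first exact: measurableT_comp.
  move=> x _ /=; rewrite lee_fin (le_trans _ (ler_norm _))//.
  by rewrite (le_trans _ (fG x))// lerDl.
apply: (le_integrable _ _ _ iG) => //; first exact: measurableT_comp.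
move=> x _ /=; rewrite lee_fin (le_trans _ (ler_norm _))//.
by rewrite (le_trans _ (fG x))// lerDr.
Qed.

Lemma Cintegrable_meas f : Cintegrable mu f -> cmeas f.
Proof.
move=> [/measurable_int f1 /measurable_int f2].
by split; exact/measurable_EFinP.
Qed.

Lemma Cintegrable_n1 f : Cintegrable mu f ->
  mu.-integrable setT (EFin \o (fun x => n1 (f x))).
Proof.
move=> [f1 f2]; rewrite (_ : _ \o _ =
  (EFin \o (fun x => `|Re (f x)|%R)) \+ (EFin \o (fun x => `|Im (f x)|%R)))%E//.
by apply: integrableD => //; exact: integrable_norm.
Qed.

Lemma n1_Cintegral f : Cintegrable mu f ->
  n1 (Cintegral mu f) <= \int[mu]_x n1 (f x).
Proof.
move=> [f1 f2]; rewrite /n1/= RintegralD//; [|exact: integrable_norm..].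
by rewrite lerD//; exact: le_normr_Rintegral.
Qed.

Lemma n1_Cintegral_le f (G : T -> R) : cmeas f ->
  mu.-integrable setT (EFin \o G) -> (forall x, n1 (f x) <= G x) ->
  n1 (Cintegral mu f) <= \int[mu]_x G x.
Proof.
move=> mf iG fG; have If := dominated_Cintegrable mf iG fG.
apply: (le_trans (n1_Cintegral If)); apply: le_Rintegral => //.
exact: Cintegrable_n1.
Qed.

Lemma eq_Cintegral f g : f =1 g -> Cintegral mu f = Cintegral mu g.
Proof. by move=> /funext ->. Qed.

Lemma CintegrableD f g : Cintegrable mu f -> Cintegrable mu g ->
  Cintegrable mu (fun x => f x + g x).
Proof.
move=> [f1 f2] [g1 g2]; split.
  rewrite (_ : _ \o _ = (EFin \o (Re \o f)) \+ (EFin \o (Re \o g)))%E.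
    exact: integrableD.
  by apply/funext => x /=; rewrite raddfD.
rewrite (_ : _ \o _ = (EFin \o (Im \o f)) \+ (EFin \o (Im \o g)))%E.
  exact: integrableD.
by apply/funext => x /=; rewrite raddfD.
Qed.

Lemma CintegrableZ z f : Cintegrable mu f -> Cintegrable mu (fun x => z * f x).
Proof.
move=> If; have n1f := Cintegrable_n1 If.
apply: (@dominated_Cintegrable _ (fun x => n1 z * n1 (f x))).
- exact: cmeasZ (Cintegrable_meas If).
- exact: (integrableZl _ (n1 z) n1f).
- by move=> x; exact: n1M.
Qed.

Lemma CintegrableN f : Cintegrable mu f -> Cintegrable mu (fun x => - f x).
Proof.
move=> If; rewrite (_ : (fun x => _) = fun x => -1 * f x).
  exact: CintegrableZ.
by apply/funext => x; rewrite mulN1r.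
Qed.

Lemma CintegralDf f g : Cintegrable mu f -> Cintegrable mu g ->
  Cintegral mu (fun x => f x + g x) = Cintegral mu f + Cintegral mu g.
Proof. exact: CintegralD. Qed.

Lemma CintegralN f : Cintegrable mu f ->
  Cintegral mu (fun x => - f x) = - Cintegral mu f.
Proof.
move=> If; rewrite -mulN1r -CintegralZ//.
by apply: eq_Cintegral => x; rewrite mulN1r.
Qed.

Lemma CintegralB f g : Cintegrable mu f -> Cintegrable mu g ->
  Cintegral mu (fun x => f x - g x) = Cintegral mu f - Cintegral mu g.
Proof.
by move=> If Ig; rewrite CintegralDf ?CintegralN//; exact: CintegrableN.
Qed.

Lemma CintegralZr z f : Cintegrable mu f ->
  Cintegral mu (fun x => f x * z) = Cintegral mu f * z.
Proof.
move=> If; rewrite mulrC -CintegralZ//.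
by apply: eq_Cintegral => x; rewrite mulrC.
Qed.

Lemma Cintegrable_sum (I : Type) (s : seq I) (F : I -> T -> R[i]) :
  (forall i, Cintegrable mu (F i)) ->
  Cintegrable mu (fun x => \sum_(i <- s) F i x).
Proof.
move=> IF; elim: s => [|i s IH].
  rewrite (_ : (fun x => _) = fun=> 0).
    split; rewrite (_ : _ \o _ = cst 0%E)//; exact: integrable0.
  by apply/funext => x; rewrite big_nil.
rewrite (_ : (fun x => _) = fun x => F i x + \sum_(j <- s) F j x).
  exact: CintegrableD.
by apply/funext => x; rewrite big_cons.
Qed.

Lemma Cintegral_sum (I : Type) (s : seq I) (F : I -> T -> R[i]) :
  (forall i, Cintegrable mu (F i)) ->
  Cintegral mu (fun x => \sum_(i <- s) F i x) =
  \sum_(i <- s) Cintegral mu (F i).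
Proof.
move=> IF; elim: s => [|i s IH].
  (* The zero function is written as a product so that [CintegralZ] can pull out a factor 0; the
     same device recurs below. *)
  rewrite big_nil; rewrite (_ : (fun x => _) = fun=> 0*0).
    rewrite CintegralZ ?mul0r//.
    split; rewrite (_ : _ \o _ = cst 0%E)//; exact: integrable0.
  by apply/funext => x; rewrite big_nil mul0r.
rewrite big_cons -IH -CintegralDf//; last exact: Cintegrable_sum.
by apply: eq_Cintegral => x; rewrite big_cons.
Qed.

Lemma Cintegral_conj f : Cintegrable mu f ->
  Cintegral mu (fun x => (f x)^*)%C = ((Cintegral mu f)^*)%C.
Proof.
move=> [f1 f2]; apply: complex_ext => /=.
  by apply: eq_Rintegral => x _; case: (f x).
rewrite -[RHS]mulN1r -RintegralZl//; apply: eq_Rintegral => x _.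
by case: (f x) => a b /=; rewrite mulN1r.
Qed.

Lemma Cintegral_real (f : T -> R) :
  Cintegral mu (fun x => (f x)%:C%C) = (\int[mu]_x f x)%:C%C.
Proof.
apply: complex_ext => //=; rewrite (@eq_Rintegral _ _ _ mu setT (cst 0)) //.
by rewrite Rintegral_cst ?mul0r.
Qed.

End Cintegral_theory.

(** * Fubini for integrands dominated by a product of integrable functions *)

Section Cfubini.
Context d1 d2 (T1 : measurableType d1) (T2 : measurableType d2) (R : realType).
Variable m1 : {sigma_finite_measure set T1 -> \bar R}.
Variable m2 : {sigma_finite_measure set T2 -> \bar R}.
Variables (G : T1 -> R) (H : T2 -> R).
Hypotheses (iG : m1.-integrable setT (EFin \o G))
           (iH : m2.-integrable setT (EFin \o H)).
Hypotheses (G0 : forall x, 0 <= G x) (H0 : forall y, 0 <= H y).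

Lemma integrable_prod :
  (m1 \x m2)%E.-integrable setT (EFin \o (fun u => G u.1 * H u.2)).
Proof.
have mG : measurable_fun setT G.
  by apply/measurable_EFinP; exact: (measurable_int m1).
have mH : measurable_fun setT H.
  by apply/measurable_EFinP; exact: (measurable_int m2).
apply/integrable12ltyP.
  apply/measurable_EFinP; apply: measurable_funM.
    exact: (measurableT_comp mG measurable_fst).
  exact: (measurableT_comp mH measurable_snd).
under eq_integral => x _.
  under eq_integral => y _ do rewrite /= ger0_norm ?mulr_ge0// EFinM.
  rewrite (integralZl measurableT iH (G x)).
  over.
have := integrable_fin_num measurableT iH.
move=> /fineK <-.
under eq_integral do rewrite -EFinM mulrC EFinM.
rewrite (integralZl measurableT iG)//.
have := integrable_fin_num measurableT iG.
by move=> /fineK <-; rewrite -EFinM ltry.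
Qed.

Lemma Rfubini (F : T1 * T2 -> R) : measurable_fun setT F ->
    (forall x y, `|F (x, y)| <= G x * H y) ->
  [/\ measurable_fun setT (fun x => \int[m2]_y F (x, y)),
      \int[m1]_x \int[m2]_y F (x, y) = \int[(m1 \x m2)%E]_u F u &
      \int[m2]_y \int[m1]_x F (x, y) = \int[(m1 \x m2)%E]_u F u].
Proof.
move=> mF FGH.
have iF : (m1 \x m2)%E.-integrable setT (EFin \o F).
  apply: (le_integrable _ _ _ integrable_prod) => //.
    exact/measurable_EFinP.
  by move=> [x y] _ /=; rewrite lee_fin [leRHS]ger0_norm ?mulr_ge0.
have i2 x : m2.-integrable setT (fun y => (F (x, y))%:E).
  apply: (le_integrable _ _ _ (integrableZl _ (G x) iH)) => //.
    by apply/measurable_EFinP; exact: measurable_fun_pair2.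
  by move=> y _ /=; rewrite lee_fin [leRHS]ger0_norm ?mulr_ge0.
have i1 y : m1.-integrable setT (fun x => (F (x, y))%:E).
  apply: (le_integrable _ _ _ (integrableZl _ (H y) iG)) => //.
    by apply/measurable_EFinP; exact: measurable_fun_pair1.
  move=> x _ /=; rewrite lee_fin [leRHS]ger0_norm ?mulr_ge0//.
  by rewrite mulrC.
have FE x : (\int[m2]_y F (x, y))%:E = (\int[m2]_y (F (x, y))%:E)%E.
  by rewrite fineK//; exact: integrable_fin_num (i2 x).
have GE y : (\int[m1]_x F (x, y))%:E = (\int[m1]_x (F (x, y))%:E)%E.
  by rewrite fineK//; exact: integrable_fin_num (i1 y).
split.
- apply/measurable_EFinP; under [X in measurable_fun _ X]eq_fun do rewrite /= FE.
  exact: measurable_fubini_F iF.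
- rewrite /Rintegral; congr fine.
  under eq_integral do rewrite FE.
  exact: integral12_prod_meas1 iF.
- rewrite /Rintegral; congr fine.
  under eq_integral do rewrite GE.
  exact: integral21_prod_meas1 iF.
Qed.

Variable F : T1 * T2 -> R[i].
Hypotheses (mF : cmeas F) (FGH : forall x y, n1 (F (x, y)) <= G x * H y).

Let FR x y : `|Re (F (x, y))| <= G x * H y.
Proof. by apply: le_trans (FGH x y); rewrite /n1 lerDl. Qed.
Let FI x y : `|Im (F (x, y))| <= G x * H y.
Proof. by apply: le_trans (FGH x y); rewrite /n1 lerDr. Qed.

Lemma Cfubini_prod_integrable : Cintegrable (m1 \x m2)%E F.
Proof. by apply: dominated_Cintegrable integrable_prod _ => // -[]. Qed.

Lemma Cfubini_integrable2 x : Cintegrable m2 (fun y => F (x, y)).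
Proof.
apply: (dominated_Cintegrable _ (integrableZl _ (G x) iH)) => // .
by case: mF => f1 f2; split;
  [exact: measurable_fun_pair2 f1|exact: measurable_fun_pair2 f2].
Qed.

Lemma Cfubini_integrable1 y : Cintegrable m1 (fun x => F (x, y)).
Proof.
apply: (dominated_Cintegrable _ (integrableZl _ (H y) iG)) => //.
  by case: mF => f1 f2; split;
    [exact: measurable_fun_pair1 f1|exact: measurable_fun_pair1 f2].
by move=> x /=; rewrite mulrC.
Qed.

Lemma Cfubini_meas : cmeas (fun x => Cintegral m2 (fun y => F (x, y))).
Proof.
case: mF => f1 f2; split.
  by have [] := Rfubini f1 FR.
by have [] := Rfubini f2 FI.
Qed.

Lemma Cfubini_bound x :
  n1 (Cintegral m2 (fun y => F (x, y))) <= G x * \int[m2]_y H y.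
Proof.
rewrite -RintegralZl//; apply: n1_Cintegral_le => //.
  by have [] := Cintegrable_meas (Cfubini_integrable2 x).
exact: (integrableZl _ (G x) iH).
Qed.

Lemma Cfubini_integrable :
  Cintegrable m1 (fun x => Cintegral m2 (fun y => F (x, y))).
Proof.
apply: (dominated_Cintegrable Cfubini_meas
  (integrableZl measurableT (\int[m2]_y H y) iG)) => // x /=.
by rewrite mulrC Cfubini_bound.
Qed.

Lemma Cfubini1 : Cintegral m1 (fun x => Cintegral m2 (fun y => F (x, y))) =
  Cintegral (m1 \x m2)%E F.
Proof.
case: mF => f1 f2; apply: complex_ext => /=.
  by have [_ ->] := Rfubini f1 FR.
by have [_ ->] := Rfubini f2 FI.
Qed.

Lemma Cfubini2 : Cintegral m2 (fun y => Cintegral m1 (fun x => F (x, y))) =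
  Cintegral (m1 \x m2)%E F.
Proof.
case: mF => f1 f2; apply: complex_ext => /=.
  by have [_ _ ->] := Rfubini f1 FR.
by have [_ _ ->] := Rfubini f2 FI.
Qed.

Lemma Cfubini : Cintegral m1 (fun x => Cintegral m2 (fun y => F (x, y))) =
  Cintegral m2 (fun y => Cintegral m1 (fun x => F (x, y))).
Proof. by rewrite Cfubini1 Cfubini2. Qed.

End Cfubini.

(** * Elementary calculus on the line *)

Section calculus.
Variable R : realType.

(** A second order Taylor estimate survives integration over a parameter. This criterion therefore
    replaces differentiation under the integral sign: bound the integrand's remainder, integrate the
    bound, and conclude. *)
Lemma is_derive_quadratic (V : normedModType R) (f : V -> R) (a v : V) (l C : R) :
  (forall h, `|f (h *: v + a) - f a - h * l| <= C * h ^+ 2) ->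
  is_derive a v f l.
Proof.
move=> hf; suff : (fun h => h^-1 *: ((f \o shift a) (h *: v) - f a)) @ 0^' --> l.
  by move=> fl; split; [exact: cvgP fl|exact/cvg_lim].
have hf' (h : R) : h != 0 -> `|l - h^-1 *: ((f \o shift a) (h *: v) - f a)| <= `|C| * `|h|.
  move=> h0; rewrite distrC -(ler_pM2l (x := `|h|)) ?normr_gt0//.
  rewrite -normrM mulrBr /= -[_ *: _]/(_ * _) mulrA divff// mul1r.
  apply: (le_trans (hf h)); rewrite (_ : `|h| * _ = `|C| * `|h| ^+ 2); last by ring.
  rewrite real_normK ?num_real//.
  by rewrite ler_wpM2r ?sqr_ge0 ?ler_norm.
apply/cvgrPdist_le => e e0; near=> h.
have h0 : h != 0 by near: h; exact: nbhs_dnbhs_neq.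
apply: (le_trans (hf' h h0)).
have C1 : 0 < `|C| + 1 by rewrite ltr_wpDl.
apply: (@le_trans _ _ ((`|C| + 1) * `|h|)).
  by rewrite ler_wpM2r// lerDl.
rewrite mulrC -ler_pdivlMr//; near: h; apply: nbhs_dnbhs.
apply: (@nbhs0_le _ R^o); by rewrite divr_gt0.
Unshelve. all: by end_near. Qed.

Lemma normr_sin_le (x : R) : `|sin x| <= `|x|.
Proof.
wlog x0 : x / 0 <= x.
  move=> H; have [/H//|/ltW x0] := leP 0 x.
  by rewrite -normrN -sinN -[leRHS]normrN; apply: H; rewrite oppr_ge0.
rewrite [leRHS]ger0_norm//.
have dsin (y : R) : y \in `]0, x[ -> is_derive y 1 (@sin R) (cos y).
  by move=> _; exact: is_derive_sin.
have [|c _] := @MVT_segment R sin cos 0 x x0 dsin.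
  by apply: continuous_subspaceT; exact: continuous_sin.
rewrite sin0 !subr0 => ->; rewrite normrM (ger0_norm x0).
by rewrite ler_piMl// ler_norml cos_geN1 cos_le1.
Qed.

Lemma cosB1E (x : R) : `|cos x - 1| = 2 * `|sin (x / 2)| ^+ 2.
Proof.
have -> : cos x = cos (x / 2 + x / 2) by congr cos; field.
rewrite cosD -!expr2 cos2sin2.
rewrite (_ : _ - 1 = - (2 * sin (x / 2) ^+ 2)); last by ring.
by rewrite normrN real_normK ?num_real// ger0_norm// mulr_ge0 ?sqr_ge0.
Qed.

Lemma cosB1_le (x : R) : `|cos x - 1| <= x ^+ 2.
Proof.
rewrite cosB1E.
have := normr_sin_le (x / 2); rewrite -(ler_pXn2r (n:=2)) ?nnegrE//.
rewrite (@real_normK _ (x / 2)) ?num_real// expr_div_n => h.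
have := sqr_ge0 x; lra.
Qed.

Lemma cosB1_le1 (x : R) : `|cos x - 1| <= `|x|.
Proof.
rewrite cosB1E.
have h2 : `|sin (x / 2)| <= 1 by rewrite ler_norml sin_geN1 sin_le1.
have := normr_sin_le (x / 2).
rewrite normrM (@ger0_norm _ (2^-1)) ?invr_ge0// => h1.
have := normr_ge0 (sin (x / 2)); nra.
Qed.

(** The mean value theorem gives sin x - x = x (cos c - 1) with c between 0 and x, and |cos c - 1|
    <= |c|. *)
Lemma sinB_le (x : R) : `|sin x - x| <= x ^+ 2.
Proof.
wlog x0 : x / 0 <= x.
  move=> H; have [/H//|/ltW x0] := leP 0 x.
  by rewrite -normrN opprD -sinN -sqrrN; apply: H; rewrite oppr_ge0.
have dsin (y : R) : y \in `]0, x[ -> is_derive y 1 (@sin R) (cos y).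
  by move=> _; exact: is_derive_sin.
have [|c cx] := @MVT_segment R sin cos 0 x x0 dsin.
  by apply: continuous_subspaceT; exact: continuous_sin.
rewrite sin0 !subr0 => ->; rewrite -[X in _ - X]mul1r -mulrBl normrM.
rewrite (ger0_norm x0) expr2 ler_wpM2r// (le_trans (cosB1_le1 _))//.
by move: cx; rewrite in_itv/= => /andP[c0 cx]; rewrite ger0_norm.
Qed.

Lemma n1_expiB1 (t : R) : n1 (expi t - 1 - (0 +i* t)%C) <= 2 * t ^+ 2.
Proof.
rewrite /n1/= !subr0; have := cosB1_le t; have := sinB_le t; lra.
Qed.

(** Fundamental theorem of calculus on [-n, n], then n tends to infinity: the truncated integrals
    converge by dominated convergence, while the boundary terms are at most 2 C / n. *)
Lemma is_derive_Rintegral0 (h h' : R -> R) (C : R) :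
    (forall x : R, is_derive x (1 : R) h (h' x)) -> continuous h' ->
    (@lebesgue_measure R).-integrable setT (EFin \o h') ->
    (forall x, `|h x| <= C / (1 + x ^+ 2)) ->
  \int[@lebesgue_measure R]_x h' x = 0.
Proof.
move=> dh ch' ih' hC.
pose g n := (EFin \o h') \_ `[- n%:R, n%:R].
have mh' : measurable_fun setT h' by exact: continuous_measurable_fun.
have mn n : measurable (`[- n%:R, n%:R]%classic : set R).
  exact: measurable_itv.
have := @dominated_convergence _ _ R (@lebesgue_measure R) setT measurableT
  g (EFin \o h') (fun x => `|(h' x)%:E|)%E.
case.
- move=> n; apply/(measurable_restrictT _ (mn n))/measurable_EFinP.
  exact: measurable_funTS.
- exact/measurable_EFinP.
- apply: aeW => x _; apply: cvg_near_cst; near=> n.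
  rewrite /g patchE ifT// inE/= in_itv/= -ler_norml.
  by near: n; exact: nbhs_infty_ger.
- exact: integrable_abse.
- apply: aeW => x n _; rewrite /g patchE; case: ifPn => // _.
  by rewrite abse0.
move=> _ _ cv.
(* The index starts at 1 because the fundamental theorem is applied on a nondegenerate interval. *)
have E n : (\int[@lebesgue_measure R]_x g n.+1 x = (h n.+1%:R - h (- n.+1%:R))%:E)%E.
  rewrite -integral_mkcond EFinB; apply: continuous_FTC2.
  - by rewrite (lt_trans (_ : _ < 0))// oppr_lt0.
  - exact: continuous_subspaceT.
  - have ch : continuous h.
      by move=> x; apply: differentiable_continuous; apply/derivable1_diffP.
    split; first by move=> x _.
      by apply: cvg_at_right_filter; exact: ch.
    by apply: cvg_at_left_filter; exact: ch.
  - by move=> x _; rewrite derive1E; exact: derive_val.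
have cv0 : (fun n => h n.+1%:R - h (- n.+1%:R)) @ \oo --> (0 : R).
  have C0 : 0 <= C by move: (hC 0); rewrite expr0n addr0 divr1; apply: le_trans.
  apply/norm_cvg0P; apply: (@squeeze_cvgr _ _ _ _ (cst 0) (fun n => 2 * C * n.+1%:R^-1)).
  - near=> n; rewrite normr_ge0/=.
    apply: (le_trans (ler_normB _ _)).
    have H (y : R) : y ^+ 2 = n.+1%:R ^+ 2 -> `|h y| <= C / n.+1%:R.
      move=> y2; apply: (le_trans (hC y)); rewrite y2 ler_wpM2l// lef_pV2 ?posrE//.
        have : 1 <= n.+1%:R :> R by rewrite ler1n.
        nra.
    have := H n.+1%:R erefl; have := H (- n.+1%:R); rewrite sqrrN => /(_ erefl).
    by rewrite (_ : 2 * C / _ = C / n.+1%:R + C / n.+1%:R); [move=> ? ?; exact: lerD|ring].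
  - exact: cvg_cst.
  - rewrite -[X in _ --> X](mulr0 (2 * C)).
    by apply: (@cvgM R); [exact: cvg_cst|exact: cvg_harmonic].
have cv' : (fun n => (h n.+1%:R - h (- n.+1%:R))%:E) @ \oo -->
    (\int[@lebesgue_measure R]_x (h' x)%:E)%E.
  rewrite -(funext E).
  by rewrite (cvg_shiftS (fun n => (\int[@lebesgue_measure R]_x g n x)%E)).
have cv0' : (fun n => (h n.+1%:R - h (- n.+1%:R))%:E) @ \oo --> 0%:E.
  by apply: cvg_EFin => //; exact: nearW.
by rewrite /Rintegral (cvg_unique _ cv' cv0').
Unshelve. all: by end_near. Qed.

End calculus.

(** * Affine substitutions in Lebesgue integrals *)

Section lebesgue_affine.
Variable R : realType.
Local Notation leb := (@lebesgue_measure R).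
Variables (c d : R).
Hypothesis c0 : 0 < c.

Let phi (x : measurableTypeR R) : measurableTypeR R := c * x + d.

Let mphi : measurable_fun setT phi.
Proof. by apply: measurable_funD => //; exact: measurable_funM. Qed.

Let pm : {measure set (measurableTypeR R) -> \bar R} :=
  measure_function_pushforward__canonical__measure_function_Measure leb mphi.

(** Both measures give the same value to every interval []a, b]], which determines Lebesgue
    measure. *)
Lemma lebesgue_measure_affine (A : set (measurableTypeR R)) : measurable A ->
  leb A = (c%:E * pushforward leb phi A)%E.
Proof.
move=> mA.
pose m := mscale (NngNum (ltW c0)) pm.
rewrite (@lebesgue_measure_unique _ m)// => _ [[a b]] _ <-.
rewrite -[RHS]/(c%:E * leb (phi @^-1` `]a, b]))%E.
rewrite (_ : phi @^-1` _ = `](a - d) / c, (b - d) / c]%classic); last first.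
  apply/seteqP; split => x /=; rewrite !in_itv/= /phi.
    by rewrite ltr_pdivrMr// ler_pdivlMr// ltrBlDr lerBrDr (mulrC x).
  by rewrite ltr_pdivrMr// ler_pdivlMr// ltrBlDr lerBrDr (mulrC x).
rewrite !lebesgue_measure_itv/= !lte_fin ltr_pM2r ?invr_gt0// ltrD2r.
case: ifPn => _; last by rewrite mule0.
by rewrite -!EFinD -EFinM; congr EFin; field; rewrite gt_eqF.
Qed.

Lemma ge0_integral_affine (f : measurableTypeR R -> \bar R) :
    measurable_fun setT f -> (forall x, 0 <= f x)%E ->
  (\int[leb]_x f x = c%:E * \int[leb]_x f (phi x))%E.
Proof.
move=> mf f0.
have := @ge0_integral_pushforward _ _ _ _ R phi mphi leb setT f measurableT mf.
rewrite preimage_setT => <-//.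
pose m := mscale (NngNum (ltW c0)) pm.
rewrite (@eq_measure_integral _ _ _ setT m)//; last first.
  by move=> A mA _; exact: lebesgue_measure_affine.
by rewrite ge0_integral_mscale.
Qed.

Lemma integrable_affine (f : measurableTypeR R -> R) :
  leb.-integrable setT (EFin \o f) ->
  leb.-integrable setT (EFin \o (fun x => f (c * x + d))).
Proof.
move=> /integrableP[mf If]; apply/integrableP; split.
  exact: (measurableT_comp mf).
have := @ge0_integral_affine (fun x => `|(f x)%:E|%E) .
rewrite /comp => H; move: If; rewrite H//; last exact: measurableT_comp.
rewrite (_ : (fun x : R => _) = fun x => `|(f (phi x))%:E|%E)//.
(* As c > 0, a finite value of c times the integral forces the integral itself to be finite. *)
case: integral => //=.
by move=> r; rewrite !ltry.
by rewrite gt0_muley ?lte_fin.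
Qed.

Lemma Rintegral_affine (f : measurableTypeR R -> R) :
  leb.-integrable setT (EFin \o f) ->
  \int[leb]_x f (c * x + d) = c^-1 * \int[leb]_x f x.
Proof.
move=> fi; have mf := measurable_int _ fi.
pose m := mscale (NngNum (ltW c0)) pm.
rewrite {2}/Rintegral (@eq_measure_integral _ _ _ setT m)//; last first.
  by move=> A mA _; exact: lebesgue_measure_affine.
have ip : pm.-integrable setT (EFin \o f).
  apply: integrable_pushforward => //.
  exact: integrable_affine.
rewrite integralE !ge0_integral_mscale//; [|exact: measurable_funeneg|
  exact: measurable_funepos].
rewrite -muleBr//; last first.
  exact: integrable_add_def.
rewrite -integralE integral_pushforward//; last exact: integrable_affine.
rewrite preimage_setT fineM//=.
  by rewrite mulrA mulVf ?gt_eqF// mul1r.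
by apply: integral_fune_fin_num => //; exact: integrable_affine.
Qed.

Lemma Cintegrable_affine (f : R -> R[i]) : Cintegrable leb f ->
  Cintegrable leb (fun x => f (c * x + d)).
Proof.
by move=> [f1 f2]; split; [exact: (integrable_affine f1)|
  exact: (integrable_affine f2)].
Qed.

Lemma Cintegral_affine (f : R -> R[i]) : Cintegrable leb f ->
  Cintegral leb (fun x => f (c * x + d)) = (c^-1)%:C%C * Cintegral leb f.
Proof.
move=> [f1 f2]; apply: (@complex_ext R) => /=; rewrite mul0r ?subr0 ?addr0.
  exact: (Rintegral_affine f1).
exact: (Rintegral_affine f2).
Qed.

End lebesgue_affine.

(** * Gaussian integrals with a complex parameter *)

Section gaussian.
Variable R : realType.
Local Notation leb := (@lebesgue_measure R).

Let g (x : R) : R := expR (- (x ^+ 2) / 2).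

Let mg : measurable_fun setT g.
Proof.
apply: measurableT_comp => //; apply: measurable_funM => //.
by apply: measurableT_comp => //; exact: measurable_funX.
Qed.

Lemma gaussian_sqrt2 (x : R) :
  gauss_fun ((Num.sqrt 2)^-1 * x + 0) = expR (- (x ^+ 2) / 2).
Proof.
rewrite /gauss_fun addr0 exprMn exprVn sqr_sqrtr//; congr expR; by field.
Qed.

Let sqrt2_gt0 : 0 < (Num.sqrt 2)^-1 :> R.
Proof. by rewrite invr_gt0 sqrtr_gt0. Qed.

Lemma integrable_gaussian :
  leb.-integrable setT (EFin \o (fun x : R => expR (- (x ^+ 2) / 2))).
Proof.
have := @integrable_affine R _ 0 sqrt2_gt0 _ (@integrableT_gauss R).
by congr (_.-integrable _ (EFin \o _)); apply/funext => x; rewrite gaussian_sqrt2.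
Qed.

Lemma integral_gaussian : \int[leb]_x expR (- (x ^+ 2) / 2) = Num.sqrt (2 * pi).
Proof.
have := @Rintegral_affine R _ 0 sqrt2_gt0 _ (@integrableT_gauss R).
under eq_Rintegral do rewrite gaussian_sqrt2.
by rewrite {2}/Rintegral integralT_gauss/= invrK sqrtrM.
Qed.

Lemma integrable_expR_gaussian (a : R) :
  leb.-integrable setT (EFin \o (fun x : R => expR (a * x - x ^+ 2 / 2))).
Proof.
have := @integrable_affine R 1 (- a) ltr01 _ integrable_gaussian.
move/(integrableZl measurableT (expR (a ^+ 2 / 2))).
congr (_.-integrable _ _); apply/funext => x /=.
by rewrite -EFinM -expRD; congr (expR _)%:E; field.
Qed.

(** The inequality 1 + y <= exp y at y = x^2 / 4 spends half of the Gaussian on the factor x^2. The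
    right-hand side is 4 exp(- x^2 / 4), spelled as [integrable_affine] produces it. *)
Let sqr_g (x : R) : x ^+ 2 * g x <= 4 * expR (- ((Num.sqrt 2)^-1 * x + 0) ^+ 2 / 2).
Proof.
rewrite addr0 exprMn exprVn sqr_sqrtr// /g.
have := expR_ge1Dx (x ^+ 2 / 4) => h.
rewrite (_ : - x ^+ 2 / 2 = - (x ^+ 2 / 4) + - (2^-1 * x ^+ 2) / 2); last by field.
rewrite expRD mulrA ler_wpM2r ?expR_ge0// expRN ler_pdivrMr ?expR_gt0//.
by lra.
Qed.

Let integrable_sqr_g : leb.-integrable setT (EFin \o (fun x => x ^+ 2 * g x)).
Proof.
have := @integrable_affine R _ 0 sqrt2_gt0 _ integrable_gaussian.
move/(integrableZl measurableT 4); apply: le_integrable => //.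
  by apply/measurable_EFinP; apply: measurable_funM => //; exact: measurable_funX.
move=> x _ /=; rewrite lee_fin -/(g x).
rewrite ger0_norm; last by apply: mulr_ge0; [exact: sqr_ge0|exact: expR_ge0].
by rewrite ger0_norm ?mulr_ge0 ?expR_ge0// sqr_g.
Qed.

Let integrable_g_cos (F : R -> R) : measurable_fun setT F -> (forall x, `|F x| <= 1) ->
  leb.-integrable setT (EFin \o (fun x => g x * F x)).
Proof.
move=> mF F1; apply: (le_integrable _ _ _ integrable_gaussian) => //.
  by apply/measurable_EFinP; exact: measurable_funM.
move=> x _ /=; rewrite lee_fin normrM ler_piMr//.
Qed.

Let integrable_xg_sin (F : R -> R) : measurable_fun setT F -> (forall x, `|F x| <= 1) ->
  leb.-integrable setT (EFin \o (fun x => x * g x * F x)).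
Proof.
move=> mF F1; apply: (le_integrable _ _ _ (integrableD measurableT
  integrable_gaussian integrable_sqr_g)) => //.
  by apply/measurable_EFinP; apply: measurable_funM => //; exact: measurable_funM.
move=> x _ /=; rewrite lee_fin -/(g x).
have g0 : 0 <= g x by exact: expR_ge0.
rewrite [leRHS]ger0_norm; last first.
  by apply: addr_ge0 => //; apply: mulr_ge0 => //; exact: sqr_ge0.
rewrite !normrM (ger0_norm g0); apply: (@le_trans _ _ (`|x| * g x * 1)).
  by rewrite ler_wpM2l ?mulr_ge0.
rewrite mulr1 -[X in _ <= X + _]mul1r -mulrDl ler_wpM2r//.
by have := normr_ge0 x; rewrite -(real_normK (num_real x)); nra.
Qed.

Let mcos (t b : R) : measurable_fun setT (fun x : R => cos (t * x + b)).
Proof.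
apply: (measurableT_comp (f := @cos R)).
  by apply: continuous_measurable_fun; exact: continuous_cos.
by apply: measurable_funD => //; exact: measurable_funM.
Qed.

Let msin (t b : R) : measurable_fun setT (fun x : R => sin (t * x + b)).
Proof.
apply: (measurableT_comp (f := @sin R)).
  by apply: continuous_measurable_fun; exact: continuous_sin.
by apply: measurable_funD => //; exact: measurable_funM.
Qed.

Let cos1 (y : R) : `|cos y| <= 1. Proof. by rewrite ler_norml cos_geN1 cos_le1. Qed.
Let sin1 (y : R) : `|sin y| <= 1. Proof. by rewrite ler_norml sin_geN1 sin_le1. Qed.

(** The shift b treats both parts of the Fourier transform at once: b = 0 gives the cosine and b = -
    pi / 2 the sine. *)
Let gcos (b t : R) := \int[leb]_x (g x * cos (t * x + b)).

Let taylor (t b h x : R) :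
  `|g x * cos ((h + t) * x + b) - g x * cos (t * x + b) +
    h * (x * g x * sin (t * x + b))| <= 2 * h ^+ 2 * (x ^+ 2 * g x).
Proof.
have -> : (h + t) * x + b = (t * x + b) + h * x by ring.
rewrite cosD; set y := t * x + b.
have -> : g x * (cos y * cos (h * x) - sin y * sin (h * x)) - g x * cos y +
    h * (x * g x * sin y) =
    g x * (cos y * (cos (h * x) - 1) - sin y * (sin (h * x) - h * x)) by ring.
have g0 : 0 <= g x by exact: expR_ge0.
rewrite normrM (ger0_norm g0) [leRHS]mulrA mulrC ler_wpM2r//.
apply: (le_trans (ler_normB _ _)); rewrite !normrM.
have := cosB1_le (h * x); have := sinB_le (h * x); rewrite exprMn.
have := cos1 y; have := sin1 y.
have := normr_ge0 (cos y); have := normr_ge0 (sin y).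
have := normr_ge0 (cos (h * x) - 1); have := normr_ge0 (sin (h * x) - h * x).
rewrite -mulrA; move: `|cos y| `|sin y| `|cos (h * x) - 1| => A B C.
move: `|sin (h * x) - h * x| (h ^+ 2 * x ^+ 2) => D E D0 C0 B0 A0 B1 A1 H1 H2.
nra.
Qed.

Let dgcos (b t : R) :
  is_derive t (1 : R) (gcos b) (- (\int[leb]_x (x * g x * sin (t * x + b)))).
Proof.
apply: (@is_derive_quadratic R R^o _ _ _ _ (2 * \int[leb]_x (x ^+ 2 * g x))) => h.
rewrite /gcos -RintegralB//; [|exact: integrable_g_cos..].
have i1 := integrable_g_cos (mcos (h + t) b) (fun=> cos1 _).
have i2 := integrable_g_cos (mcos t b) (fun=> cos1 _).
have i3 := integrable_xg_sin (msin t b) (fun=> sin1 _).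
have i12 : leb.-integrable setT (EFin \o
  (fun x => g x * cos ((h + t) * x + b) - g x * cos (t * x + b))).
  exact: (integrableB _ i1 i2).
have i3' : leb.-integrable setT (EFin \o
  (fun x => h * (x * g x * sin (t * x + b)))) by exact: (integrableZl _ _ i3).
rewrite mulrN opprK -RintegralZl//.
rewrite (_ : h *: (1 : R) + t = h + t); last by rewrite /GRing.scale/= mulr1.
rewrite -RintegralD//.
apply: (le_trans (le_normr_Rintegral _ _)) => //; first exact: (integrableD _ i12 i3').
rewrite mulrAC -RintegralZl//; apply: (@le_Rintegral _ _ R leb) => //.
- by apply: integrable_norm; exact: (integrableD _ i12 i3').
- exact: (integrableZl _ _ integrable_sqr_g).
Qed.

Let dg (x : R) : is_derive x (1 : R) g (- x * g x).
Proof.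
rewrite /g; apply: is_derive_eq; rewrite /GRing.scale/=; by field.
Qed.

(** The derivative in x of g(x) sin(t x + b) is t g(x) cos(t x + b) - x g(x) sin(t x + b), and its
    integral vanishes. *)
Let ibp (b t : R) : \int[leb]_x (x * g x * sin (t * x + b)) = t * gcos b t.
Proof.
have i3 := integrable_xg_sin (msin t b) (fun=> sin1 _).
have i2 := integrable_g_cos (mcos t b) (fun=> cos1 _).
have i2' : leb.-integrable setT (EFin \o
  (fun x => t * (g x * cos (t * x + b)))) by exact: (integrableZl _ _ i2).
apply/eqP; rewrite -subr_eq0 -oppr_eq0 opprB /gcos -RintegralZl// -RintegralB//.
apply/eqP; apply: (@is_derive_Rintegral0 R (fun x => g x * sin (t * x + b)) _ 2).
- move=> x.
  have ds : is_derive x (1 : R) (fun x => sin (t * x + b)) (t * cos (t * x + b)).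
    by apply: is_derive_eq; rewrite /GRing.scale/=; ring.
  have := @is_deriveM R R^o g (fun x => sin (t * x + b)) x 1 _ _ (dg x) ds.
  by move=> H; apply: is_derive_eq; rewrite /GRing.scale/=; ring.
- have cg : continuous g.
    by move=> x; apply: differentiable_continuous; apply/derivable1_diffP; apply: ex_derive.
  have cl : continuous (fun x : R => t * x + b).
    move=> x; apply: cvgD; last exact: cvg_cst.
    by apply: cvgM; [exact: cvg_cst|exact: cvg_id].
  move=> x; apply: cvgB.
    apply: cvgM; first exact: cvg_cst.
    apply: cvgM; first exact: cg.
    by apply: continuous_comp; [exact: cl|exact: continuous_cos].
  apply: cvgM; first by apply: cvgM; [exact: cvg_id|exact: cg].
  by apply: continuous_comp; [exact: cl|exact: continuous_sin].
- exact: (integrableB _ i2' i3).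
- move=> x; have g0 : 0 <= g x by exact: expR_ge0.
  rewrite normrM (ger0_norm g0); apply: (@le_trans _ _ (g x * 1)).
    by rewrite ler_wpM2l.
  have x2 : 0 < 1 + x ^+ 2 by rewrite ltr_wpDr ?sqr_ge0.
  rewrite mulr1 ler_pdivlMr//.
  have := expR_ge1Dx (x ^+ 2 / 2) => h.
  rewrite /g mulNr expRN mulrC ler_pdivrMr ?expR_gt0//; have := sqr_ge0 x; lra.
Qed.

(** By [dgcos] and [ibp], [gcos b] solves y' = - t y. Hence its product with exp(t^2 / 2) is
    constant, equal to its value at 0, where the plain Gaussian integral appears. *)
Let gcosE (b t : R) : gcos b t = cos b * Num.sqrt (2 * pi) * expR (- (t ^+ 2) / 2).
Proof.
pose F t := gcos b t * expR (t ^+ 2 / 2).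
have dF (x : R) : is_derive x (1 : R) F 0.
  have := dgcos b x; rewrite ibp => d1.
  have d2 : is_derive x (1 : R) (fun t : R => expR (t ^+ 2 / 2)) (x * expR (x ^+ 2 / 2)).
    by apply: is_derive_eq; rewrite /GRing.scale/=; field.
  have := @is_deriveM R R^o (gcos b) _ x 1 _ _ d1 d2.
  by move=> H; apply: is_derive_eq; rewrite /GRing.scale/=; ring.
have := is_derive_0_is_cst t 0 dF; rewrite /F expr0n mul0r expR0 mulr1.
have -> : gcos b 0 = cos b * Num.sqrt (2 * pi).
  rewrite /gcos; under eq_Rintegral do rewrite mul0r add0r mulrC.
  by rewrite RintegralZl//; [rewrite integral_gaussian|exact: integrable_gaussian].
move=> <-; rewrite -mulrA -expRD mulNr subrr expR0 mulr1//.
Qed.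

Definition coh (a : R[i]) (x : R) : R[i] := cexp (a * x%:C%C - (x ^+ 2 / 2)%:C%C).

Lemma cmeas_coh a : cmeas (coh a).
Proof.
apply: cmeas_cexp; apply: cmeasD.
  by apply: cmeasM; [exact: cmeas_cst|exact: cmeas_real].
by apply: cmeasN; apply: cmeas_real; apply: measurable_funM.
Qed.

Lemma n1_coh a x : n1 (coh a x) <= 2 * expR (Re a * x - x ^+ 2 / 2).
Proof.
apply: (le_trans (n1_cexp _)); case: a => a b /=.
by rewrite mulr0 subr0.
Qed.

Lemma Cintegrable_coh a : Cintegrable leb (coh a).
Proof.
apply: (@dominated_Cintegrable _ _ R leb _
  (fun x => 2 * expR (Re a * x - x ^+ 2 / 2))).
- exact: cmeas_coh.
- exact: (integrableZl _ 2 (integrable_expR_gaussian (Re a))).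
- exact: n1_coh.
Qed.

(** Completing the square in the real part of a turns [coh] into a translate of a Gaussian times a
    character, whose integral is given by [gcosE]. *)
Lemma Cintegral_coh a :
  Cintegral leb (coh a) = (Num.sqrt (2 * pi))%:C%C * cexp (a ^+ 2 / 2).
Proof.
case: a => a b.
pose G x := (g x)%:C%C * expi (b * x).
have iG : Cintegrable leb G.
  apply: (@dominated_Cintegrable _ _ R leb _ (fun x => 2 * g x)).
  - by apply: cmeasM; [exact: cmeas_real|apply: cmeas_expi; exact: measurable_funM].
  - exact: (integrableZl _ 2 integrable_gaussian).
  - move=> x; apply: (le_trans (n1M _ _)); rewrite n1_real ger0_norm ?expR_ge0//.
    by rewrite mulrC ler_wpM2r ?expR_ge0 ?n1_expi.
have IG : Cintegral leb G = (Num.sqrt (2 * pi) * expR (- (b ^+ 2) / 2))%:C%C.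
  apply: complex_ext => /=.
    rewrite -[LHS](_ : gcos 0 b = _); first by rewrite gcosE cos0 mul1r.
    by apply: eq_Rintegral => x _; rewrite /= mul0r subr0 addr0.
  (* The imaginary part is a sine integral, that is [gcos] shifted by - pi / 2, and it vanishes
     because cos(pi / 2) = 0. *)
  rewrite -[LHS](_ : gcos (- (pi / 2)) b = _).
    by rewrite gcosE cosN cos_pihalf !mul0r.
  apply: eq_Rintegral => x _; rewrite /= mul0r addr0.
  by congr (_ * _); rewrite cosD cosN sinN cos_pihalf sin_pihalf; ring.
rewrite (_ : coh _ = fun x => cexp ((a ^+ 2 / 2) +i* (a * b))%C * G (1 * x + - a)).
  rewrite CintegralZ ?Cintegral_affine//; last exact: Cintegrable_affine.
  rewrite IG invr1 mul1r rmorphM/= expR_cexp mulrCA -cexpD halfC.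
  congr (_ * cexp _); apply: complex_ext; rewrite /= ?expr2/=; by field.
apply/funext => x; rewrite /G /coh /g expR_cexp expiE -!cexpD; congr cexp.
by apply: complex_ext => /=; field.
Qed.

End gaussian.

(** * Measurability and differentiability in the plane *)

Section plane.
Variable R : realType.

(** The product sigma-algebra is generated by rectangles, so U is exhausted by the countably many
    squares with rational centre and radius that it contains. *)
Lemma open_measurable_plane (U : set (R * R)) : open U -> measurable U.
Proof.
move=> oU.
pose B (a b r : rat) : set (R * R) :=
  ball (ratr a : R) (ratr r : R) `*` ball (ratr b : R) (ratr r : R).
have mB a b r : measurable (B a b r).
  by apply: measurableX; exact: measurable_ball.
have -> : U = \bigcup_a \bigcup_b \bigcup_r
    (if `[< B a b r `<=` U >] then B a b r else set0).
  apply/seteqP; split => [[x y] Uxy|[x y] [a _] [b _] [r _]]; last first.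
    by case: asboolP => // BU; exact: BU.
  have /nbhs_ballP[e /= e0 eU] : nbhs (x, y) U by exact: open_nbhs_nbhs.
  have [r] : exists r, ratr r \in `]0, (e / 2)[%R.
    by apply: rat_in_itvoo; rewrite divr_gt0.
  rewrite in_itv/= => /andP[r0 re].
  have [a] : exists a, ratr a \in `]x - ratr r, x + ratr r[%R.
    by apply: rat_in_itvoo; rewrite ltrBlDr -addrA ltrDl addr_gt0.
  have [b] : exists b, ratr b \in `]y - ratr r, y + ratr r[%R.
    by apply: rat_in_itvoo; rewrite ltrBlDr -addrA ltrDl addr_gt0.
  rewrite !in_itv/= => /andP[b1 b2] /andP[a1 a2].
  exists a => //; exists b => //; exists r => //.
  case: asboolP => [_|[]].
    by split; rewrite /= /ball/= ltr_norml; apply/andP; split; lra.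
  move=> [x' y'] [/=]; rewrite /ball/= !ltr_norml => /andP[x1 x2] /andP[y1 y2].
  by apply: eU; split; rewrite /= /ball/= ltr_norml; apply/andP; split; lra.
apply: bigcupT_measurable_rat => a; apply: bigcupT_measurable_rat => b.
by apply: bigcupT_measurable_rat => r; case: ifPn.
Qed.

Lemma continuous_measurable_plane (f : R * R -> R) :
  continuous f -> measurable_fun setT f.
Proof.
move=> /continuousP cf; apply: (measurability _ (RGenOpens.measurableE R)).
move=> _ [_ [a [b ->] <-]]; rewrite setTI; apply: open_measurable_plane.
exact/cf/interval_open.
Qed.

Section lin2.
Variables a b : R.
Definition lin2 (h : R * R) : R := a * h.1 + b * h.2.
Let lin2_linear : linear lin2.
Proof. by move=> k x y; rewrite /lin2 /= /GRing.scale/=; ring. Qed.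
HB.instance Definition _ := GRing.isLinear.Build R (R * R)%type R _ lin2 lin2_linear.
End lin2.

Lemma continuous_lin2 a b : continuous (lin2 a b).
Proof.
move=> x; apply: cvgD; (apply: cvgM; first exact: cvg_cst).
  exact: cvg_fst.
exact: cvg_snd.
Qed.

Definition dir (b : bool) : R * R := if b then (0, 1) else (1, 0).
Definition coord (b : bool) (u : R * R) : R := if b then u.2 else u.1.

(** The planar counterpart of [is_derive_quadratic]: a quadratic remainder is o(h), and uniqueness
    of the differential identifies the partial derivatives with a and b. *)
Lemma differentiable_quadratic (f : R * R -> R) (u : R * R) (a b C : R) :
  (forall h, `|f (h + u) - f u - (a * h.1 + b * h.2)| <= C * (h.1 ^+ 2 + h.2 ^+ 2)) ->
  differentiable f u /\ forall c, 'D_(dir c) f u = if c then b else a.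
Proof.
move=> hf.
have hf' h : `|f (h + u) - f u - lin2 a b h| <= 2 * `|C| * `|h| * `|h|.
  apply: (le_trans (hf h)); apply: (@le_trans _ _ (`|C| * (h.1 ^+ 2 + h.2 ^+ 2))).
    by rewrite ler_wpM2r ?addr_ge0 ?sqr_ge0 ?ler_norm.
  rewrite -!mulrA mulrCA ler_wpM2l// -expr2.
  have h1 : `|h.1| <= `|h| by rewrite [leRHS]/Num.norm/= le_max lexx.
  have h2 : `|h.2| <= `|h| by rewrite [leRHS]/Num.norm/= le_max lexx orbT.
  rewrite -(real_normK (num_real h.1)) -(real_normK (num_real h.2)).
  have := normr_ge0 h.1; have := normr_ge0 h.2; nra.
have E : f \o shift u = cst (f u) + lin2 a b +o_ (0 : R * R) id.
  apply/eqaddoP => e e0; near=> h.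
  rewrite !fctE /= opprD addrA.
  apply: (le_trans (hf' h)); rewrite ler_wpM2r//.
  have C1 : 0 < 2 * `|C| + 1 by rewrite ltr_wpDl// mulr_ge0.
  apply: (@le_trans _ _ ((2 * `|C| + 1) * `|h|)).
    by rewrite ler_wpM2r// lerDl.
  rewrite mulrC -ler_pdivlMr//; near: h.
  by apply: (@nbhs0_le R (R * R)%type); rewrite divr_gt0.
have D := diff_unique (@continuous_lin2 a b) E.
have Df : differentiable f u.
  by apply/diff_locallyP; rewrite D; split => //; exact: continuous_lin2.
split=> // c; rewrite deriveE// D -[LHS]/(a * (dir c).1 + b * (dir c).2).
by case: c; rewrite /dir /= ?mulr0 ?mulr1 ?addr0 ?add0r.
Unshelve. all: by end_near. Qed.

Lemma is_derive_slice (f : R * R -> R) (q p : R) : differentiable f (q, p) ->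
  is_derive q (1 : R) (fun s => f (s, p)) ('D_(dir false) f (q, p)) /\
  is_derive p (1 : R) (fun s => f (q, s)) ('D_(dir true) f (q, p)).
Proof.
move=> df; split.
  have [d1 d2] := derivableP (diff_derivable (v := dir false) df).
  have E : (fun h : R => h^-1 *: (f (h *: (1 : R) + q, p) - f (q, p))) =
      (fun h => h^-1 *: ((f \o shift (q, p)) (h *: dir false) - f (q, p))).
    apply/funext => h /=; rewrite /dir /=.
    by congr (_ *: (f _ - _)); rewrite /shift/= -[RHS]/(_, _)/= scaler0 add0r.
  split; first by rewrite /derivable /= E; exact: d1.
  by rewrite /derive /= E.
have [d1 d2] := derivableP (diff_derivable (v := dir true) df).
have E : (fun h : R => h^-1 *: (f (q, h *: (1 : R) + p) - f (q, p))) =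
    (fun h => h^-1 *: ((f \o shift (q, p)) (h *: dir true) - f (q, p))).
  apply/funext => h /=; rewrite /dir /=.
  by congr (_ *: (f _ - _)); rewrite /shift/= -[RHS]/(_, _)/= scaler0 add0r.
split; first by rewrite /derivable /= E; exact: d1.
by rewrite /derive /= E.
Qed.

Lemma differentiable_coord b u : differentiable (coord b) u.
Proof.
have [] := @differentiable_quadratic (coord b) u (if b then 0 else 1)
  (if b then 1 else 0) 0; last by [].
by move=> h; case: b => /=; rewrite !mul0r mul1r ?add0r ?addr0 addrK subrr normr0.
Qed.

Lemma derive_coord b c u : 'D_(dir c) (coord b) u = (b == c)%:R.
Proof.
have [] := @differentiable_quadratic (coord b) u (if b then 0 else 1)
  (if b then 1 else 0) 0; last by move=> _ ->; case: b; case: c.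
by move=> h; case: b => /=; rewrite !mul0r mul1r ?add0r ?addr0 addrK subrr normr0.
Qed.

End plane.

(** * Schwartz functions *)

Section schwartz_real.
Variable R : realType.
Implicit Types g h : R * R -> R.

(* Boundedness of all coordinate multiples of all derivatives follows from
   stability of [C] alone. *)
Lemma rschwartz_coind (C : (R * R -> R) -> Prop) :
    (forall g, C g -> [/\ forall u, differentiable g u,
      exists M, forall u, `|g u| <= M,
      forall b, C (fun u => coord b u * g u) &
      forall b, C ('D_(dir R b) g)]) ->
  forall g, C g -> rschwartz g.
Proof.
move=> HC g Cg.
have Cw w : C (partials w g).
  by elim: w => // b w IH; have [_ _ _] := HC _ IH; apply.
split=> [w u|a b w]; first by have [] := HC _ (Cw w).
have : C (fun u => u.1 ^+ a * u.2 ^+ b * partials w g u).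
  elim: a => [|a IH].
    elim: b => [|b IH].
      by rewrite (_ : (fun u => _) = partials w g)//; apply/funext => u;
        rewrite !expr0 !mul1r.
    have [_ _ /(_ true) + _] := HC _ IH; congr C; apply/funext => u /=.
    by rewrite exprS; ring.
  have [_ _ /(_ false) + _] := HC _ IH; congr C; apply/funext => u /=.
  by rewrite exprS; ring.
by move=> /HC[_ [M hM] _ _]; exists M => q p; exact: (hM (q, p)).
Qed.

Lemma rschwartz_diff g u : rschwartz g -> differentiable g u.
Proof. by move=> [/(_ [::])]. Qed.

Lemma rschwartz_bound g : rschwartz g -> exists M, forall u, `|g u| <= M.
Proof.
move=> [_ /(_ 0 0 [::])%N[M hM]]; exists M => -[q p].
by have := hM q p; rewrite !expr0 !mul1r.
Qed.

Lemma rschwartz_derive g b : rschwartz g -> rschwartz ('D_(dir R b) g).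
Proof.
have E w : partials w ('D_(dir R b) g) = partials (rcons w b) g.
  by rewrite /partials foldr_rcons.
move=> [d m]; split=> [w u|a c w]; first by rewrite E.
by have [M hM] := m a c (rcons w b); exists M => q p; rewrite E.
Qed.

(** The polynomial combinations of the derivatives of g. The span is stable under derivation and
    under the coordinates, and its members are bounded when g is Schwartz, so [rschwartz_coind]
    applies to it. *)
Inductive rspan g : (R * R -> R) -> Prop :=
| rspan_base a b w : rspan g (fun u => u.1 ^+ a * u.2 ^+ b * partials w g u)
| rspan_add h1 h2 : rspan g h1 -> rspan g h2 -> rspan g (fun u => h1 u + h2 u)
| rspan_scale c h : rspan g h -> rspan g (fun u => c * h u).

Lemma coordX b n : (fun u => coord b u ^+ n) = (@coord R b) ^+ n.
Proof. by apply/funext => u; rewrite fctE. Qed.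

Lemma differentiable_coordX b n u : differentiable (fun u => @coord R b u ^+ n) u.
Proof.
case: n => [|n].
  rewrite (_ : (fun u => _) = cst 1); first exact: differentiable_cst.
  by apply/funext => v; rewrite expr0.
have := @differentiableX R _ (coord b) n u (@differentiable_coord R b u).
by rewrite -coordX.
Qed.

Lemma derive_coordX b n c u : 'D_(dir R c) (fun u => @coord R b u ^+ n) u =
  if b == c then n%:R * coord b u ^+ n.-1 else 0.
Proof.
have H : is_derive u (dir R c) (coord b) (b == c)%:R.
  by have := derivableP (diff_derivable (v := dir R c)
    (@differentiable_coord R b u)); rewrite derive_coord.
have := @is_deriveX R _ (coord b) n u (dir R c) _ H.
rewrite coordX => -[_ ->].
by case: (b == c); rewrite /GRing.scale/= ?mulr0 ?mulr1// mulr_natl.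
Qed.

Lemma rspan_diff g : rschwartz g -> forall h, rspan g h -> forall u, differentiable h u.
Proof.
move=> Sg h; elim=> {h}[a b w|h1 h2 _ d1 _ d2|c h _ d] u.
- apply: differentiableM; last by case: Sg.
  by apply: differentiableM; [exact: (@differentiable_coordX false)|
    exact: (@differentiable_coordX true)].
- exact: differentiableD.
- exact: differentiableZ.
Qed.

Lemma rspan_derive g : rschwartz g -> forall h, rspan g h ->
  forall c, rspan g ('D_(dir R c) h).
Proof.
move=> Sg h; elim=> {h}[a b w|h1 h2 s1 d1 s2 d2|k h s d] c.
- have dq u : differentiable (fun u : R * R => u.1 ^+ a) u.
    exact: (@differentiable_coordX false).
  have dp u : differentiable (fun u : R * R => u.2 ^+ b) u.
    exact: (@differentiable_coordX true).
  have dg u : differentiable (partials w g) u by case: Sg.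
  (* For a = 0 the truncated predecessor [a.-1] is harmless, since the coefficient [a%:R] is then
     0. *)
  have Dq u : 'D_(dir R c) (fun u : R * R => u.1 ^+ a) u =
      if c then 0 else a%:R * u.1 ^+ a.-1.
    by rewrite (@derive_coordX false); case: (c).
  have Dp u : 'D_(dir R c) (fun u : R * R => u.2 ^+ b) u =
      if c then b%:R * u.2 ^+ b.-1 else 0.
    by rewrite (@derive_coordX true); case: (c).
  rewrite (_ : 'D_(dir R c) _ = fun u =>
    (if c then b%:R else a%:R) * (u.1 ^+ (if c then a else a.-1) *
       u.2 ^+ (if c then b.-1 else b) * partials w g u) +
    u.1 ^+ a * u.2 ^+ b * partials (c :: w) g u).
    apply: rspan_add; last exact: (@rspan_base g a b (c :: w)).
    by apply: rspan_scale; exact: rspan_base.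
  apply/funext => u.
  rewrite (@deriveM R (R * R)%type (fun u : R * R => u.1 ^+ a * u.2 ^+ b : R)); [|
    by apply: diff_derivable; exact: differentiableM|exact: diff_derivable].
  rewrite (@deriveM R (R * R)%type (fun u : R * R => u.1 ^+ a : R)); [|exact: diff_derivable..].
  rewrite Dq Dp /GRing.scale/=; case: c {Dq Dp} => /=; rewrite /dir; ring.
- rewrite (_ : 'D_(dir R c) _ = fun u => 'D_(dir R c) h1 u + 'D_(dir R c) h2 u).
    exact: rspan_add.
  by apply/funext => u; rewrite deriveD//; apply: diff_derivable;
    [exact: (rspan_diff Sg s1)|exact: (rspan_diff Sg s2)].
- rewrite (_ : 'D_(dir R c) _ = fun u => k * 'D_(dir R c) h u).
    exact: rspan_scale.
  by apply/funext => u; rewrite deriveZ//; apply: diff_derivable;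
    exact: (rspan_diff Sg s).
Qed.

Lemma rspan_coord g : forall h, rspan g h ->
  forall c, rspan g (fun u => coord c u * h u).
Proof.
move=> h; elim=> {h}[a b w|h1 h2 s1 d1 s2 d2|k h s d] c.
- have := @rspan_base g (if c then a else a.+1) (if c then b.+1 else b) w.
  by congr rspan; apply/funext => u; case: c => /=; rewrite exprS; ring.
- have := rspan_add (d1 c) (d2 c); congr rspan; apply/funext => u; ring.
- have := rspan_scale k (d c); congr rspan; apply/funext => u; ring.
Qed.

Lemma rspan_bound g : rschwartz g -> forall h, rspan g h ->
  exists M, forall u, `|h u| <= M.
Proof.
move=> [_ m] h; elim=> {h}[a b w|h1 h2 _ [M1 hM1] _ [M2 hM2]|k h _ [M hM]].
- by have [M hM] := m a b w; exists M => -[q p]; exact: hM.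
- by exists (M1 + M2) => u; rewrite (le_trans (ler_normD _ _))// lerD.
- by exists (`|k| * M) => u; rewrite normrM ler_wpM2l.
Qed.

Lemma rspan_schwartz g h : rschwartz g -> rspan g h -> rschwartz h.
Proof.
move=> Sg; apply: rschwartz_coind => {}h sh; split.
- exact: rspan_diff sh.
- exact: rspan_bound sh.
- exact: rspan_coord.
- exact: rspan_derive.
Qed.

Lemma rspan_id g : rspan g g.
Proof.
have := @rspan_base g 0 0 [::]; congr rspan; apply/funext => u.
by rewrite !expr0 !mul1r.
Qed.

Lemma rschwartz_coord g b : rschwartz g -> rschwartz (fun u => coord b u * g u).
Proof. by move=> Sg; apply: rspan_schwartz Sg _; apply: rspan_coord; exact: rspan_id. Qed.

Lemma rschwartzZ g c : rschwartz g -> rschwartz (fun u => c * g u).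
Proof. by move=> Sg; apply: rspan_schwartz Sg _; apply: rspan_scale; exact: rspan_id. Qed.

Lemma rschwartzD g h : rschwartz g -> rschwartz h ->
  rschwartz (fun u => g u + h u).
Proof.
move=> Sg Sh; pose C (f : R * R -> R) := exists g h,
  [/\ rschwartz g, rschwartz h & f = fun u => g u + h u].
suff: C (fun u => g u + h u).
  apply: rschwartz_coind => {Sg Sh}_ [{}g [{}h [Sg Sh ->]]]; split.
  - by move=> u; apply: differentiableD; exact: rschwartz_diff.
  - have [M1 h1] := rschwartz_bound Sg; have [M2 h2] := rschwartz_bound Sh.
    by exists (M1 + M2) => u; rewrite (le_trans (ler_normD _ _))// lerD.
  - move=> b; exists (fun u => coord b u * g u), (fun u => coord b u * h u).
    split; [exact: rschwartz_coord|exact: rschwartz_coord|].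
    by apply/funext => u; rewrite mulrDr.
  - move=> b; exists ('D_(dir R b) g), ('D_(dir R b) h).
    split; [exact: rschwartz_derive|exact: rschwartz_derive|].
    by apply/funext => u; rewrite deriveD//; apply: diff_derivable; exact: rschwartz_diff.
by exists g, h.
Qed.

End schwartz_real.

Section schwartz_complex.
Variable R : realType.
Implicit Types F G : R * R -> R[i].
Local Notation S2 := (schwartz R).

Definition cdiff F := forall u,
  differentiable (Re \o F) u /\ differentiable (Im \o F) u.

Definition cD b F (u : R * R) : R[i] :=
  ('D_(dir R b) (Re \o F) u +i* 'D_(dir R b) (Im \o F) u)%C.

Lemma schwartz_coind (C : (R * R -> R[i]) -> Prop) :
    (forall F, C F -> [/\ cdiff F,
      exists M, forall u, n1 (F u) <= M,
      forall b, C (fun u => (coord b u)%:C%C * F u) &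
      forall b, C (cD b F)]) ->
  forall F, C F -> S2 F.
Proof.
move=> HC F CF.
pose Cr (g : R * R -> R) := exists G, C G /\ (g = Re \o G \/ g = Im \o G).
have H g : Cr g -> rschwartz g.
  apply: rschwartz_coind => {}g [G [CG gG]].
  have [dG [M hM] cG DG] := HC _ CG; split.
  - by move=> u; have [d1 d2] := dG u; case: gG => ->.
  - exists M => u; apply: le_trans (hM u).
    by case: gG => ->; rewrite /n1/= ?lerDl ?lerDr.
  - move=> b; exists (fun u => (coord b u)%:C%C * G u); split => //.
    case: gG => ->; [left|right]; apply/funext => u /=; case: (G u) => x y /=.
      by rewrite mul0r subr0.
    by rewrite mul0r addr0.
  - move=> b; exists (cD b G); split => //.
    by case: gG => ->; [left|right].
by split; apply: H; exists F; split => //; [left|right].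
Qed.

Lemma schwartz_diff F : S2 F -> cdiff F.
Proof. by move=> [s1 s2] u; split; exact: rschwartz_diff. Qed.

Lemma schwartz_bounded F : S2 F -> exists M, forall u, n1 (F u) <= M.
Proof.
move=> [/rschwartz_bound[M1 h1] /rschwartz_bound[M2 h2]].
by exists (M1 + M2) => u; rewrite /n1 lerD ?h1 ?h2.
Qed.

Lemma schwartzD F G : S2 F -> S2 G -> S2 (fun u => F u + G u).
Proof.
move=> [f1 f2] [g1 g2]; split.
  rewrite (_ : _ \o _ = fun u => (Re \o F) u + (Re \o G) u).
    exact: rschwartzD.
  by apply/funext => u /=; rewrite raddfD.
rewrite (_ : _ \o _ = fun u => (Im \o F) u + (Im \o G) u).
  exact: rschwartzD.
by apply/funext => u /=; rewrite raddfD.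
Qed.

Lemma schwartzZ z F : S2 F -> S2 (fun u => z * F u).
Proof.
case: z => a b [f1 f2]; split.
  rewrite (_ : _ \o _ = fun u => a * (Re \o F) u + (- b) * (Im \o F) u).
    by apply: rschwartzD; exact: rschwartzZ.
  by apply/funext => u /=; case: (F u) => x y /=; rewrite mulNr.
rewrite (_ : _ \o _ = fun u => a * (Im \o F) u + b * (Re \o F) u).
  by apply: rschwartzD; exact: rschwartzZ.
by apply/funext => u /=; case: (F u) => x y.
Qed.

Lemma schwartz0 : S2 (fun=> 0).
Proof.
apply: (@schwartz_coind (fun F => F = fun=> 0)) => // F ->; split.
- by move=> u; split; exact: differentiable_cst.
- by exists 0 => u; rewrite /n1/= normr0 addr0.
- by move=> b; apply/funext => u; rewrite mulr0.
- by move=> b; apply/funext => u; rewrite /cD; apply: complex_ext; exact: derive_cst.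
Qed.

Lemma schwartz_conj F : S2 F -> S2 (fun u => (F u)^*)%C.
Proof.
move=> [f1 f2]; split.
  by rewrite (_ : _ \o _ = Re \o F)//; apply/funext => u /=; case: (F u).
rewrite (_ : _ \o _ = fun u => -1 * (Im \o F) u).
  exact: rschwartzZ.
by apply/funext => u /=; case: (F u) => x y /=; rewrite mulN1r.
Qed.

Lemma schwartz_coord b F : S2 F -> S2 (fun u => (coord b u)%:C%C * F u).
Proof.
move=> [f1 f2]; split.
  rewrite (_ : _ \o _ = fun u => coord b u * (Re \o F) u).
    exact: rschwartz_coord.
  by apply/funext => u /=; case: (F u) => x y /=; rewrite mul0r subr0.
rewrite (_ : _ \o _ = fun u => coord b u * (Im \o F) u).
  exact: rschwartz_coord.
by apply/funext => u /=; case: (F u) => x y /=; rewrite mul0r addr0.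
Qed.

Lemma schwartz_cD b F : S2 F -> S2 (cD b F).
Proof. by move=> [f1 f2]; split; exact: rschwartz_derive. Qed.

Lemma cmeas_schwartz F : S2 F -> cmeas F.
Proof.
move=> /schwartz_diff dF; split; apply: continuous_measurable_plane => u;
  apply: differentiable_continuous; by have [] := dF u.
Qed.

Definition jp (x : R) : R := (1 + x ^+ 2)^-1.
Definition Jp (u : R * R) : R := jp u.1 * jp u.2.

Lemma jp_gt0 x : 0 < jp x.
Proof. by rewrite invr_gt0 ltr_wpDr// sqr_ge0. Qed.

Lemma Jp_gt0 u : 0 < Jp u.
Proof. by rewrite mulr_gt0// jp_gt0. Qed.

Lemma integrable_jp : (@lebesgue_measure R).-integrable setT (EFin \o jp).
Proof.
have mj : measurable_fun setT jp.
  by apply: continuous_measurable_fun; exact: continuous_oneDsqrV.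
apply/integrableP; split; first exact/measurable_EFinP.
under eq_integral do rewrite /= ger0_norm ?(ltW (jp_gt0 _))//.
rewrite ge0_symfun_integralT.
- rewrite (_ : [set x | _] = `[0, +oo[%classic); last first.
    by apply/seteqP; split => x/=; rewrite in_itv/= andbT.
  by rewrite integral0y_oneDsqr -EFinM ltry.
- by move=> x; exact/ltW/jp_gt0.
- exact: continuous_oneDsqrV.
- by move=> x; rewrite /jp /= sqrrN.
Qed.

Lemma integrable_Jp :
  (@lebesgue_measure R \x @lebesgue_measure R)%E.-integrable setT (EFin \o Jp).
Proof.
apply: integrable_prod => //; try exact: integrable_jp;
  by move=> x; exact/ltW/jp_gt0.
Qed.

(** The decay that the integral estimates consume. The weight [Jp] is a product, as the domination
    hypotheses of the Fubini lemmas on R^2 and R^4 require. *)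
Definition rapid F := cmeas F /\ exists2 M, 0 <= M & forall u, n1 (F u) <= M * Jp u.

(** The inverse of [Jp (q, p)] is 1 + q^2 + p^2 + q^2 p^2, so M is the sum of the bounds for F, q^2
    F, p^2 F and q^2 p^2 F. *)
Lemma rapid_schwartz F : S2 F -> rapid F.
Proof.
move=> SF; split; first exact: cmeas_schwartz.
have [M0 h0] := schwartz_bounded SF.
have sq b G : S2 G -> S2 (fun u => (coord b u)%:C%C * ((coord b u)%:C%C * G u)).
  by move=> SG; do 2!apply: schwartz_coord.
have [M1 h1] := schwartz_bounded (sq false _ SF).
have [M2 h2] := schwartz_bounded (sq true _ SF).
have [M3 h3] := schwartz_bounded (sq false _ (sq true _ SF)).
have M0_ge0 : 0 <= M0 by apply: le_trans (h0 (0, 0)); exact: n1_ge0.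
have M1_ge0 : 0 <= M1 by apply: le_trans (h1 (0, 0)); exact: n1_ge0.
have M2_ge0 : 0 <= M2 by apply: le_trans (h2 (0, 0)); exact: n1_ge0.
have M3_ge0 : 0 <= M3 by apply: le_trans (h3 (0, 0)); exact: n1_ge0.
have E (r : R) z : n1 (r%:C%C * z) = `|r| * n1 z.
  by case: z => x y; rewrite /n1/= !mul0r subr0 addr0 !normrM mulrDr.
exists (M0 + M1 + M2 + M3); first by rewrite !addr_ge0.
move=> [q p]; rewrite /Jp /jp /= -invfM ler_pdivlMr; last first.
  by rewrite mulr_gt0// ltr_wpDr// sqr_ge0.
have := h0 (q, p); have := h1 (q, p); have := h2 (q, p); have := h3 (q, p).
rewrite !E /= ![`|_| * (`|_| * _)]mulrA -!normrM -!expr2 !ger0_norm ?sqr_ge0//.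
by move: (n1 _) => n; lra.
Qed.

Lemma rapid_integrable F : rapid F ->
  Cintegrable (@lebesgue_measure R \x @lebesgue_measure R)%E F.
Proof.
move=> [mF [M M0 hM]].
apply: (@dominated_Cintegrable _ _ R (@lebesgue_measure R \x @lebesgue_measure R)%E
  F (fun u => M * Jp u)) => //.
exact: (integrableZl _ M integrable_Jp).
Qed.

End schwartz_complex.

Lemma sigma_finite_product d1 d2 (T1 : measurableType d1) (T2 : measurableType d2)
    (R : realType) (m1 : {sigma_finite_measure set T1 -> \bar R})
    (m2 : {sigma_finite_measure set T2 -> \bar R}) :
  sigma_finite setT (m1 \x m2)%E.
Proof.
have /sigma_finiteP[F [TF ndF Foo]] := sigma_finiteT m1.
have /sigma_finiteP[G [TG ndG Goo]] := sigma_finiteT m2.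
exists (fun n => F n `*` G n).
  rewrite -setXTT TF TG predeqE => -[x y]; split.
    move=> [/= [n _ Fnx] [k _ Gky]]; exists (maxn n k) => //; split.
    - by move: x Fnx; exact/subsetPset/ndF/leq_maxl.
    - by move: y Gky; exact/subsetPset/ndG/leq_maxr.
  by move=> [n _ []/= ? ?]; split; exists n.
move=> k; have [? ?] := Foo k; have [? ?] := Goo k.
split; first exact: measurableX.
by rewrite product_measure1E// lte_mul_pinfty// ge0_fin_numE.
Qed.

Section lebesgue_plane.
Variable R : realType.
Local Notation leb := (@lebesgue_measure R).

(* The product of two sigma-finite measures is not known to be sigma-finite to
   the canonical structures; [lebp] and [lebq] are names for the Lebesgue
   measures of R^2 and R^4 that are. *)
Definition lebp : set (measurableTypeR R * measurableTypeR R)%type -> \bar R :=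
  (leb \x leb)%E.
HB.instance Definition _ := Measure.on lebp.
HB.instance Definition _ :=
  Measure_isSigmaFinite.Build _ _ R lebp (sigma_finite_product leb leb).

Definition lebq : set ((measurableTypeR R * measurableTypeR R) *
    (measurableTypeR R * measurableTypeR R))%type -> \bar R :=
  (lebp \x lebp)%E.
HB.instance Definition _ := Measure.on lebq.
HB.instance Definition _ :=
  Measure_isSigmaFinite.Build _ _ R lebq (sigma_finite_product lebp lebp).
End lebesgue_plane.

(** * Integration by parts against plane waves *)

Section ibp.
Variable R : realType.
Local Notation leb := (@lebesgue_measure R).
Local Notation leb2 := (leb \x leb)%E.

Lemma jp_cst_mul (C x : R) : C * jp x = C / (1 + x ^+ 2).
Proof. by []. Qed.

(** The integrand is the derivative of h(s) exp(i (al s + be)), which decays like [jp]. The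
    fundamental theorem is applied to its real and imaginary parts. *)
Lemma Cintegral_derive0 (h h' : R -> R[i]) (al be C : R) :
    (forall s, is_derive s (1 : R) (Re \o h) (Re (h' s))) ->
    (forall s, is_derive s (1 : R) (Im \o h) (Im (h' s))) ->
    continuous (Re \o h') -> continuous (Im \o h') ->
    (forall s, n1 (h s) <= C * jp s) -> (forall s, n1 (h' s) <= C * jp s) ->
  Cintegral leb (fun s =>
    (h' s + (0 +i* al)%C * h s) * expi (al * s + be)) = 0.
Proof.
move=> dr di cr' ci' bh bh'.
have cr : continuous (Re \o h).
  by move=> x; apply: differentiable_continuous; apply/derivable1_diffP; apply: ex_derive.
have ci : continuous (Im \o h).
  by move=> x; apply: differentiable_continuous; apply/derivable1_diffP; apply: ex_derive.
have cl : continuous (fun x : R => al * x + be).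
  move=> x; apply: cvgD; last exact: cvg_cst.
  by apply: cvgM; [exact: cvg_cst|exact: cvg_id].
have cc : continuous (fun x : R => cos (al * x + be)).
  by move=> x; apply: continuous_comp; [exact: cl|exact: continuous_cos].
have cs : continuous (fun x : R => sin (al * x + be)).
  by move=> x; apply: continuous_comp; [exact: cl|exact: continuous_sin].
have dc (s : R) : is_derive s (1 : R) (fun x : R => cos (al * x + be))
    (- (al * sin (al * s + be))).
  by apply: is_derive_eq; rewrite /GRing.scale/=; ring.
have ds (s : R) : is_derive s (1 : R) (fun x : R => sin (al * x + be))
    (al * cos (al * s + be)).
  by apply: is_derive_eq; rewrite /GRing.scale/=; ring.
set F := (X in Cintegral _ X).
have C0 : 0 <= C.
  rewrite -(pmulr_lge0 _ (jp_gt0 0)); apply: le_trans (bh 0); exact: n1_ge0.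
have mh : cmeas h by split; exact: continuous_measurable_fun.
have mh' : cmeas h' by split; exact: continuous_measurable_fun.
have iF : Cintegrable leb F.
  apply: (@dominated_Cintegrable _ _ R leb F
      (fun s => (C + `|al| * C) * 2 * jp s)).
  - apply: cmeasM; first by apply: cmeasD => //; exact: cmeasZ.
    by apply: cmeas_expi; exact: continuous_measurable_fun.
  - exact: (integrableZl _ _ (@integrable_jp R)).
  - move=> s; apply: (le_trans (n1M _ _)); rewrite mulrAC.
    apply: ler_pM; rewrite ?n1_ge0 ?n1_expi//.
    apply: (le_trans (n1D _ _)); rewrite mulrDl lerD//.
    apply: (le_trans (n1M _ _)); rewrite -mulrA ler_pM ?n1_ge0//.
    by rewrite /n1/= normr0 add0r.
have bRe s : `|Re (h s)| <= C * jp s.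
  by apply: le_trans (bh s); rewrite lerDl.
have bIm s : `|Im (h s)| <= C * jp s.
  by apply: le_trans (bh s); rewrite lerDr.
have cos1 (y : R) : `|cos y| <= 1 by rewrite ler_norml cos_geN1 cos_le1.
have sin1 (y : R) : `|sin y| <= 1 by rewrite ler_norml sin_geN1 sin_le1.
have bnd (x y c d K : R) : 0 <= K -> `|x| <= K -> `|y| <= K -> `|c| <= 1 -> `|d| <= 1 ->
    `|x * c + y * d| <= K + K.
  move=> K0 xK yK c1 d1; apply: (le_trans (ler_normD _ _)); rewrite !normrM.
  by apply: lerD; rewrite -[leRHS]mulr1; apply: ler_pM.
case: iF => iR iI; apply: complex_ext => /=.
- have E : Re \o F = fun s => (Re (h' s) * cos (al * s + be) -
      al * (Re (h s) * sin (al * s + be))) -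
      (Im (h' s) * sin (al * s + be) + al * (Im (h s) * cos (al * s + be))).
    apply/funext => s; rewrite /F /=; case: (h s) (h' s) => [a b] [a' b'] /=; ring.
  apply: (@is_derive_Rintegral0 R (fun s => Re (h s) * cos (al * s + be) +
      Im (h s) * - sin (al * s + be)) (Re \o F) (C + C)) => //.
  - move=> s; rewrite E.
    have d1 := @is_deriveM R R^o _ _ s 1 _ _ (dr s) (dc s).
    have d2 := @is_deriveM R R^o _ _ s 1 _ _ (di s) (is_deriveN (ds s)).
    have := is_deriveD d1 d2; move=> H; apply: is_derive_eq.
    rewrite /GRing.scale/= -[X in _ + (_ + X * _)]/(- sin (al * s + be)).
    by ring.
  - rewrite E => s; apply: cvgB.
      apply: cvgB; first by apply: cvgM; [exact: cr'|exact: cc].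
      by apply: cvgM; [exact: cvg_cst|apply: cvgM; [exact: cr|exact: cs]].
    apply: cvgD; first by apply: cvgM; [exact: ci'|exact: cs].
    by apply: cvgM; [exact: cvg_cst|apply: cvgM; [exact: ci|exact: cc]].
  - move=> s; rewrite -jp_cst_mul mulrDl; apply: bnd => //; last by rewrite normrN.
    by rewrite mulr_ge0//; exact/ltW/jp_gt0.
- have E : Im \o F = fun s => (Re (h' s) * sin (al * s + be) +
      al * (Re (h s) * cos (al * s + be))) +
      (Im (h' s) * cos (al * s + be) - al * (Im (h s) * sin (al * s + be))).
    apply/funext => s; rewrite /F /=; case: (h s) (h' s) => [a b] [a' b'] /=; ring.
  apply: (@is_derive_Rintegral0 R (fun s => Re (h s) * sin (al * s + be) +
      Im (h s) * cos (al * s + be)) (Im \o F) (C + C)) => //.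
  - move=> s; rewrite E.
    have d1 := @is_deriveM R R^o _ _ s 1 _ _ (dr s) (ds s).
    have d2 := @is_deriveM R R^o _ _ s 1 _ _ (di s) (dc s).
    have := is_deriveD d1 d2; move=> H; apply: is_derive_eq.
    by rewrite /GRing.scale/=; ring.
  - rewrite E => s; apply: cvgD.
      apply: cvgD; first by apply: cvgM; [exact: cr'|exact: cs].
      by apply: cvgM; [exact: cvg_cst|apply: cvgM; [exact: cr|exact: cc]].
    apply: cvgB; first by apply: cvgM; [exact: ci'|exact: cc].
    by apply: cvgM; [exact: cvg_cst|apply: cvgM; [exact: ci|exact: cs]].
  - move=> s; rewrite -jp_cst_mul mulrDl; apply: bnd => //.
    by rewrite mulr_ge0//; exact/ltW/jp_gt0.
Qed.

Lemma schwartz_continuous (f : R * R -> R[i]) : schwartz R f ->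
  continuous (Re \o f) /\ continuous (Im \o f).
Proof.
move=> /schwartz_diff df; split=> u; apply: differentiable_continuous;
  by have [] := df u.
Qed.

Lemma jp_le1 (x : R) : jp x <= 1.
Proof. by rewrite invf_le1 ?ltr_wpDr ?sqr_ge0// lerDl sqr_ge0. Qed.

Lemma integrable_jpM (C : R) : leb.-integrable setT (EFin \o (fun x => C * jp x)).
Proof. exact: (integrableZl _ C (@integrable_jp R)). Qed.

(** Fubini in the order that integrates along the direction b first leaves on each line an integral
    that vanishes by [Cintegral_derive0]; the other coordinate only enters the constant part of the
    phase. *)
Lemma schwartz_ibp (f : R * R -> R[i]) (b : bool) (al be ga : R) :
    schwartz R f ->
  Cintegral leb2 (fun v => (cD b f v + (0 +i* al)%C * f v) *
    expi (al * coord b v + be * coord (~~ b) v + ga)) = 0.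
Proof.
move=> Sf.
have [mf [M1 M10 b1]] := rapid_schwartz Sf.
have [mf' [M2 M20 b2]] := rapid_schwartz (schwartz_cD b Sf).
set F := (X in Cintegral _ X).
have mF : cmeas F.
  apply: cmeasM; first by apply: cmeasD => //; exact: cmeasZ.
  have mc c : measurable_fun setT (@coord R c).
    by apply: continuous_measurable_plane => u; apply: differentiable_continuous;
      exact: differentiable_coord.
  apply: cmeas_expi; apply: measurable_funD => //.
  by apply: measurable_funD; (apply: measurable_funM; first exact: measurable_cst);
    exact: mc.
pose C := (M2 + `|al| * M1) * 2.
have bF x y : n1 (F (x, y)) <= C * jp x * jp y.
  rewrite -mulrA -[_ * jp y]/(Jp (x, y)) /C mulrAC.
  apply: (le_trans (n1M _ _)); apply: ler_pM; rewrite ?n1_ge0 ?n1_expi//.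
  apply: (le_trans (n1D _ _)); rewrite mulrDl lerD//.
  apply: (le_trans (n1M _ _)); rewrite -mulrA ler_pM ?n1_ge0//.
  by rewrite /n1/= normr0 add0r.
have C0 : 0 <= C by rewrite mulr_ge0// addr_ge0// mulr_ge0.
have jp0 (x : R) : 0 <= jp x by exact/ltW/jp_gt0.
have Cjp0 (x : R) : 0 <= C * jp x by rewrite mulr_ge0.
have [cr ci] := schwartz_continuous Sf.
have [cr' ci'] := schwartz_continuous (schwartz_cD b Sf).
have cx (x : R) : continuous (fun s : R => (x, s)).
  move=> s; apply: (@differentiable_continuous _ R^o).
  by apply: (@differentiable_pair R R^o R^o R^o (cst x) id).
have cy (y : R) : continuous (fun s : R => (s, y)).
  move=> s; apply: (@differentiable_continuous _ R^o).
  by apply: (@differentiable_pair R R^o R^o R^o id (cst y)).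
have M12 (u : R * R) : M1 * Jp u <= (M1 + M2) * (jp u.1 * jp u.2).
  by rewrite mulrDl lerDl mulr_ge0// mulr_ge0.
have M21 (u : R * R) : M2 * Jp u <= (M1 + M2) * (jp u.1 * jp u.2).
  by rewrite mulrDl lerDr mulr_ge0// mulr_ge0.
case: b @F mF bF mf' b2 cr' ci' => F mF bF mf' b2 cr' ci'.
- have <- := @Cfubini1 _ _ _ _ R leb leb _ _ (integrable_jpM C) (@integrable_jp R)
    Cjp0 jp0 F mF bF.
  rewrite (_ : (fun x => _) = fun x => 0 * 0).
    rewrite CintegralZ ?mul0r//; split;
      rewrite (_ : _ \o _ = cst 0%E)//; exact: integrable0.
  apply/funext => x; rewrite mulr0.
  apply: etrans; last apply: (@Cintegral_derive0 (fun s => f (x, s)) (fun s => cD true f (x, s)) al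
    (be * x + ga) ((M1 + M2) * jp x)).
  + by apply: eq_Cintegral => s; rewrite /F /=; congr (_ * expi _); ring.
  + by move=> s; have [_] := is_derive_slice (schwartz_diff Sf (x, s)).1.
  + by move=> s; have [_] := is_derive_slice (schwartz_diff Sf (x, s)).2.
  + by by move=> s; apply: (@continuous_comp _ _ _ (fun s => (x, s)) (Re \o cD true f)); [exact: cx|exact: cr'].
  + move=> s; apply: (@continuous_comp _ _ _ (fun s => (x, s)) (Im \o cD true f)).
      exact: cx.
    exact: ci'.
  + by move=> s; rewrite -mulrA; apply: le_trans (b1 _) (M12 _).
  + by move=> s; rewrite -mulrA; apply: le_trans (b2 _) (M21 _).
- have <- := @Cfubini2 _ _ _ _ R leb leb _ _ (integrable_jpM C) (@integrable_jp R)
    Cjp0 jp0 F mF bF.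
  rewrite (_ : (fun x => _) = fun x => 0 * 0).
    rewrite CintegralZ ?mul0r//; split;
      rewrite (_ : _ \o _ = cst 0%E)//; exact: integrable0.
  apply/funext => y; rewrite mulr0.
  apply: etrans; last apply: (@Cintegral_derive0 (fun s => f (s, y)) (fun s => cD false f (s, y)) al
    (be * y + ga) ((M1 + M2) * jp y)).
  + by apply: eq_Cintegral => s; rewrite /F /=; congr (_ * expi _); ring.
  + by move=> s; have [] := is_derive_slice (schwartz_diff Sf (s, y)).1.
  + by move=> s; have [] := is_derive_slice (schwartz_diff Sf (s, y)).2.
  + move=> s; apply: (@continuous_comp _ _ _ (fun s => (s, y)) (Re \o cD false f)).
      exact: cy.
    exact: cr'.
  + move=> s; apply: (@continuous_comp _ _ _ (fun s => (s, y)) (Im \o cD false f)).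
      exact: cy.
    exact: ci'.
  + by move=> s; rewrite mulrAC -mulrA; apply: le_trans (b1 _) (M12 _).
  + by move=> s; rewrite mulrAC -mulrA; apply: le_trans (b2 _) (M21 _).
Qed.

End ibp.

Section measurability.
Context d (T : measurableType d) (R : realType).

Lemma measurable_fun_fst d1 d2 (T1 : measurableType d1) (T2 : measurableType d2)
  (h : T -> T1 * T2) : measurable_fun setT h -> measurable_fun setT (fun x => (h x).1).
Proof. by move=> mh; exact: (measurableT_comp measurable_fst mh). Qed.

Lemma measurable_fun_snd d1 d2 (T1 : measurableType d1) (T2 : measurableType d2)
  (h : T -> T1 * T2) : measurable_fun setT h -> measurable_fun setT (fun x => (h x).2).
Proof. by move=> mh; exact: (measurableT_comp measurable_snd mh). Qed.

Lemma measurable_symp (h k : T -> R * R) : measurable_fun setT h ->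
  measurable_fun setT k -> measurable_fun setT (fun x => symp (h x) (k x)).
Proof.
move=> mh mk; apply: measurable_funB; apply: measurable_funM;
  solve [exact: measurable_fun_fst|exact: measurable_fun_snd].
Qed.

End measurability.

(** * The twisted product of Schwartz functions *)

Section twisted_theory.
Variable R : realType.
Local Notation leb := (@lebesgue_measure R).
Local Notation leb2 := (leb \x leb)%E.
Local Notation lp := (@lebp R).
Local Notation leb4 := (lp \x lp)%E.
Local Notation S2 := (schwartz R).
Implicit Types f g : R * R -> R[i].

Lemma Jp_ge0 (u : R * R) : 0 <= Jp u. Proof. exact/ltW/Jp_gt0. Qed.

Lemma integrable_JpM (C : R) : leb2.-integrable setT (EFin \o (fun x => C * Jp x)).
Proof. exact: (integrableZl _ C (@integrable_Jp R)). Qed.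

Section JJ.
Variables (F : (R * R) * (R * R) -> R[i]) (M : R).
Hypotheses (mF : cmeas F) (FM : forall x y, n1 (F (x, y)) <= M * Jp x * Jp y).

Let M0 : 0 <= M.
Proof.
rewrite -(pmulr_lge0 _ (Jp_gt0 0)) -(pmulr_lge0 _ (Jp_gt0 0)).
exact: (le_trans (n1_ge0 _) (FM 0 0)).
Qed.

Let MJ0 x : 0 <= M * Jp x. Proof. by rewrite mulr_ge0// Jp_ge0. Qed.

Lemma JJ_integrable : Cintegrable leb4 F.
Proof.
exact: (@Cfubini_prod_integrable _ _ _ _ R lp lp _ _ (integrable_JpM M)
  (@integrable_Jp R) MJ0 Jp_ge0 F mF FM).
Qed.

Lemma JJ_iter_integrable : Cintegrable leb2 (fun x => Cintegral leb2 (fun y => F (x, y))).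
Proof.
exact: (@Cfubini_integrable _ _ _ _ R lp lp _ _ (integrable_JpM M)
  (@integrable_Jp R) MJ0 Jp_ge0 F mF FM).
Qed.

Lemma JJ1 : Cintegral leb2 (fun x => Cintegral leb2 (fun y => F (x, y))) =
  Cintegral leb4 F.
Proof.
exact: (@Cfubini1 _ _ _ _ R lp lp _ _ (integrable_JpM M)
  (@integrable_Jp R) MJ0 Jp_ge0 F mF FM).
Qed.

Lemma JJ2 : Cintegral leb2 (fun y => Cintegral leb2 (fun x => F (x, y))) =
  Cintegral leb4 F.
Proof.
exact: (@Cfubini2 _ _ _ _ R lp lp _ _ (integrable_JpM M)
  (@integrable_Jp R) MJ0 Jp_ge0 F mF FM).
Qed.

Lemma JJ_bound : n1 (Cintegral leb4 F) <= M * (\int[leb4]_z (Jp z.1 * Jp z.2)).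
Proof.
have iJ := @integrable_prod _ _ _ _ R lp lp _ _ (@integrable_Jp R)
  (@integrable_Jp R) Jp_ge0 Jp_ge0.
rewrite -RintegralZl//; apply: (@n1_Cintegral_le _ _ R leb4) => //.
  exact: (integrableZl _ M iJ).
by move=> [x y] /=; rewrite mulrA.
Qed.

End JJ.

Definition phase (u v w : R * R) : R := symp u v + symp v w + symp w u.

(** The pair z is (w, v), the outer variable first, so that [JJ1] yields the iterated integral of
    [twisted] in its own order. *)
Definition tker f g (u : R * R) (z : (R * R) * (R * R)) : R[i] :=
  f z.2 * g z.1 * expi (phase u z.2 z.1).

Lemma measurable_phase u :
  measurable_fun setT (fun z : (R * R) * (R * R) => phase u z.2 z.1).
Proof.
have m1 : measurable_fun setT (fun z : (R * R) * (R * R) => z.1).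
  exact: measurable_fst.
have m2 : measurable_fun setT (fun z : (R * R) * (R * R) => z.2).
  exact: measurable_snd.
apply: measurable_funD; first apply: measurable_funD;
  apply: measurable_symp => //; exact: measurable_cst.
Qed.

Lemma cmeas_tker f g u : cmeas f -> cmeas g -> cmeas (tker f g u).
Proof.
move=> mf mg; apply: cmeasM.
  apply: cmeasM.
    exact: (cmeas_comp (h := snd) measurable_snd mf).
  exact: (cmeas_comp (h := fst) measurable_fst mg).
apply: cmeas_expi; exact: measurable_phase.
Qed.

Lemma tker_bound f g : rapid f -> rapid g ->
  exists M, forall u x y, n1 (tker f g u (x, y)) <= M * Jp x * Jp y.
Proof.
move=> [_ [M1 M10 h1]] [_ [M2 M20 h2]]; exists (M1 * M2 * 2) => u x y.
apply: (le_trans (n1M _ _)).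
rewrite (_ : _ * _ * Jp y = ((M1 * Jp y) * (M2 * Jp x)) * 2); last by ring.
apply: ler_pM; rewrite ?n1_ge0 ?n1_expi//.
apply: (le_trans (n1M _ _)); exact: ler_pM (n1_ge0 _) (n1_ge0 _) (h1 _) (h2 _).
Qed.

Definition c4 : R[i] := ((4 * pi ^+ 2)^-1)%:C%C.

Lemma twistedE f g u : rapid f -> rapid g ->
  twisted f g u = c4 * Cintegral leb4 (tker f g u).
Proof.
move=> rf rg; have [M hM] := tker_bound rf rg.
rewrite -(JJ1 (M := M)) ?(hM u)//.
by apply: cmeas_tker; [case: rf|case: rg].
Qed.

Lemma tker_integrable f g u : rapid f -> rapid g -> Cintegrable leb4 (tker f g u).
Proof.
move=> rf rg; have [M hM] := tker_bound rf rg.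
by apply: (JJ_integrable _ (hM u)); apply: cmeas_tker; [case: rf|case: rg].
Qed.

Lemma twisted_bounded f g : rapid f -> rapid g ->
  exists M, forall u, n1 (twisted f g u) <= M.
Proof.
move=> rf rg; have [M hM] := tker_bound rf rg.
exists (n1 c4 * (M * (\int[leb4]_z (Jp z.1 * Jp z.2)))) => u.
rewrite twistedE//; apply: (le_trans (n1M _ _)); rewrite ler_wpM2l ?n1_ge0//.
by apply: JJ_bound => //; apply: cmeas_tker; [case: rf|case: rg].
Qed.

(** The factor i times a coordinate is what a derivative in u brings down from the exponential of
    the phase. *)
Definition icoord b f (u : R * R) : R[i] := (0 +i* 1)%C * ((coord b u)%:C%C * f u).

Lemma schwartz_icoord b f : S2 f -> S2 (icoord b f).
Proof. by move=> Sf; apply: schwartzZ; exact: schwartz_coord. Qed.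

(* The partial derivatives of [twisted f g], obtained by differentiating the
   phase under the integral. *)
Definition dtw b f g (u : R * R) : R[i] :=
  if b then twisted f (icoord false g) u - twisted (icoord false f) g u
  else twisted (icoord true f) g u - twisted f (icoord true g) u.

(** The quadratic moment absorbs the growth in v of the Taylor remainder of the phase. *)
Lemma rapid_moment f : S2 f ->
  exists2 M, 0 <= M & forall v, n1 (f v) * (1 + v.1 ^+ 2 + v.2 ^+ 2) <= M * Jp v.
Proof.
move=> Sf; have sq b : S2 (fun u => (coord b u)%:C%C * ((coord b u)%:C%C * f u)).
  by do 2!apply: schwartz_coord.
have [_ [M0 M00 h0]] := rapid_schwartz Sf.
have [_ [M1 M10 h1]] := rapid_schwartz (sq false).
have [_ [M2 M20 h2]] := rapid_schwartz (sq true).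
exists (M0 + M1 + M2); first by rewrite !addr_ge0.
have E (r : R) z : n1 (r%:C%C * z) = `|r| * n1 z.
  by case: z => x y; rewrite /n1/= !mul0r subr0 addr0 !normrM mulrDr.
move=> v; have := h0 v; have := h1 v; have := h2 v.
rewrite !E ![`|_| * (`|_| * _)]mulrA -!normrM -!expr2 !ger0_norm ?sqr_ge0//=.
by move: (n1 _) => n; lra.
Qed.

(** The phase is affine in u, so moving u by h multiplies the kernel by exp(i dl) with [dl] linear
    in h. The remainder exp(i dl) - 1 - i dl is at most 2 dl^2, and dl^2 is at most |h|^2 times
    second moments in v and w, which [rapid_moment] integrates. *)
Lemma twisted_expansion f g : S2 f -> S2 g -> exists C, forall u h,
  n1 (twisted f g (h + u) - twisted f g u -
     (h.1%:C%C * dtw false f g u + h.2%:C%C * dtw true f g u)) <=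
  C * (h.1 ^+ 2 + h.2 ^+ 2).
Proof.
move=> Sf Sg; have [Mf Mf0 hf] := rapid_moment Sf; have [Mg Mg0 hg] := rapid_moment Sg.
have rf := rapid_schwartz Sf; have rg := rapid_schwartz Sg.
have rif b := rapid_schwartz (schwartz_icoord b Sf).
have rig b := rapid_schwartz (schwartz_icoord b Sg).
exists (n1 c4 * (8 * (Mf * Mg) * (\int[leb4]_z (Jp z.1 * Jp z.2)))) => u h.
(* This is the increment symp h v + symp w h of the phase. *)
pose dl (v w : R * R) : R := h.1 * (v.2 - w.2) + h.2 * (w.1 - v.1).
pose Rm z := tker f g u z *
  (expi (dl z.2 z.1) - 1 - (0 +i* dl z.2 z.1)%C).
have -> : twisted f g (h + u) - twisted f g u -
     (h.1%:C%C * dtw false f g u + h.2%:C%C * dtw true f g u) =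
     c4 * Cintegral leb4 Rm.
  rewrite /dtw !twistedE//.
  have i0 := tker_integrable (h + u) rf rg.
  have i1 := tker_integrable u rf rg.
  have i2 b := tker_integrable u (rif b) rg.
  have i3 b := tker_integrable u rf (rig b).
  have j23 : Cintegrable leb4 (fun z =>
      tker (icoord true f) g u z - tker f (icoord true g) u z).
    by apply: CintegrableD => //; exact: CintegrableN.
  have j32 : Cintegrable leb4 (fun z =>
      tker f (icoord false g) u z - tker (icoord false f) g u z).
    by apply: CintegrableD => //; exact: CintegrableN.
  have i23 := CintegrableZ h.1%:C%C j23.
  have i32 := CintegrableZ h.2%:C%C j32.
  rewrite (_ : Rm = fun z => (tker f g (h + u) z - tker f g u z) -
      (h.1%:C%C * (tker (icoord true f) g u z - tker f (icoord true g) u z) +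
       h.2%:C%C * (tker f (icoord false g) u z - tker (icoord false f) g u z))).
    rewrite CintegralB; [|by apply: CintegrableD => //; exact: CintegrableN|
      exact: CintegrableD].
    rewrite (CintegralDf i23 i32) (CintegralZ _ j23) (CintegralZ _ j32).
    by rewrite !CintegralB//; ring.
  apply/funext => -[w v]; rewrite /Rm /tker /=.
  have -> : phase (h + u) v w = phase u v w + dl v w.
    by rewrite /phase /dl /symp /=; ring.
  rewrite expiD /icoord /dl /=.
  set e := expi (phase u v w); set e' := expi _.
  have -> : (0 +i* (h.1 * (v.2 - w.2) + h.2 * (w.1 - v.1)))%C =
    (0 +i* 1)%C * (h.1%:C%C * (v.2%:C%C - w.2%:C%C) + h.2%:C%C * (w.1%:C%C - v.1%:C%C)).
    by apply: complex_ext => /=; ring.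
  by ring.
apply: (le_trans (n1M _ _)); rewrite -mulrA ler_wpM2l ?n1_ge0//.
rewrite mulrAC.
have mR : cmeas Rm.
  apply: cmeasM; first by apply: cmeas_tker; [case: rf|case: rg].
  have md : measurable_fun setT (fun z : (R * R) * (R * R) => dl z.2 z.1).
    have m1 : measurable_fun setT (fun z : (R * R) * (R * R) => z.1).
  exact: measurable_fst.
    have m2 : measurable_fun setT (fun z : (R * R) * (R * R) => z.2).
  exact: measurable_snd.
    apply: measurable_funD; (apply: measurable_funM; first exact: measurable_cst);
      apply: measurable_funB; solve [exact: measurable_fun_fst|exact: measurable_fun_snd].
  apply: cmeasD.
    apply: cmeasD; first exact: cmeas_expi.
    exact: cmeas_cst.
  by apply: cmeasN; split => //=; exact: measurable_cst.
apply: JJ_bound => // w v.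
apply: (le_trans (n1M _ _)).
have A1 : n1 (tker f g u (w, v)) <= 2 * (n1 (f v) * n1 (g w)).
  rewrite mulrC; apply: (le_trans (n1M _ _)).
  by rewrite ler_pM ?n1_ge0 ?n1_expi// n1M.
have A2 := n1_expiB1 (dl v w).
(* The difference of the two sides is a sum of squares: Lagrange's identity for h and v - w, then
   the parallelogram law, which bounds |v - w|^2 by 2 |v|^2 + 2 |w|^2. *)
have A3 : dl v w ^+ 2 <= 2 * (h.1 ^+ 2 + h.2 ^+ 2) *
   ((v.1 ^+ 2 + v.2 ^+ 2) + (w.1 ^+ 2 + w.2 ^+ 2)).
  rewrite /dl; move: h.1 h.2 v.1 v.2 w.1 w.2 => a b x y z t.
  have H1 := sqr_ge0 (a * (x - z) + b * (y - t)).
  have H2 := mulr_ge0 (addr_ge0 (sqr_ge0 a) (sqr_ge0 b)) (addr_ge0 (sqr_ge0 (x + z)) (sqr_ge0 (y + t))).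
  rewrite -subr_ge0; set X := (X in 0 <= X).
  have -> : X = (a * (x - z) + b * (y - t)) ^+ 2 +
    (a ^+ 2 + b ^+ 2) * ((x + z) ^+ 2 + (y + t) ^+ 2) by rewrite /X; ring.
  exact: addr_ge0.
apply: (le_trans (ler_pM (n1_ge0 _) (n1_ge0 _) A1 A2)).
have A4 : n1 (f v) * n1 (g w) * ((v.1 ^+ 2 + v.2 ^+ 2) + (w.1 ^+ 2 + w.2 ^+ 2)) <=
   (Mf * Jp v) * (Mg * Jp w).
  apply: le_trans (ler_pM _ _ (hf v) (hg w)); last 2 first.
  - by rewrite mulr_ge0 ?n1_ge0// !addr_ge0 ?sqr_ge0.
  - by rewrite mulr_ge0 ?n1_ge0// !addr_ge0 ?sqr_ge0.
  rewrite mulrACA ler_wpM2l ?mulr_ge0 ?n1_ge0//.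
  have := mulr_ge0 (addr_ge0 (sqr_ge0 v.1) (sqr_ge0 v.2)) (addr_ge0 (sqr_ge0 w.1) (sqr_ge0 w.2)).
  nra.
have nn : 0 <= n1 (f v) * n1 (g w) by rewrite mulr_ge0 ?n1_ge0.
have hh : 0 <= h.1 ^+ 2 + h.2 ^+ 2 by rewrite addr_ge0 ?sqr_ge0.
apply: (@le_trans _ _ (4 * (n1 (f v) * n1 (g w)) * (2 * (h.1 ^+ 2 + h.2 ^+ 2) *
   ((v.1 ^+ 2 + v.2 ^+ 2) + (w.1 ^+ 2 + w.2 ^+ 2))))).
  rewrite (_ : 2 * _ * (2 * _) = 4 * (n1 (f v) * n1 (g w)) * dl v w ^+ 2); last by ring.
  by rewrite ler_wpM2l// mulr_ge0.
have := ler_wpM2l hh A4.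
move=> H; rewrite -mulrA mulrCA [leLHS](_ : _ = 8 * ((h.1 ^+ 2 + h.2 ^+ 2) *
  (n1 (f v) * n1 (g w) * (v.1 ^+ 2 + v.2 ^+ 2 + (w.1 ^+ 2 + w.2 ^+ 2))))); last by ring.
rewrite [leRHS](_ : _ = 8 * ((h.1 ^+ 2 + h.2 ^+ 2) * (Mf * Jp v * (Mg * Jp w)))); last by ring.
by rewrite ler_pM2l.
Qed.

Lemma twisted_diff f g : S2 f -> S2 g ->
  cdiff (twisted f g) /\ forall b, cD b (twisted f g) = dtw b f g.
Proof.
move=> Sf Sg; have [C hC] := twisted_expansion Sf Sg.
have hr u := @differentiable_quadratic R (Re \o twisted f g) u
  (Re (dtw false f g u)) (Re (dtw true f g u)) C.
have hi u := @differentiable_quadratic R (Im \o twisted f g) u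
  (Im (dtw false f g u)) (Im (dtw true f g u)) C.
have {}hr u : differentiable (Re \o twisted f g) u /\
    forall b, 'D_(dir R b) (Re \o twisted f g) u = Re (dtw b f g u).
  have [h|d1 d2] := hr u; last by split => // b; rewrite d2; case: b.
  apply: le_trans (hC u h); apply: le_trans (Re_le_n1 _).
  rewrite /comp; move: (twisted f g (h + u)) (twisted f g u) (dtw false f g u) (dtw true f g u).
  move=> [a b] [c d] [k l] [m n] /=; rewrite !mul0r !subr0.
  by rewrite le_eqVlt; apply/orP; left; apply/eqP; congr (`|_|); ring.
have {}hi u : differentiable (Im \o twisted f g) u /\
    forall b, 'D_(dir R b) (Im \o twisted f g) u = Im (dtw b f g u).
  have [h|d1 d2] := hi u; last by split => // b; rewrite d2; case: b.
  apply: le_trans (hC u h); apply: le_trans (Im_le_n1 _).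
  rewrite /comp; move: (twisted f g (h + u)) (twisted f g u) (dtw false f g u) (dtw true f g u).
  move=> [a b] [c d] [k l] [m n] /=; rewrite !mul0r !addr0.
  by rewrite le_eqVlt; apply/orP; left; apply/eqP; congr (`|_|); ring.
split=> [u|b]; first by split; [case: (hr u)|case: (hi u)].
apply/funext => u; apply: complex_ext => /=; first by have [_ ->] := hr u.
by have [_ ->] := hi u.
Qed.

Definition mtw b f (u : R * R) : R[i] :=
  (if b then (0 +i* -1)%C else (0 +i* 1)%C) * cD (~~ b) f u.

Lemma schwartz_mtw b f : S2 f -> S2 (mtw b f).
Proof. by move=> Sf; apply: schwartzZ; exact: schwartz_cD. Qed.

(** The coordinate of v other than b enters the phase with coefficient plus or minus u_b - w_b.
    Multiplication by u_b - w_b is thus a derivative of the exponential in v, which integration by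
    parts moves onto f. In particular q (f x g) = f x (q g) + (i d_p f) x g. *)
Lemma twisted_coord b f g : S2 f -> S2 g ->
  (fun u => (coord b u)%:C%C * twisted f g u) =
  (fun u => twisted f (fun w => (coord b w)%:C%C * g w) u +
            twisted (mtw b f) g u).
Proof.
move=> Sf Sg; apply/funext => u.
have Scg := schwartz_coord b Sg; have Smf := schwartz_mtw b Sf.
have rf := rapid_schwartz Sf; have rg := rapid_schwartz Sg.
have rcg := rapid_schwartz Scg; have rmf := rapid_schwartz Smf.
rewrite !twistedE//.
have i1 := tker_integrable u rf rg.
have i2 := tker_integrable u rf rcg.
have i3 := tker_integrable u rmf rg.
pose F := fun z => ((coord b u)%:C%C * tker f g u z -
  tker f (fun w => (coord b w)%:C%C * g w) u z) - tker (mtw b f) g u z.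
have i12 := CintegrableD (CintegrableZ (coord b u)%:C%C i1) (CintegrableN i2).
suff F0 : Cintegral leb4 F = 0.
  apply/eqP; rewrite -subr_eq0 -mulrDr mulrCA -mulrBr opprD addrA.
  rewrite -CintegralZ// -(CintegralB (CintegrableZ (coord b u)%:C%C i1) i2).
  by rewrite -(CintegralB i12 i3) F0 mulr0.
have [M1 h1] := tker_bound rf rg; have [M2 h2] := tker_bound rf rcg.
have [M3 h3] := tker_bound rmf rg.
have mt f' g' : rapid f' -> rapid g' -> cmeas (tker f' g' u).
  by move=> [? _] [? _]; exact: cmeas_tker.
rewrite -(@JJ1 F (`|coord b u| * M1 + M2 + M3)); last 2 first.
- apply: cmeasD; last by apply: cmeasN; exact: mt.
  by apply: cmeasD; [apply: cmeasZ; exact: mt|apply: cmeasN; exact: mt].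
- move=> x y; rewrite /F.
  apply: (le_trans (n1D _ _)); rewrite n1N -mulrA mulrDl.
  apply: lerD; last by rewrite mulrA; exact: h3.
  apply: (le_trans (n1D _ _)); rewrite n1N mulrDl.
  apply: lerD; last by rewrite mulrA; exact: h2.
  apply: (le_trans (n1M _ _)); rewrite n1_real -mulrA ler_wpM2l//.
  by rewrite mulrA; exact: h1.
rewrite (_ : (fun x => _) = fun x => 0 * 0).
  rewrite CintegralZ ?mul0r//; split;
    rewrite (_ : _ \o _ = cst 0%E)//; exact: integrable0.
apply/funext => w; rewrite mulr0.
(* [al] and [be] are the coefficients in the phase of the coordinate [~~ b] of v and of the
   coordinate b. *)
pose al := if b then w.2 - u.2 else u.1 - w.1.
pose be := if b then u.1 - w.1 else w.2 - u.2.
have := @schwartz_ibp R f (~~ b) al be (symp w u) Sf.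
set I := Cintegral _ _ => I0.
pose z0 : R[i] := (if b then (0 +i* 1)%C else (0 +i* -1)%C).
have -> : Cintegral leb2 (fun y => F (w, y)) = (z0 * g w) * I; last by rewrite I0 mulr0.
rewrite /I -CintegralZ.
  apply: eq_Cintegral => v; rewrite /F /tker /mtw /=.
  have -> : al * coord (~~ b) v + be * coord (~~ ~~ b) v + symp w u = phase u v w.
    by rewrite /al /be /phase /symp; case: (b) => /=; ring.
  set e := expi _.
  have -> : (coord b u)%:C%C * (f v * g w * e) - f v * ((coord b w)%:C%C * g w) * e -
     (if b then (0 +i* -1)%C else (0 +i* 1)%C) * cD (~~ b) f v * g w * e =
     g w * e * (((coord b u)%:C%C - (coord b w)%:C%C) * f v -
      (if b then (0 +i* -1)%C else (0 +i* 1)%C) * cD (~~ b) f v) by ring.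
  rewrite (_ : z0 * g w * _ = g w * e * (z0 * (cD (~~ b) f v + (0 +i* al)%C * f v))); last by ring.
  congr (_ * _); rewrite /z0 /al.
  case: (b); case: (f v) => x y; apply: complex_ext => /=; ring.
have [mf [Mf Mf0 hf]] := rf.
have [mf' [Mf' Mf'0 hf']] := rapid_schwartz (schwartz_cD (~~ b) Sf).
apply: (@dominated_Cintegrable _ _ R leb2 _ (fun v => ((Mf' + `|al| * Mf) * 2) * Jp v)).
- apply: cmeasM; first by apply: cmeasD => //; exact: cmeasZ.
  have mc c : measurable_fun setT (@coord R c).
    by apply: continuous_measurable_plane => v; apply: differentiable_continuous;
      exact: differentiable_coord.
  apply: cmeas_expi; apply: measurable_funD; last exact: measurable_cst.
  by apply: measurable_funD; (apply: measurable_funM; first exact: measurable_cst);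
    exact: mc.
- exact: integrable_JpM.
- move=> v; apply: (le_trans (n1M _ _)); rewrite mulrAC.
  apply: ler_pM; rewrite ?n1_ge0 ?n1_expi//.
  apply: (le_trans (n1D _ _)); rewrite mulrDl lerD//.
  apply: (le_trans (n1M _ _)); rewrite -mulrA ler_pM ?n1_ge0//.
  by rewrite /n1/= normr0 add0r.
Qed.

(* A class stable under partial derivatives and multiplication by coordinates,
   so that [schwartz_coind] applies. *)
Inductive tclass : (R * R -> R[i]) -> Prop :=
| tclass_tw f g : S2 f -> S2 g -> tclass (twisted f g)
| tclass_add F G : tclass F -> tclass G -> tclass (fun u => F u + G u).

Lemma cDD b f g : cdiff f -> cdiff g ->
  cD b (fun u => f u + g u) = fun u => cD b f u + cD b g u.
Proof.
move=> df dg; apply/funext => u; have [f1 f2] := df u; have [g1 g2] := dg u.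
apply: complex_ext => /=.
  rewrite (_ : _ \o _ = fun u => (Re \o f) u + (Re \o g) u).
    by rewrite deriveD//; exact: diff_derivable.
  by apply/funext => v /=; rewrite raddfD.
rewrite (_ : _ \o _ = fun u => (Im \o f) u + (Im \o g) u).
  by rewrite deriveD//; exact: diff_derivable.
by apply/funext => v /=; rewrite raddfD.
Qed.

Lemma cdiffD f g : cdiff f -> cdiff g -> cdiff (fun u => f u + g u).
Proof.
move=> df dg u; have [f1 f2] := df u; have [g1 g2] := dg u; split.
  rewrite (_ : _ \o _ = fun u => (Re \o f) u + (Re \o g) u).
    exact: differentiableD.
  by apply/funext => v /=; rewrite raddfD.
rewrite (_ : _ \o _ = fun u => (Im \o f) u + (Im \o g) u).
  exact: differentiableD.
by apply/funext => v /=; rewrite raddfD.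
Qed.

Lemma twistedZl z f g : S2 f -> S2 g ->
  twisted (fun u => z * f u) g = fun u => z * twisted f g u.
Proof.
move=> Sf Sg; apply/funext => u.
have rf := rapid_schwartz Sf; have rg := rapid_schwartz Sg.
have rzf := rapid_schwartz (schwartzZ z Sf).
rewrite !twistedE// mulrCA -(CintegralZ z (tker_integrable u rf rg)).
congr (_ * _); apply: eq_Cintegral => x; rewrite /tker; ring.
Qed.

(** Induction on the class: [twisted_diff] and [twisted_coord] express derivatives and coordinate
    multiples of a twisted product as sums of twisted products of Schwartz functions. *)
Lemma tclass_schwartz F : tclass F -> S2 F.
Proof.
apply: schwartz_coind => {}F; elim=> {F}[f g Sf Sg|F G tF [dF [M1 h1] cF DF] tG [dG [M2 h2] cG DG]].
- have [df Df] := twisted_diff Sf Sg; split => //.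
  + by apply: twisted_bounded; exact: rapid_schwartz.
  + move=> b; rewrite twisted_coord//.
    apply: tclass_add; apply: tclass_tw => //; first exact: schwartz_coord.
    exact: schwartz_mtw.
  (* [tclass] has no scalar constructor, so the sign is absorbed by the left factor. *)
  + have N f' g' : S2 f' -> S2 g' -> tclass (fun u => - twisted f' g' u).
      move=> Sf' Sg'; have := tclass_tw (schwartzZ (-1) Sf') Sg'.
      rewrite twistedZl//; congr tclass; apply/funext => u; exact: mulN1r.
    move=> b; rewrite Df /dtw; case: b.
      apply: tclass_add; first by apply: tclass_tw => //; exact: schwartz_icoord.
      by apply: N => //; exact: schwartz_icoord.
    apply: tclass_add; first by apply: tclass_tw => //; exact: schwartz_icoord.
    by apply: N => //; exact: schwartz_icoord.
- split.
  + exact: cdiffD.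
  + by exists (M1 + M2) => u; apply: (le_trans (n1D _ _)); exact: lerD.
  + move=> b; have := tclass_add (cF b) (cG b); congr tclass.
    by apply/funext => u; rewrite mulrDr.
  + by move=> b; rewrite cDD//; exact: tclass_add.
Qed.

Lemma schwartz_twisted f g : S2 f -> S2 g -> S2 (twisted f g).
Proof. by move=> Sf Sg; apply: tclass_schwartz; exact: tclass_tw. Qed.

End twisted_theory.

Lemma inv_nat_small (R : realType) (e : R) : 0 < e -> exists N, forall n, (N <= n)%N -> n.+1%:R^-1 < e.
Proof.
move=> e0; have [N hN] := ltr_add_invr e0.
exists N => n Nn; apply: le_lt_trans (_ : N.+1%:R^-1 < e); last by move: hN; rewrite add0r.
by rewrite lef_pV2 ?posrE// ler_nat.
Qed.

Lemma ltr0C (R : realType) (x : R) : (0 < x%:C%C :> R[i]) = (0 < x).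
Proof. by rewrite -[0]/(0%:C%C) ltcR. Qed.

(** * Hilbert spaces *)

Section prehilbert.
Variables (R : realType) (V : preHilbertType R).
Implicit Types x y z : V.

(** The norm has its values in [R[i]], which is only partially ordered; its real part carries the
    same information in an ordered field. *)
Definition rn x : R := Re `|x|.

Lemma rnE x : `|x| = (rn x)%:C%C.
Proof.
have : `|x| \is Num.real by exact: normr_real.
rewrite /rn; case: (`|x|) => a b /= /complex_realP[k [-> ->]]//.
Qed.

Lemma rn_ge0 x : 0 <= rn x.
Proof. by rewrite -ler0c -rnE. Qed.

Lemma rnD x y : rn (x + y) <= rn x + rn y.
Proof. by rewrite -lecR rmorphD/= -!rnE ler_normD. Qed.

Lemma rnN x : rn (- x) = rn x.
Proof. by rewrite /rn normrN. Qed.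

Lemma rnB x y : rn (x - y) = rn (y - x).
Proof. by rewrite -rnN opprB. Qed.

Lemma rn0 : rn 0 = 0.
Proof. by rewrite /rn normr0. Qed.

Lemma rn_eq0 x : rn x = 0 -> x = 0.
Proof. by move=> h; apply/normr0_eq0; rewrite rnE h. Qed.

Lemma rnZ (a : R[i]) x : rn (a *: x) = Re `|a| * rn x.
Proof.
rewrite /rn normrZ rnE; have : `|a| \is Num.real by exact: normr_real.
by case: (`|a|) => c d /=; rewrite mulr0 subr0.
Qed.

Lemma Re_norm_le (a : R[i]) : Re `|a| <= n1 a.
Proof.
case: a => a b; rewrite normc_def /= /n1/=.
rewrite -(@ler_pXn2r _ 2) ?nnegrE ?sqrtr_ge0 ?addr_ge0//.
rewrite sqr_sqrtr ?addr_ge0 ?sqr_ge0// -(real_normK (num_real a)).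
rewrite -(real_normK (num_real b)).
by have := normr_ge0 a; have := normr_ge0 b; nra.
Qed.

Lemma rnZ_le (a : R[i]) x : rn (a *: x) <= n1 a * rn x.
Proof. by rewrite rnZ ler_wpM2r ?rn_ge0 ?Re_norm_le. Qed.

Lemma innerDr z x y : inner z (x + y) = inner z x + inner z y.
Proof. by have := inner_linear z 1 x y; rewrite scale1r mul1r. Qed.

Lemma inner0r z : inner z (0 : V) = 0.
Proof. by apply: (addrI (inner z 0)); rewrite -innerDr !addr0. Qed.

Lemma innerZr z (a : R[i]) x : inner z (a *: x) = a * inner z x.
Proof. by have := inner_linear z a x 0; rewrite !addr0 inner0r addr0. Qed.

Lemma innerNr z x : inner z (- x) = - inner z x.
Proof. by rewrite -scaleN1r innerZr mulN1r. Qed.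

Lemma innerBr z x y : inner z (x - y) = inner z x - inner z y.
Proof. by rewrite innerDr innerNr. Qed.

Lemma innerDl x y z : inner (x + y) z = inner x z + inner y z.
Proof. by rewrite inner_conj innerDr rmorphD/= -!inner_conj. Qed.

Lemma innerZl (a : R[i]) x z : inner (a *: x) z = (a^*)%C * inner x z.
Proof. by rewrite inner_conj innerZr rmorphM/= -inner_conj. Qed.

Lemma inner0l z : inner (0 : V) z = 0.
Proof. by rewrite inner_conj inner0r rmorph0. Qed.

Lemma innerNl x z : inner (- x) z = - inner x z.
Proof. by rewrite inner_conj innerNr rmorphN/= -inner_conj. Qed.

Lemma innerBl x y z : inner (x - y) z = inner x z - inner y z.
Proof. by rewrite innerDl innerNl. Qed.

Lemma rn_sqr x : inner x x = (rn x ^+ 2)%:C%C.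
Proof. by rewrite inner_norm rnE rmorphXn. Qed.

Lemma rnD_sqr x y : rn (x + y) ^+ 2 = rn x ^+ 2 + 2 * Re (inner x y) + rn y ^+ 2.
Proof.
have : inner (x + y) (x + y) = inner x x + inner x y + (inner y x + inner y y).
  by rewrite innerDl !innerDr.
rewrite (inner_conj x y) !rn_sqr; case: (inner x y) => a b.
by move=> /(congr1 Re) /= ->; ring.
Qed.

Lemma rnB_sqr x y : rn (x - y) ^+ 2 = rn x ^+ 2 - 2 * Re (inner x y) + rn y ^+ 2.
Proof.
rewrite rnD_sqr innerNr rnN; case: (inner x y) => a b /=.
by rewrite mulrN.
Qed.

Lemma Re_inner_le x y : Re (inner x y) <= rn x * rn y.
Proof.
have x0 := rn_ge0 x; have y0 := rn_ge0 y.
have [/rn_eq0 ->|yn0] := eqVneq (rn y) 0; first by rewrite inner0r rn0 mulr0.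
have y_gt0 : 0 < rn y by rewrite lt_def yn0.
have E (t : R) : Re `|t%:C%C : R[i]| ^+ 2 = t ^+ 2.
  by rewrite normc_def/= expr0n addr0 sqrtr_sqr real_normK ?num_real.
pose t := Re (inner x y) / rn y ^+ 2.
have := sqr_ge0 (rn (x - t%:C%C *: y)).
rewrite rnB_sqr rnZ exprMn E innerZr /t; case: (inner x y) => a b /=.
rewrite mul0r subr0 => h.
have {}h : a ^+ 2 <= (rn x * rn y) ^+ 2.
  have := mulr_ge0 (sqr_ge0 (rn y)) h.
  have : a / rn y ^+ 2 * rn y ^+ 2 = a by rewrite divfK// expf_neq0.
  move: (a / _) => q <-; lra.
have xy0 : 0 <= rn x * rn y by rewrite mulr_ge0.
by rewrite -(ger0_norm xy0) (le_trans (ler_norm a))// -ler_sqr ?nnegrE// !real_normK ?num_real.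
Qed.

(** The Cauchy-Schwarz inequality for real parts is applied to the pairs (x, y), (-x, y), (x, i y)
    and (x, -i y), which bounds both parts of the inner product. *)
Lemma n1_inner_le x y : n1 (inner x y) <= 2 * (rn x * rn y).
Proof.
have h1 := Re_inner_le x y; have := Re_inner_le (- x) y.
have := Re_inner_le x ((0 +i* 1)%C *: y); have := Re_inner_le x ((0 +i* -1)%C *: y).
rewrite rnN innerNl !innerZr !rnZ; move: h1.
rewrite !normc_def/= expr0n sqrrN expr1n !add0r sqrtr1 !mul1r.
case: (inner x y) => a b /=; rewrite !mul0r !sub0r mulN1r mul1r opprK /n1/= => h1 h2 h3 h4.
have : `|a| <= rn x * rn y by rewrite ler_norml; apply/andP; split; lra.
have : `|b| <= rn x * rn y by rewrite ler_norml; apply/andP; split; lra.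
lra.
Qed.

Definition cvgs (u : nat -> V) (l : V) :=
  forall e : R, 0 < e -> exists N, forall n, (N <= n)%N -> rn (u n - l) < e.

Definition cauchys (u : nat -> V) :=
  forall e : R, 0 < e -> exists N, forall m n, (N <= m)%N -> (N <= n)%N -> rn (u m - u n) < e.

Definition completes := forall u, cauchys u -> exists l, cvgs u l.

Section projection.
Variables (M L : V -> Prop).
Hypotheses (M0 : M 0) (Mlin : forall (a : R[i]) x y, M x -> M y -> M (a *: x + y)).
Hypothesis Mcomp : forall u, (forall n, M (u n)) -> cauchys u -> exists2 l, L l & cvgs u l.

(** Minimizing sequences in M are Cauchy by the parallelogram law. The set L that receives their
    limits is kept apart from M, so that the result covers a subspace that is not closed in a
    complete space as well as the complete range of an isometry. *)
Lemma projection x : exists y, [/\ L y,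
  forall e : R, 0 < e -> exists2 m, M m & rn (m - y) < e &
  forall m, M m -> inner m (x - y) = 0].
Proof.
pose S := [set rn (x - m) | m in M].
have S0 : S !=set0 by exists (rn (x - 0)), 0.
have Slb : lbound S 0 by move=> _ [m _ <-]; exact: rn_ge0.
have Sinf : has_inf S by split => //; exists 0.
pose s := inf S.
have s0 : 0 <= s by apply: lb_le_inf.
have sM m : M m -> s <= rn (x - m).
  by move=> Mm; apply: ge_inf; [case: Sinf|exists m].
have /choice[u uP] : forall n : nat, exists m, M m /\ rn (x - m) < s + n.+1%:R^-1.
  move=> n; have n0 : (0 : R) < n.+1%:R^-1 by [].
  by have [_ [m Mm <-] h] := inf_adherent n0 Sinf; exists m.
have uM n : M (u n) by case: (uP n).
have us n : rn (x - u n) < s + n.+1%:R^-1 by case: (uP n).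
have n1le n : (n.+1%:R : R)^-1 <= 1 by rewrite invf_le1// ler1n.
(* Parallelogram law for x - u_m and x - u_n: their midpoint is x minus an element of M, so its norm
   is at least s. *)
have par m n : rn (u m - u n) ^+ 2 <= (4 * s + 2) * (m.+1%:R^-1 + n.+1%:R^-1).
  have p1 := rnD_sqr (x - u m) (x - u n); have p2 := rnB_sqr (x - u m) (x - u n).
  have mid : 2 * s <= rn ((x - u m) + (x - u n)).
    have -> : (x - u m) + (x - u n) = 2 *: (x - 2^-1 *: (u m + u n)).
      rewrite scalerBr scalerA divff ?pnatr_eq0// scale1r scaler_nat mulr2n.
      by rewrite addrACA opprD.
    rewrite rnZ (_ : Re `|2 : R[i]| = 2) ?ler_pM2l//; last first.
      by rewrite ger0_norm//.
    apply: sM; rewrite scalerDr -[X in _ + X]addr0; apply: (Mlin) => //; exact: (Mlin).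
  have -> : u m - u n = - ((x - u m) - (x - u n)).
    by rewrite opprB opprB [RHS]addrC addrA subrK.
  rewrite rnN; have := us m; have := us n; have := rn_ge0 (x - u m).
  have := rn_ge0 (x - u n).
  have := n1le m; have := n1le n.
  have : (0 : R) < m.+1%:R^-1 by [].
  have : (0 : R) < n.+1%:R^-1 by [].
  move: (m.+1%:R^-1) (n.+1%:R^-1) p1 p2 mid => dm dn.
  move: (rn (_ + _)) (rn (x - u m - _)) (rn (x - u m)) (rn (x - u n)) => A B a b.
  move: (Re _) => t p1 p2 mid dn0 dm0 dn1 dm1 b0 a0 bs as'.
  have A2 : (2 * s) ^+ 2 <= A ^+ 2 by rewrite ler_sqr ?nnegrE ?mulr_ge0//; lra.
  have a2 : a ^+ 2 <= (s + dm) ^+ 2 by rewrite ler_sqr ?nnegrE//; lra.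
  have b2 : b ^+ 2 <= (s + dn) ^+ 2 by rewrite ler_sqr ?nnegrE//; lra.
  have dm2 : dm ^+ 2 <= dm by rewrite expr2 ler_piMl// ltW.
  have dn2 : dn ^+ 2 <= dn by rewrite expr2 ler_piMl// ltW.
  lra.
have cu : cauchys u.
  move=> e e0.
  have e2 : 0 < e ^+ 2 / (2 * (4 * s + 2)) by rewrite divr_gt0 ?exprn_gt0// mulr_gt0// ltr_wpDl// mulr_ge0.
  have [N hN] := inv_nat_small e2; exists N => m n Nm Nn.
  rewrite -(@ltr_pXn2r _ 2) ?nnegrE ?rn_ge0 ?ltW//; apply: (le_lt_trans (par m n)).
  have k0 : 0 < 4 * s + 2 by rewrite ltr_wpDl// mulr_ge0.
  have := hN m Nm; have := hN n Nn; rewrite !ltr_pdivlMr ?mulr_gt0//.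
  move: (m.+1%:R^-1) (n.+1%:R^-1) => dm dn; nra.
have [y Ly uy] := Mcomp uM cu.
have ys : rn (x - y) <= s.
  apply/ler_addgt0Pl => e e0; have e2 : 0 < e / 2 by rewrite divr_gt0.
  have [N1 h1] := uy _ e2; have [N2 h2] := inv_nat_small e2.
  pose n := maxn N1 N2; have := h1 n (leq_maxl _ _); have := h2 n (leq_maxr _ _).
  have := us n; have := rnD (x - u n) (u n - y); rewrite addrA subrK.
  move: (rn (x - y)) (rn (x - u n)) (rn (u n - y)) (n.+1%:R^-1) => a b c d *; lra.
exists y; split => // [e e0|m Mm].
  by have [N hN] := uy e e0; exists (u N) => //; exact: hN.
have sy m' : M m' -> s <= rn (x - y - m').
  move=> Mm'; apply/ler_addgt0Pl => e e0; have [N hN] := uy e e0.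
  have := hN N (leqnn _); have := sM (u N + m').
  have MN : M (u N + m') by rewrite -[u N]scale1r; exact: Mlin.
  move=> /(_ MN); have := rnD (x - y - m') (y - u N); rewrite (rnB (u N)).
  rewrite (_ : x - y - m' + (y - u N) = x - (u N + m')).
    move: (rn (x - y - m')) (rn (u N - y)) (rn (x - (u N + m'))) => a b c *; lra.
  by rewrite [x - y - m']addrAC addrA subrK opprD addrA addrAC.
pose h := x - y; pose c := inner m h; pose k := Re c ^+ 2 + Im c ^+ 2.
have k0 : 0 <= k by rewrite addr_ge0 ?sqr_ge0.
suff : k <= 0.
  move=> k1; have /eqP : k = 0 by apply/eqP; rewrite eq_le k1.
  rewrite paddr_eq0 ?sqr_ge0// !sqrf_eq0 => /andP[/eqP c1 /eqP c2].
  exact: complex_ext.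
(* Comparing h with h - t c m gives 2 t k <= t^2 k |m|^2. The added 1 keeps t defined for m = 0 and
   makes t |m|^2 = 1 - t < 1, which forces k <= 0. *)
pose t := (rn m ^+ 2 + 1)^-1.
have rm0 : 0 < rn m ^+ 2 + 1 by rewrite ltr_wpDl ?sqr_ge0.
have t0 : 0 < t by rewrite invr_gt0.
have Mm' : M ((t%:C%C * c) *: m) by rewrite -[_ *: m]addr0; exact: Mlin.
have := sy _ Mm'; rewrite -/h => sh.
have : rn h ^+ 2 <= rn (h - (t%:C%C * c) *: m) ^+ 2.
  by rewrite ler_sqr ?nnegrE ?rn_ge0//; apply: le_trans sh.
rewrite rnB_sqr innerZr (inner_conj m h) -/c rnZ exprMn.
have -> : Re `|t%:C%C * c| ^+ 2 = t ^+ 2 * k.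
  rewrite normc_def /k; case: (c) => c1 c2 /=.
  by rewrite sqr_sqrtr ?addr_ge0 ?sqr_ge0//; ring.
have -> : Re (t%:C%C * c * (c^*)%C) = t * k.
  by rewrite /k; case: (c) => c1 c2 /=; ring.
have : t * (rn m ^+ 2 + 1) = 1 by rewrite mulVf ?gt_eqF.
move: k k0 => k k0 ht H.
have E : t ^+ 2 * k * rn m ^+ 2 = t * k * (1 - t).
  by rewrite (_ : 1 - t = t * rn m ^+ 2); [ring|lra].
rewrite -(pmulr_rle0 _ t0); have tk0 : 0 <= t * k by rewrite mulr_ge0// ltW.
have := mulr_ge0 (ltW t0) tk0; move: H; rewrite E; lra.
Qed.

End projection.

End prehilbert.

Section hilbert.
Variables (R : realType) (V : preHilbertType R).
Implicit Types x y : V.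

(** The difference of x and its projection is orthogonal to M, hence zero. *)
Lemma dense_subspace (M : V -> Prop) : completes V -> M 0 ->
    (forall (a : R[i]) x y, M x -> M y -> M (a *: x + y)) ->
    (forall h, (forall m, M m -> inner m h = 0) -> h = 0) ->
  forall x (e : R), 0 < e -> exists2 m, M m & rn (m - x) < e.
Proof.
move=> cV M0 Ml Mo x.
have [|y [_ yM yo]] := @projection R V M (fun=> True) M0 Ml _ x.
  by move=> u _ cu; have [l ul] := cV u cu; exists l.
by move/Mo/subr0_eq : yo => ->.
Qed.

Lemma inner_ext x y : (forall z, inner z x = inner z y) -> x = y.
Proof.
move=> h; apply/subr0_eq/rn_eq0; have := rn_sqr (x - y).
rewrite innerBr h subrr => /(congr1 Re)/= /esym/eqP.
by rewrite sqrf_eq0 => /eqP.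
Qed.

Lemma closureP (A : set V) x : closure A x <->
  forall e : R, 0 < e -> exists2 a, A a & rn (a - x) < e.
Proof.
split=> [cA e e0|h B].
  have [|a [Aa]] := cA (ball x e%:C%C).
    by apply: nbhsx_ballx; rewrite ltr0C.
  rewrite -ball_normE/= => xa; exists a => //.
  by rewrite rnB -ltcR -rnE.
move=> /nbhs_ballP[e /= e0 eB].
have [k ke] : exists k : R, e = k%:C%C.
  by move: (gtr0_real e0); case: e {eB e0} => a b /complex_realP[k ->]; exists k.
have [|a Aa xa] := h k; first by rewrite -ltr0C -ke.
exists a; split=> //; apply: eB; rewrite -ball_normE/=.
by rewrite distrC rnE ke ltcR.
Qed.

End hilbert.

Section adjoint.
Variables (R : realType) (V1 V2 : preHilbertType R) (J : V1 -> V2).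
Hypothesis cV1 : completes V1.
Hypothesis Jlin : forall (a : R[i]) x y, J (a *: x + y) = a *: J x + J y.
Hypothesis Jiso : forall x y, inner (J x) (J y) = inner x y.

(** The range of an isometry with complete domain is complete, so F has a projection J phi on it,
    and phi is the value of the adjoint at F. *)
Lemma adjoint_ex F : exists phi, forall psi, inner psi phi = inner (J psi) F.
Proof.
have JB x y : J (x - y) = J x - J y.
  by rewrite addrC -scaleN1r Jlin scaleN1r addrC.
have Jrn x : rn (J x) = rn x.
  apply/eqP; rewrite -(@eqrXn2 _ 2) ?rn_ge0//; apply/eqP.
  by have := Jiso x x; rewrite !rn_sqr => -[].
have J0 : J 0 = 0 by have := JB 0 0; rewrite subr0 subrr.
have [|a x y [x' <-] [y' <-]|u uM cu|y [[phi phiy] _ yo]] := 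
    @projection R V2 (fun y => exists x, J x = y) (fun y => exists x, J x = y) _ _ _ F.
- by exists 0.
- by exists (a *: x' + y'); rewrite Jlin.
- have /choice[v vu] := uM.
  have [|l vl] := cV1 (u := v).
    move=> e e0; have [N hN] := cu e e0; exists N => m n Nm Nn.
    by rewrite -Jrn JB !vu; exact: hN.
  exists (J l); first by exists l.
  move=> e e0; have [N hN] := vl e e0; exists N => n Nn.
  by rewrite -vu -JB Jrn; exact: hN.
exists phi => psi; have := yo (J psi); rewrite innerBr -phiy Jiso.
by move=> /(_ (ex_intro _ psi erefl)) /subr0_eq.
Qed.

End adjoint.

(** * Extension by continuity *)

Section extension.
Variables (R : realType) (U V : preHilbertType R) (X : Type).
Variables (D : set X) (i : X -> U) (A : X -> V) (C : R).
Hypotheses (cV : completes V) (C0 : 0 <= C).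
Hypothesis AC : forall g g', D g -> D g' -> rn (A g - A g') <= C * rn (i g - i g').

(** A Lipschitz map has a limit along the filter, by completeness, and the Lipschitz estimate passes
    to it. This inequality is the only access to [ext_cont] used later: values on D, linearity and
    isometry all follow from it by approximation. *)
Lemma ext_contP x : closure (i @` D) x ->
  forall g, D g -> rn (A g - ext_cont D i A x) <= C * rn (i g - x).
Proof.
move=> /closureP cx.
have /choice[u uP] : forall n : nat, exists g, D g /\ rn (i g - x) < n.+1%:R^-1.
  by move=> n; have [//|_ [g Dg <-] h] := cx n.+1%:R^-1; exists g.
have C1 : 0 < C + 1 by rewrite ltr_wpDl.
have [|y uy] := cV (u := A \o u).
  move=> e e0; have e2 : 0 < e / (2 * (C + 1)) by rewrite divr_gt0// mulr_gt0.
  have [N hN] := inv_nat_small e2; exists N => m n Nm Nn /=.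
  have [Dm um] := uP m; have [Dn un] := uP n.
  apply: (le_lt_trans (AC Dm Dn)).
  have := rnD (i (u m) - x) (x - i (u n)); rewrite addrA subrK (rnB x).
  have := hN m Nm; have := hN n Nn; rewrite !ltr_pdivlMr ?mulr_gt0//.
  have := rn_ge0 (i (u m) - i (u n)).
  move: um un; move: (rn (_ - i _)) (rn (_ - x)) (rn (_ - x)) (m.+1%:R^-1) (n.+1%:R^-1).
  by move=> a b c dm dn *; nra.
have Ay g : D g -> rn (A g - y) <= C * rn (i g - x).
  move=> Dg; apply/ler_addgt0Pl => e e0.
  have e2 : 0 < e / (2 * (C + 1)) by rewrite divr_gt0// mulr_gt0.
  have e3 : 0 < e / 2 by rewrite divr_gt0.
  have [N1 h1] := inv_nat_small e2; have [N2 h2] := uy _ e3.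
  pose n := maxn N1 N2; have [Dn un] := uP n.
  have := h1 n (leq_maxl _ _); have := h2 n (leq_maxr _ _) => /= h3.
  have := AC Dg Dn; have := rnD (A g - A (u n)) (A (u n) - y); rewrite addrA subrK.
  have := rnD (i g - x) (x - i (u n)); rewrite addrA subrK (rnB x).
  rewrite ltr_pdivlMr ?mulr_gt0//; move: un h3.
  have := rn_ge0 (i (u n) - x).
  move: (rn (i (u n) - x)) (rn (A (u n) - y)) (n.+1%:R^-1) (rn (i g - i (u n))).
  move=> a b dn c a0 adn be cle H1 H2 H3.
  have k1 := ler_wpM2l C0 cle; have k2 := ler_wpM2l C0 (ltW adn).
  have k3 : 0 <= dn by lra.
  lra.
(* The filter is proper because x lies in the closure of the image of D; limits along it are then
   unique. *)
have PF : ProperFilter (filter_from (nbhs x) (fun B => D `&` (i @^-1` B))).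
  apply: filter_from_proper.
    apply: filter_from_filter; first by exists setT; exact: filterT.
    move=> P Q nP nQ; exists (P `&` Q); first exact: filterI.
    by move=> z [Dz [Pz Qz]].
  move=> B nB; have := (closureP (i @` D) x).2 cx B nB.
  by move=> [_ [[g Dg <-] Bg]]; exists g.
suff -> : ext_cont D i A x = y by [].
apply/cvg_lim => //.
apply/cvgrPdist_lt => e e0.
have [k ke] : exists k : R, e = k%:C%C.
  by move: (gtr0_real e0); case: e {e0} => a b /complex_realP[k ->]; exists k.
have k0 : 0 < k by rewrite -ltr0C -ke.
exists (ball x (k / (C + 1))%:C%C).
  by apply: nbhsx_ballx; rewrite ltr0C divr_gt0.
move=> g [Dg]; rewrite /= -ball_normE/= distrC rnE ltcR => xg.
rewrite distrC rnE ke ltcR; apply: (le_lt_trans (Ay g Dg)).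
move: xg; rewrite ltr_pdivlMr//; have := rn_ge0 (i g - x).
by move: (rn _) => a *; nra.
Qed.

End extension.

Section sequences_aux.
Variable R : realType.

Lemma sum2_le n : \sum_(0 <= k < n) (2 : R) ^- k <= 2.
Proof.
have -> : \sum_(0 <= k < n) (2 : R) ^- k = 2 - 2 * 2 ^- n.
  elim: n => [|n IH]; first by rewrite big_geq// expr0 invr1 mulr1 subrr.
  rewrite big_nat_recr//= IH exprS; field.
  by rewrite expf_neq0.
by rewrite gerBl mulr_ge0// invr_ge0 exprn_ge0.
Qed.

(** The telescoping series converges absolutely. *)
Lemma cvg_bounded_variation (B : R) (a : nat -> R) :
  (forall n, \sum_(0 <= k < n) `|a k.+1 - a k| <= B) -> cvgn a.
Proof.
move=> aB; have c : cvgn (series (telescope a)).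
  apply: (@normed_cvg R R^o); apply: nondecreasing_is_cvgn.
    apply/nondecreasing_seqP => n; rewrite -[leRHS]/(\sum_(0 <= k < n.+1) `|telescope a k|).
    by rewrite -[leLHS]/(\sum_(0 <= k < n) `|telescope a k|) big_nat_recr//= lerDl.
  by exists B => _ [n _ <-]; exact: aB.
have -> : a = fun n => a 0%N + series (telescope a) n by exact/funext/eq_sum_telescope.
by apply: is_cvgD => //; exact: is_cvg_cst.
Qed.

End sequences_aux.

(** * Completeness of L^2 *)

Section L2_theory.
Context d (T : measurableType d) (R : realType).
Variable mu : {measure set T -> \bar R}.
Implicit Types f g : T -> R[i].
Local Notation L2 := (L2 mu).
Local Notation L2fun := (@L2fun d T R mu).
Local Notation toL2 := (@toL2 d T R mu).

Definition sqn (z : R[i]) : R := Re z ^+ 2 + Im z ^+ 2.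

Lemma sqn_ge0 z : 0 <= sqn z.
Proof. by rewrite addr_ge0 ?sqr_ge0. Qed.

Lemma sqn_le_n1 z : sqn z <= n1 z ^+ 2.
Proof.
rewrite /sqn /n1 -(real_normK (num_real (Re z))) -(real_normK (num_real (Im z))).
by have := normr_ge0 (Re z); have := normr_ge0 (Im z); nra.
Qed.

Lemma Lfun2P (f : T -> R) : measurable_fun setT f ->
  mu.-integrable setT (EFin \o (fun x => f x ^+ 2)) -> f \in Lfun mu 2%:E.
Proof.
move=> mf /integrableP[_ fi]; rewrite inE; apply/andP; split; rewrite inE//=.
rewrite /finite_norm (@lty_poweRy _ _ 2)// powR_Lnorm//.
apply: le_lt_trans fi; apply: ge0_le_integral => //.
- move=> x _; exact: poweR_ge0.
- apply/measurable_EFinP.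
  apply/(@measurableT_comp _ _ _ _ _ _ (fun x : R => x `^ 2)%R) => //.
  exact/measurableT_comp.
- apply: measurableT_comp => //; apply/measurable_EFinP; exact: measurable_funX.
- by move=> t _ /=; rewrite lee_fin normrX powR_mulrn.
Qed.

Lemma L2funP f : cmeas f -> mu.-integrable setT (EFin \o (sqn \o f)) -> f \in L2fun.
Proof.
move=> [f1 f2] fi; apply/andP; split; apply: Lfun2P => //;
  apply: (le_integrable _ _ _ fi) => //; try by
    apply/measurable_EFinP; exact: measurable_funX.
  move=> x _ /=; rewrite lee_fin !ger0_norm ?sqn_ge0 ?sqr_ge0//.
  by rewrite /sqn lerDl sqr_ge0.
move=> x _ /=; rewrite lee_fin !ger0_norm ?sqn_ge0 ?sqr_ge0//.
by rewrite /sqn lerDr sqr_ge0.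
Qed.

Lemma L2fun_meas f : f \in L2fun -> cmeas f.
Proof.
move=> /andP[f1 f2]; split; [move: f1|move: f2]; rewrite inE => /andP[+ _];
  by rewrite inE.
Qed.

Lemma L2fun_sqn f : f \in L2fun -> mu.-integrable setT (EFin \o (sqn \o f)).
Proof.
move=> /andP[f1 f2]; rewrite (_ : _ \o _ = (EFin \o (fun x => (Re (f x)) ^+ 2)%R) \+
  (EFin \o (fun x => (Im (f x)) ^+ 2)%R))%E//.
by apply: integrableD => //; exact: Lfun2_integrable_sqr.
Qed.

Lemma L2fun_bound f (G : T -> R) : cmeas f -> mu.-integrable setT (EFin \o G) ->
  (forall x, n1 (f x) ^+ 2 <= G x) -> f \in L2fun.
Proof.
move=> mf iG fG; apply: L2funP => //; apply: (le_integrable _ _ _ iG) => //.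
  case: mf => f1 f2; apply/measurable_EFinP.
  by apply: measurable_funD; exact: measurable_funX.
move=> x _ /=; rewrite lee_fin (le_trans _ (ler_norm _))//.
by rewrite ger0_norm ?sqn_ge0// (le_trans (sqn_le_n1 _)).
Qed.

Lemma L2fun_lin (a : R[i]) f g : f \in L2fun -> g \in L2fun ->
  (fun x => a * f x + g x) \in L2fun.
Proof.
move=> hf hg; have : a *: f + g \in L2fun by rewrite rpredD ?rpredZ.
by congr (_ \in _).
Qed.

Lemma L2fun_sub f g : f \in L2fun -> g \in L2fun ->
  (fun x => f x - g x) \in L2fun.
Proof.
move=> hf hg; have : f - g \in L2fun by rewrite rpredB.
by congr (_ \in _).
Qed.

Local Open Scope quotient_scope.

Lemma pi_ae (F : preL2 mu) : val (repr (\pi_L2 F)) = val F %[ae mu].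
Proof. by apply/L2P; rewrite reprK. Qed.

Lemma ofL2_lin (a : R[i]) (x y : L2) :
  ofL2 (a *: x + y) = (fun t => a * ofL2 x t + ofL2 y t) %[ae mu].
Proof.
have -> : a *: x + y = \pi_L2 (repr (\pi_L2 (a *: repr x) : L2) + repr y) by [].
apply: filterS2 (pi_ae (repr (\pi_L2 (a *: repr x) : L2) + repr y)) (pi_ae (a *: repr x)) => t E1 E2 _.
rewrite /ofL2 E1// raddfD/= fctE E2// linearZ//=.
Qed.

Lemma toL2_of (x : L2) : toL2 (ofL2 x) = x.
Proof. by rewrite /Defs.toL2 /ofL2 valKd reprK. Qed.

Lemma toL2_ext f g : f \in L2fun -> g \in L2fun -> f = g %[ae mu] -> toL2 f = toL2 g.
Proof. by move=> hf hg fg; apply/L2P; rewrite !val_insubd hf hg. Qed.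

Lemma toL2_lin (a : R[i]) f g : f \in L2fun -> g \in L2fun ->
  toL2 (fun x => a * f x + g x) = a *: toL2 f + toL2 g.
Proof.
move=> hf hg; rewrite -[RHS]toL2_of; apply: toL2_ext; first exact: L2fun_lin.
  exact: ofL2_in.
apply: ae_eq_sym; apply: ae_eq_trans (ofL2_lin _ _ _) _.
by apply: filterS2 (toL2K hf) (toL2K hg) => t E1 E2 _; rewrite E1 ?E2.
Qed.

Lemma toL2_sub f g : f \in L2fun -> g \in L2fun ->
  toL2 (fun x => f x - g x) = toL2 f - toL2 g.
Proof.
move=> hf hg; rewrite [RHS]addrC -scaleN1r -toL2_lin//; congr toL2.
by apply/funext => x; rewrite mulN1r addrC.
Qed.

Lemma rn_toL2 f : f \in L2fun -> rn (toL2 f) ^+ 2 = \int[mu]_t sqn (f t).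
Proof.
move=> hf; have := rn_sqr (toL2 f); rewrite inner_toL2// => -[<- _].
by apply: eq_Rintegral => t _; case: (f t) => a b; rewrite /sqn/=; ring.
Qed.

Lemma rn_toL2_ereal f : f \in L2fun ->
  ((rn (toL2 f) ^+ 2)%:E = \int[mu]_t (sqn (f t))%:E)%E.
Proof.
move=> hf; rewrite rn_toL2// fineK//.
exact: (integrable_fin_num _ (L2fun_sqn hf)).
Qed.

Section complete.
Variable u : nat -> L2.
Hypothesis cu : cauchys u.

Let pow2_gt0 k : 0 < (2 : R) ^- k. Proof. by rewrite invr_gt0 exprn_gt0. Qed.

Let N k := projT1 (cid (cu (pow2_gt0 k))).
Let NP k m n : (N k <= m)%N -> (N k <= n)%N -> rn (u m - u n) < 2 ^- k.
Proof. exact: (projT2 (cid (cu (pow2_gt0 k)))). Qed.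

(** Taking the maximum makes the indices of the extracted subsequence nondecreasing. *)
Let K k := \max_(j < k.+1) N j.
Let NK k : (N k <= K k)%N.
Proof. by rewrite /K (bigD1 (Ordinal (ltnSn k)))//= leq_maxl. Qed.
Let KS k : (K k <= K k.+1)%N.
Proof. by rewrite {2}/K big_ord_recr/= leq_maxl. Qed.

Let f k : T -> R[i] := ofL2 (u (K k)).
Let fin k : f k \in L2fun. Proof. exact: ofL2_in. Qed.

Let D k t := sqn (f k.+1 t - f k t).

Let mD k : measurable_fun setT (D k).
Proof.
have [m1 m2] := L2fun_meas (L2fun_sub (fin k.+1) (fin k)).
by apply: measurable_funD; exact: measurable_funX.
Qed.

Let D0 k t : 0 <= D k t. Proof. exact: sqn_ge0. Qed.

(** Consecutive terms of the subsequence are closer than 2^-k, so the square of their distance is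
    below 4^-k and leaves room for the weight 2^k. *)
Let intD k : (\int[mu]_t (2 ^+ k * D k t)%:E <= (2 ^- k)%:E)%E.
Proof.
under eq_integral do rewrite EFinM.
rewrite ge0_integralZl_EFin//; [|by move=> x _; rewrite lee_fin|exact/measurable_EFinP].
rewrite -(rn_toL2_ereal (L2fun_sub (fin k.+1) (fin k))).
rewrite toL2_sub// /f !toL2_of -EFinM lee_fin.
have h : rn (u (K k.+1) - u (K k)) < 2 ^- k.
  by apply: NP; [apply: leq_trans (NK k) (KS k)|exact: NK].
have k0 : 0 < (2 : R) ^+ k by rewrite exprn_gt0.
have h2 : rn (u (K k.+1) - u (K k)) ^+ 2 <= (2 ^- k) ^+ 2.
  by rewrite ler_sqr ?nnegrE ?rn_ge0 ?ltW.
apply: (le_trans (ler_wpM2l (ltW k0) h2)).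
by rewrite expr2 mulrA divff ?gt_eqF// mul1r.
Qed.

Let S t := (\sum_(k <oo) (2 ^+ k * D k t)%:E)%E.

Let ae_S : {ae mu, forall t, (S t < +oo)%E}.
Proof.
have mS : measurable_fun setT S.
  apply: ge0_emeasurable_sum => //.
  - by move=> k t _ _; rewrite lee_fin mulr_ge0 ?exprn_ge0.
  - by move=> k _; apply/measurable_EFinP; exact: measurable_funM.
have S0 t : (0 <= S t)%E.
  by apply: nneseries_ge0 => k _ _; rewrite lee_fin mulr_ge0 ?exprn_ge0.
have iS : (\int[mu]_t S t < +oo)%E.
  rewrite integral_nneseries//; last 2 first.
  - by move=> k; apply/measurable_EFinP; exact: measurable_funM.
  - by move=> k t _; rewrite lee_fin mulr_ge0 ?exprn_ge0.
  have i0 k : (0 <= \int[mu]_t (2 ^+ k * D k t)%:E)%E.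
    by apply: integral_ge0 => t _; rewrite lee_fin mulr_ge0 ?exprn_ge0.
  apply: (@le_lt_trans _ _ (\sum_(k <oo) (2 ^- k)%:E)%E).
    by apply: lee_nneseries.
  apply: (@le_lt_trans _ _ 2%:E); last by rewrite ltry.
  apply: lime_le; first by apply: is_cvg_nneseries => k _ _; rewrite lee_fin ltW.
  by apply: nearW => n; rewrite sumEFin lee_fin sum2_le.
have := @integrable_ae _ _ _ mu setT measurableT S.
have -> : mu.-integrable setT S.
  by apply/integrableP; split=> //; under eq_integral do rewrite gee0_abs//.
move=> /(_ isT); apply: filterS => t /(_ I); rewrite fin_numElt => /andP[]//.
Qed.

(** Where S is finite the increments are summable, since |x| <= 2^-k + 2^k x^2 for every real x.
    Hence real and imaginary parts have bounded variation along k. *)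
Let ae_cv : {ae mu, forall t, cvgn (fun k => Re (f k t)) /\ cvgn (fun k => Im (f k t))}.
Proof.
apply: filterS ae_S => t St.
have S0 : (0 <= S t)%E.
  by apply: nneseries_ge0 => k _ _; rewrite lee_fin mulr_ge0 ?exprn_ge0.
have [s sE] : exists s, S t = s%:E by case: (S t) St S0 => // s _ _; exists s.
have Ds n : \sum_(0 <= k < n) (2 ^+ k * D k t) <= s.
  rewrite -lee_fin -sE -sumEFin; apply: nneseries_lim_ge => k _ _.
  by rewrite lee_fin mulr_ge0 ?exprn_ge0.
have H (a : nat -> R) : (forall k, (a k.+1 - a k) ^+ 2 <= D k t) -> cvgn a.
  move=> aD; apply: (@cvg_bounded_variation _ (2 + s)) => n.
  apply: (@le_trans _ _ (\sum_(0 <= k < n) (2 ^- k + 2 ^+ k * D k t))).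
    apply: ler_sum => k _; have k0 : 0 < (2 : R) ^+ k by rewrite exprn_gt0.
    rewrite -(ler_pM2l k0) mulrDr divff ?gt_eqF// mulrA.
    have : 2 ^+ k * `|a k.+1 - a k| <= 1 + (2 ^+ k * `|a k.+1 - a k|) ^+ 2.
      have := mulr_ge0 (ltW k0) (normr_ge0 (a k.+1 - a k)).
      by move: (_ * _) => z z0; nra.
    rewrite exprMn real_normK ?num_real// => h; apply: (le_trans h).
    by rewrite lerD2l -expr2 ler_wpM2l ?sqr_ge0.
  by rewrite big_split/= lerD ?sum2_le.
split; apply: H => k; rewrite /D /sqn -raddfB/= ?lerDl ?lerDr; exact: sqr_ge0.
Qed.

Lemma L2_complete_ex : exists l, cvgs u l.
Proof.
have [A [mA A0 subA]] := ae_cv.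
have cvA t : ~ A t -> cvgn (fun k => Re (f k t)) /\ cvgn (fun k => Im (f k t)).
  by move=> nA; apply: contrapT => h; exact/nA/subA.
(* Outside the measurable null set A the limit exists; the value 0 on A makes F a limit everywhere
   of measurable restrictions. *)
pose F t : R[i] := if t \in A then 0 else
  (lim ((fun k => Re (f k t)) @ \oo) +i* lim ((fun k => Im (f k t)) @ \oo))%C.
have mAc : measurable (~` A) by exact: measurableC.
have mF : cmeas F.
  split.
    apply: (@measurable_fun_cvg _ _ _ setT (fun k => (Re \o f k) \_ (~` A))).
      move=> k; apply/(measurable_restrictT _ mAc); apply: measurable_funTS.
      by have [] := L2fun_meas (fin k).
    move=> t _; rewrite /F /=; case: ifPn => tA.
      rewrite (_ : (fun k => _) = cst 0); first exact: cvg_cst.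
      by apply/funext => k; rewrite patchE in_setC tA.
    have nA : ~ A t by move=> /mem_set; exact/negP.
    rewrite (_ : (fun k => _) = fun k => Re (f k t)).
      by have [] := cvA t nA.
    by apply/funext => k; rewrite patchE in_setC tA.
  apply: (@measurable_fun_cvg _ _ _ setT (fun k => (Im \o f k) \_ (~` A))).
    move=> k; apply/(measurable_restrictT _ mAc); apply: measurable_funTS.
    by have [] := L2fun_meas (fin k).
  move=> t _; rewrite /F /=; case: ifPn => tA.
    rewrite (_ : (fun k => _) = cst 0); first exact: cvg_cst.
    by apply/funext => k; rewrite patchE in_setC tA.
  have nA : ~ A t by move=> /mem_set; exact/negP.
  rewrite (_ : (fun k => _) = fun k => Im (f k t)).
    by have [] := cvA t nA.
  by apply/funext => k; rewrite patchE in_setC tA.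
have KK m n : (m <= n)%N -> (K m <= K n)%N.
  by move=> mn; rewrite -(subnK mn); elim: (n - m)%N => // j IH; exact: leq_trans IH (KS _).
(* Fatou's lemma along the subsequence gives at the same time the square integrability of F - u_n
   and the rate of convergence. *)
have key k n : (N k <= n)%N ->
    (fun t => F t - ofL2 (u n) t) \in L2fun /\
    rn (toL2 (fun t => F t - ofL2 (u n) t)) <= 2 ^- k.
  move=> Nn; set g := ofL2 (u n).
  have gin : g \in L2fun by exact: ofL2_in.
  have [g1 g2] := L2fun_meas gin.
  have mh m : measurable_fun setT (fun t => (sqn (f (m + k)%N t - g t))%:E).
    have [m1 m2] := L2fun_meas (L2fun_sub (fin (m + k)) gin).
    by apply/measurable_EFinP; apply: measurable_funD; exact: measurable_funX.
  have := @fatou _ T R mu setT measurableT _ mh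
    (fun m t _ => sqn_ge0 (f (m + k)%N t - g t) : (0 <= (sqn _)%:E)%E).
  have mFg : cmeas (fun t => F t - g t) by apply: cmeasD => //; exact: cmeasN.
  have mS : measurable_fun setT (fun t => (sqn (F t - g t))%:E).
    by case: mFg => ? ?; apply/measurable_EFinP; apply: measurable_funD; exact: measurable_funX.
  rewrite (@ae_eq_integral _ _ _ mu setT (fun t => (sqn (F t - g t))%:E))//; last 2 first.
  - rewrite (_ : (fun t => _) = fun t => (- limn_esup (fun m => - (sqn (f (m + k)%N t - g t))%:E))%E).
      apply: measurableT_comp => //; apply: measurable_fun_limn_esup => m.
      exact: measurableT_comp.
    by apply/funext => t; rewrite -[in RHS]/(limn_esup (-%E \o _)) limn_esupN oppeK.
  - exists A; split => // t /=; apply: contra_notP => nA _.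
    have [c1 c2] := cvA _ nA.
    have tA : (t \in A) = false by apply/negbTE/negP => /set_mem.
    have := @cvg_limn_einf_sup _ (fun m => (sqn (f (m + k)%N t - g t))%:E) (sqn (F t - g t))%:E.
    move=> [|-> //]; apply: cvg_EFin; first exact: nearW.
    rewrite /comp/= /sqn /F tA.
    have s1 : (fun m => Re (f (m + k)%N t)) @ \oo --> lim ((fun k => Re (f k t)) @ \oo).
      by rewrite (cvg_shiftn k (fun k => Re (f k t))).
    have s2 : (fun m => Im (f (m + k)%N t)) @ \oo --> lim ((fun k => Im (f k t)) @ \oo).
      by rewrite (cvg_shiftn k (fun k => Im (f k t))).
    under eq_fun do rewrite !raddfB/= !expr2.
    rewrite !raddfB/= !expr2; apply: cvgD; apply: cvgM; apply: cvgB => //; exact: cvg_cst.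
  move=> H.
  have {}H : (\int[mu]_t (sqn (F t - g t))%:E <= ((2 ^- k) ^+ 2)%:E)%E.
    apply: le_trans H _; rewrite limn_einf_lim; apply: lime_le.
      exact: is_cvg_einfs.
    apply: nearW => m; apply: (@le_trans _ _ (\int[mu]_t (sqn (f (m + k)%N t - g t))%:E)%E).
      by apply: ereal_inf_lbound; exists m => /=.
    rewrite -rn_toL2_ereal ?L2fun_sub// toL2_sub// /f /g !toL2_of lee_fin.
    rewrite ler_sqr ?nnegrE ?rn_ge0 ?ltW//; apply: NP => //.
    by apply: leq_trans (NK k) (KK _ _ _); rewrite leq_addl.
  have inL : (fun t => F t - g t) \in L2fun.
    apply: L2funP => //; apply/integrableP; split => //.
    apply: le_lt_trans (ltry _); apply: le_trans H.
    by under eq_integral do rewrite gee0_abs ?lee_fin ?sqn_ge0//.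
  split => //; have : rn (toL2 (fun t => F t - g t)) ^+ 2 <= (2 ^- k) ^+ 2.
    by rewrite -lee_fin rn_toL2_ereal.
  by rewrite ler_sqr ?nnegrE ?rn_ge0// ltW.
have [F0 _] := key 0%N (N 0%N) (leqnn _).
have Fin : F \in L2fun.
  have := L2fun_lin 1 F0 (ofL2_in (u (N 0%N))); rewrite (_ : (fun x => _) = F)//.
  by apply/funext => t; rewrite mul1r subrK.
exists (toL2 F) => e e0; have [k hk] := inv_nat_small e0.
exists (N k) => n Nn; rewrite rnB -[u n]toL2_of -toL2_sub ?ofL2_in//.
have [_ h] := key k n Nn; apply: (le_lt_trans h); apply: le_lt_trans (hk k (leqnn _)).
by rewrite lef_pV2 ?posrE ?exprn_gt0// -natrX ler_nat ltn_expl.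
Qed.

End complete.

Lemma L2_complete : completes L2.
Proof. exact: L2_complete_ex. Qed.

End L2_theory.

(** * Vanishing of integrals on a generating family of sets *)

Section limits.
Context d (T : measurableType d) (R : realType).
Variable mu : {measure set T -> \bar R}.

Lemma Rintegral_cvg0 (F : nat -> T -> R) (f G : T -> R) :
  (forall n, measurable_fun setT (F n)) -> measurable_fun setT f ->
  {ae mu, forall x, F n x @[n --> \oo] --> f x} ->
  mu.-integrable setT (EFin \o G) -> (forall n x, `|F n x| <= G x) ->
  (forall n, \int[mu]_x F n x = 0) -> \int[mu]_x f x = 0.
Proof.
move=> mF mf Ff iG FG F0.
have iF n : mu.-integrable setT (EFin \o F n).
  apply: (le_integrable _ _ _ iG) => //; first exact/measurable_EFinP.
  by move=> x _ /=; rewrite lee_fin (le_trans (FG n x)) ?ler_norm.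
have mF' n : measurable_fun setT (EFin \o F n) by exact/measurable_EFinP.
have mf' : measurable_fun setT (EFin \o f) by exact/measurable_EFinP.
have Ff' : {ae mu, forall x, setT x -> (F n x)%:E @[n --> \oo] --> (f x)%:E}.
  by apply: filterS Ff => x Fx _; apply: cvg_EFin Fx; exact: nearW.
have FG' : {ae mu, forall x n, setT x -> (`|(F n x)%:E| <= (EFin \o G) x)%E}.
  by apply: nearW => x n _ /=; rewrite lee_fin.
have [_ _] := dominated_convergence measurableT mF' mf' Ff' iG FG'.
have E n : (\int[mu]_x (F n x)%:E = 0)%E.
  by rewrite -[LHS]fineK ?(integrable_fin_num _ (iF n))// -[fine _]/(\int[mu]_x F n x) F0.
under eq_fun do rewrite E.
move=> /cvg_lim; rewrite lim_cst// => h.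
by rewrite /Rintegral -h.
Qed.

Lemma Cintegral_cvg0 (F : nat -> T -> R[i]) (f : T -> R[i]) (G : T -> R) :
  (forall n, cmeas (F n)) -> cmeas f ->
  {ae mu, forall x, Re (F n x) @[n --> \oo] --> Re (f x) /\
                    Im (F n x) @[n --> \oo] --> Im (f x)} ->
  mu.-integrable setT (EFin \o G) -> (forall n x, n1 (F n x) <= G x) ->
  (forall n, Cintegral mu (F n) = 0) -> Cintegral mu f = 0.
Proof.
move=> mF [m1 m2] Ff iG FG F0; apply: complex_ext => /=.
  apply: (@Rintegral_cvg0 (fun n x => Re (F n x)) _ G) => //.
  - by move=> n; case: (mF n).
  - by apply: filterS Ff => x [].
  - by move=> n x; exact: le_trans (Re_le_n1 _) (FG n x).
  - by move=> n; have := F0 n => /(congr1 Re).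
apply: (@Rintegral_cvg0 (fun n x => Im (F n x)) _ G) => //.
- by move=> n; case: (mF n).
- by apply: filterS Ff => x [].
- by move=> n x; exact: le_trans (Im_le_n1 _) (FG n x).
- by move=> n; have := F0 n => /(congr1 Im).
Qed.

Lemma cmeas_indic d' (T' : measurableType d') (h : T -> T') (A : set T') :
  measurable_fun setT h -> measurable A -> cmeas (fun x => (\1_A (h x))%:C%C : R[i]).
Proof.
move=> mh mA; apply: cmeas_real.
by apply: (measurableT_comp (f := \1_A : T' -> R)) => //; exact: measurable_indic.
Qed.

Lemma n1_indic d' (T' : measurableType d') (A : set T') x :
  n1 ((\1_A x)%:C%C : R[i]) <= 1.
Proof. by rewrite n1_real indicE; case: (_ \in _); rewrite ?normr1 ?normr0. Qed.

Lemma indic_Cintegrable d' (T' : measurableType d') (h : T -> T') (A : set T')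
  (k : T -> R[i]) : measurable_fun setT h -> measurable A -> Cintegrable mu k ->
  Cintegrable mu (fun x => k x * (\1_A (h x))%:C%C).
Proof.
move=> mh mA ik; apply: (dominated_Cintegrable _ (Cintegrable_n1 ik)).
  by apply: cmeasM; [exact: Cintegrable_meas ik|exact: cmeas_indic].
by move=> x /=; apply: le_trans (n1M _ _) _; rewrite ler_piMr ?n1_ge0// n1_indic.
Qed.

(** The sets A on which the weighted integral vanishes form a Dynkin system: complements use that
    the total integral is zero, disjoint unions use dominated convergence. *)
Lemma dynkin_Cintegral0 d' (T' : measurableType d') (h : T -> T') (k : T -> R[i])
    (G : set (set T')) :
  measurable_fun setT h -> Cintegrable mu k -> @measurable _ T' = <<s G >> ->
  setI_closed G -> Cintegral mu k = 0 ->
  (forall A, G A -> Cintegral mu (fun x => k x * (\1_A (h x))%:C%C) = 0) ->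
  forall A, measurable A -> Cintegral mu (fun x => k x * (\1_A (h x))%:C%C) = 0.
Proof.
move=> mh ik mG GI k0 kG A mA.
pose P A := Cintegral mu (fun x => k x * (\1_A (h x))%:C%C) = 0.
apply: (@dynkin_induction _ T' G P) => //; last by rewrite -mG.
- rewrite /P -[RHS]k0; apply: eq_Cintegral => x.
  by rewrite indicT mulr1.
- move=> S mS PS; rewrite /P.
  have -> : (fun x => k x * (\1_(~` S) (h x))%:C%C) =
      (fun x => k x - k x * (\1_S (h x))%:C%C).
    apply/funext => x; rewrite !indicE in_setC.
    by case: (_ \in _); rewrite ?mulr0 ?mulr1 ?subr0 ?subrr.
  by rewrite CintegralB ?k0 ?PS ?subr0//; exact: indic_Cintegrable.
move=> F mF tF PF; rewrite /P.
have ikF n := indic_Cintegrable mh (mF n) ik.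
(* The partial sums are dominated by [n1 (k x)] because at most one indicator of a disjoint family
   is nonzero at a point. *)
apply: (@Cintegral_cvg0
  (fun n x => \sum_(i < n) k x * (\1_(F i) (h x))%:C%C) _ (fun x => n1 (k x))).
- by move=> n; apply: Cintegrable_meas; apply: Cintegrable_sum => i; exact: ikF.
- apply: cmeasM; first exact: Cintegrable_meas ik.
  by apply: cmeas_indic => //; exact: bigcup_measurable.
- apply: nearW => x.
  suff [N hN] : exists N, forall n, (N <= n)%N ->
      \sum_(i < n) k x * (\1_(F i) (h x))%:C%C = k x * (\1_(\bigcup_i F i) (h x))%:C%C.
    split; apply: cvg_near_cst; exists N => // n Nn.
      by rewrite hN.
    by rewrite hN.
  have [[i _ Fi]|nF] := pselect ((\bigcup_i F i) (h x)); last first.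
    exists 0%N => n _; rewrite indicE memNset// mulr0 big1// => i _.
    by rewrite indicE memNset ?mulr0// => Fi; apply: nF; exists i.
  exists i.+1 => n ni; rewrite (bigD1 (Ordinal ni))//= big1; last first.
    move=> j ji; rewrite indicE memNset ?mulr0// => Fj.
    move/negP: ji; apply; apply/eqP/val_inj => /=.
    by apply: (tF j i) => //; exists (h x).
  by rewrite addr0 !indicE !mem_set//; exists i.
- exact: Cintegrable_n1.
- move=> n x; rewrite -mulr_sumr; apply: le_trans (n1M _ _) _.
  rewrite ler_piMr ?n1_ge0//.
  have [[i [ni Fi]]|nF] := pselect (exists i : nat, (i < n)%N /\ F i (h x)).
    rewrite (bigD1 (Ordinal ni))//= big1 ?addr0 ?n1_indic// => j ji.
    rewrite indicE memNset// => Fj.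
    move/negP: ji; apply; apply/eqP/val_inj => /=.
    by apply: (tF j i) => //; exists (h x).
  rewrite big1 ?n1_real ?normr0// => i _; rewrite indicE memNset// => Fi.
  by apply: nF; exists i.
- move=> n; rewrite (@Cintegral_sum _ _ _ _ 'I_n _ (fun i x => k x * (\1_(F i) (h x))%:C%C)).
    by rewrite big1// => i _; exact: PF.
  by move=> i; exact: ikF.
Qed.

End limits.

(** * Injectivity of the Fourier transformation *)

Section fourier.
Variable R : realType.
Local Notation leb := (@lebesgue_measure R).
Local Notation lp := (@lebp R).

Definition gau (x : R) : R := expR (- (x ^+ 2) / 2).

Lemma gau_ge0 x : 0 <= gau x. Proof. exact: expR_ge0. Qed.

Lemma measurable_gau d (T : measurableType d) (h : T -> R) :
  measurable_fun setT h -> measurable_fun setT (fun x => gau (h x)).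
Proof.
move=> mh; apply: (measurableT_comp (f := gau)) => //.
apply: continuous_measurable_fun => x.
apply: continuous_comp; last exact: continuous_expR.
apply: continuousM; last exact: cvg_cst.
by apply: continuousN; exact: exprn_continuous.
Qed.

Section smoothing.
Variables a b : R.
Let I := [set` Interval (BRight a) (BRight b)].
Let mI : measurable I. Proof. exact: measurable_itv. Qed.

(* [smooth c] mollifies the indicator function of [I] by a Gaussian of width [c];
   [fsmooth] is its Fourier integral, up to normalization. *)
Definition smooth (c x : R) : R := \int[leb]_z (\1_I (c * z + x) * gau z).

Definition fsmooth (c x : R) : R[i] := Cintegral lp
  (fun p => (gau (c * p.1) * \1_I p.2)%:C%C * expi (p.1 * (x - p.2))).

Let igI : leb.-integrable setT (EFin \o gau).
Proof. exact: integrable_gaussian. Qed.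

Let iI : leb.-integrable setT (EFin \o (\1_I : R -> R)).
Proof. exact: integrable_indic_itv. Qed.

Let mI1 : measurable_fun setT (\1_I : R -> R).
Proof. exact: measurable_indic. Qed.

Let Cg (c : R) : 0 < c -> leb.-integrable setT (EFin \o (fun s => 2 * gau (c * s))).
Proof.
move=> c0; have := integrableZl measurableT 2 (integrable_affine 0 c0 igI).
by congr (_.-integrable _ (EFin \o _)); apply/funext => x; rewrite addr0.
Qed.

Let g0 c (s : R) : 0 <= 2 * gau (c * s). Proof. by rewrite mulr_ge0// expR_ge0. Qed.

Let i0 (s : R) : 0 <= (\1_I s : R). Proof. by rewrite indicE. Qed.

Let mgau c : measurable_fun setT (fun s : R => gau (c * s)).
Proof. by apply: measurable_gau; exact: measurable_funM. Qed.

Let mF c x : cmeas (fun p : R * R =>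
  (gau (c * p.1) * \1_I p.2)%:C%C * expi (p.1 * (x - p.2)) : R[i]).
Proof.
apply: cmeasM.
  apply: cmeas_real; apply: measurable_funM.
    exact: (measurableT_comp (mgau c) measurable_fst).
  exact: (measurableT_comp mI1 measurable_snd).
apply: cmeas_expi; apply: measurable_funM; first exact: measurable_fst.
by apply: measurable_funB; [exact: measurable_cst|exact: measurable_snd].
Qed.

Let FGH c x s y : n1 ((gau (c * s) * \1_I y)%:C%C * expi (s * (x - y)) : R[i]) <=
  2 * gau (c * s) * \1_I y.
Proof.
apply: le_trans (n1M _ _) _.
rewrite n1_real ger0_norm ?mulr_ge0 ?expR_ge0//.
rewrite mulrC -mulrA ler_wpM2r ?mulr_ge0 ?expR_ge0//.
exact: n1_expi.
Qed.

Lemma fourier_gaussian c y : 0 < c ->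
  Cintegral leb (fun s => (gau (c * s))%:C%C * expi (s * y)) =
  (Num.sqrt (2 * pi) / c * gau (y / c))%:C%C.
Proof.
move=> c0; have h := Cintegral_affine 0 c0 (Cintegrable_coh (0 +i* (y / c))%C).
have -> : (fun s => (gau (c * s))%:C%C * expi (s * y)) =
    (fun x => coh (0 +i* (y / c))%C (c * x + 0)).
  apply/funext => s; rewrite /coh /cexp addr0; congr (_ * _).
    by congr (_%:C)%C; congr expR => /=; rewrite mulr0 mul0r subrr sub0r mulNr.
  by congr expi => /=; rewrite mul0r add0r subr0; field; rewrite gt_eqF.
rewrite h Cintegral_coh mulrA -rmorphM/= [X in _ * X](_ : _ = (gau (y / c))%:C%C).
  by rewrite -rmorphM/= [c^-1 * _]mulrC.
rewrite expR_cexp; congr cexp; rewrite halfC expr2.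
by apply: complex_ext => /=; rewrite !(mul0r, mulr0, subr0, addr0, add0r, sub0r).
Qed.

(** Integrating the frequency first gives a Gaussian of width c in x - y with prefactor sqrt (2 pi)
    / c; the substitution y = c z + x cancels the c. *)
Lemma fsmoothE c x : 0 < c ->
  fsmooth c x = (Num.sqrt (2 * pi) * smooth c x)%:C%C.
Proof.
move=> c0; rewrite /fsmooth.
have := @Cfubini2 _ _ _ _ R leb leb _ _ (Cg c0) iI (g0 c) i0 _ (mF c x) (FGH c x).
rewrite -[Cintegral (_ \x _)%E _]/(Cintegral lp _) => <-.
pose f y : R[i] := (\1_I y * gau ((y - x) / c))%:C%C.
have mf : cmeas f.
  apply: cmeas_real; apply: measurable_funM => //.
  by apply: measurable_gau; apply: measurable_funM => //; exact: measurable_funB.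
have iF : Cintegrable leb f.
  apply: (@dominated_Cintegrable _ _ R leb _ \1_I) => //.
  move=> y; rewrite n1_real ger0_norm ?mulr_ge0 ?expR_ge0// ler_piMr//.
  by rewrite -expR0 ler_expR mulNr oppr_le0 divr_ge0 ?sqr_ge0.
have mg (y : R) : cmeas (fun s : R => (gau (c * s))%:C%C * expi (s * (x - y)) : R[i]).
  apply: cmeasM; first exact: cmeas_real.
  by apply: cmeas_expi; exact: measurable_funM.
under eq_Cintegral => y.
  have -> : Cintegral leb (fun s => (gau (c * s) * \1_I y)%:C%C * expi (s * (x - y))) =
      (Num.sqrt (2 * pi) / c)%:C%C * f y.
    have ig : Cintegrable leb (fun s => (gau (c * s))%:C%C * expi (s * (x - y))).
      apply: (@dominated_Cintegrable _ _ R leb _ _ (mg y) (Cg c0)) => s.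
       apply: le_trans (n1M _ _) _.
      rewrite n1_real ger0_norm ?expR_ge0// mulrC ler_wpM2r ?expR_ge0//.
      exact: n1_expi.
    under eq_Cintegral do rewrite rmorphM/= mulrAC.
    rewrite CintegralZr// fourier_gaussian// /f -!rmorphM/=; congr (_%:C)%C.
    rewrite -!mulrA; congr (_ * (_ * _)); rewrite mulrC; congr (_ * expR _).
    by field; rewrite gt_eqF.
  over.
rewrite CintegralZ// rmorphM/= rmorphM/= -!mulrA; congr (_ * _).
rewrite -(Cintegral_affine x c0 iF) /smooth -Cintegral_real.
apply: eq_Cintegral => z; rewrite /f; congr (_ * expR _)%:C%C.
by field; rewrite gt_eqF.
Qed.

Lemma smooth_bound c x : 0 < c -> `|smooth c x| <= Num.sqrt (2 * pi).
Proof.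
move=> c0; rewrite -integral_gaussian.
have i1 : leb.-integrable setT (EFin \o (fun z => \1_I (c * z + x) * gau z)).
  apply: (le_integrable _ _ _ igI) => //.
    apply/measurable_EFinP; apply: measurable_funM.
      by apply: measurableT_comp => //; apply: measurable_funD => //; exact: measurable_funM.
    exact: measurable_gau.
  move=> z _ /=; rewrite lee_fin normrM ler_piMl ?normr_ge0//.
  by rewrite indicE; case: (_ \in _); rewrite ?normr1 ?normr0.
apply: le_trans (le_normr_Rintegral _ i1) _ => //.
apply: le_Rintegral => //; first exact: integrable_norm.
move=> z _; rewrite normrM [`|expR _|]ger0_norm ?expR_ge0// ler_piMl ?expR_ge0//.
by rewrite indicE; case: (_ \in _); rewrite ?normr1 ?normr0.
Qed.

(** Away from the two endpoints the indicator is locally constant, so the integrand is eventually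
    constant at each z, and the Gaussian dominates. *)
Lemma smooth_cvg x : x != a -> x != b ->
  smooth n.+1%:R^-1 x @[n --> \oo] --> Num.sqrt (2 * pi) * \1_I x.
Proof.
move=> xa xb; rewrite /smooth.
have mh n : measurable_fun setT (fun z : R => \1_I (n.+1%:R^-1 * z + x) * gau z : R).
  apply: measurable_funM.
    by apply: measurableT_comp => //; apply: measurable_funD => //; exact: measurable_funM.
  exact: measurable_gau.
have -> : Num.sqrt (2 * pi) * \1_I x = fine (\int[leb]_z (\1_I x * gau z)%:E)%E.
  rewrite -[RHS]/(\int[leb]_z (\1_I x * gau z)) RintegralZl// integral_gaussian.
  by rewrite mulrC.
apply: fine_cvg.
rewrite fineK; last first.
  apply: integrable_fin_num => //; exact: (integrableZl measurableT (\1_I x) igI).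
have := @dominated_cvg _ _ R leb setT measurableT
  (fun n z => (\1_I (n.+1%:R^-1 * z + x) * gau z)%:E)
  (fun z => (\1_I x * gau z)%:E) (EFin \o gau).
apply => //.
- by move=> n; apply/measurable_EFinP; exact: (mh n).
- move=> z _; apply: cvg_EFin; first exact: nearW.
  suff [d d0 hd] : exists2 d : R, 0 < d & forall t, `|t| < d -> \1_I (t + x) = \1_I x :> R.
    apply: cvg_near_cst.
    have z1 : 0 < `|z| + 1 by rewrite ltr_wpDl.
    have [N hN] := inv_nat_small (divr_gt0 d0 z1).
    exists N => // n /= Nn; rewrite hd//.
    rewrite normrM ger0_norm ?invr_ge0// (@le_lt_trans _ _ (n.+1%:R^-1 * (`|z| + 1)))//.
      by rewrite ler_wpM2l ?invr_ge0// lerDl.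
    by rewrite -ltr_pdivlMr// hN.
  exists (Num.min `|x - a| `|x - b|).
    by rewrite lt_min !normr_gt0 !subr_eq0 xa xb.
  move=> t; rewrite lt_min !indicE => /andP[ta tb]; congr ((_ _)%:R).
  apply/idP/idP; rewrite !inE /I/= !in_itv/= => /andP[h1 h2]; apply/andP; split;
    move: ta tb; rewrite !lter_norml;
    case: (ltrgtP x a) xa => // xa _; case: (ltrgtP x b) xb => // xb _;
    rewrite ?(@ltr0_norm _ (x - a)) ?(@gtr0_norm _ (x - a)) ?(@ltr0_norm _ (x - b))
      ?(@gtr0_norm _ (x - b)) ?subr_lt0 ?subr_gt0//; lra.
- move=> n z _ /=; rewrite lee_fin normrM (@ger0_norm _ (gau z)) ?expR_ge0//.
  rewrite ler_piMl ?expR_ge0//.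
  by rewrite indicE; case: (_ \in _); rewrite ?normr1 ?normr0.
Qed.

End smoothing.
End fourier.

Section fourier_uniqueness.
Context d (T : measurableType d) (R : realType).
Variable mu : {sigma_finite_measure set T -> \bar R}.
Local Notation leb := (@lebesgue_measure R).
Local Notation lp := (@lebp R).
Variables (h : T -> R) (k : T -> R[i]).
Hypotheses (mh : measurable_fun setT h) (ik : Cintegrable mu k).
Hypothesis h0 : forall a, mu (h @^-1` [set a]) = 0%E.
Hypothesis k0 : forall s, Cintegral mu (fun x => k x * expi (s * h x)) = 0.

(** [fsmooth] is a superposition of characters, each of which annihilates k by hypothesis; Fubini
    exchanges the superposition with the integral over T. *)
Let smoothed a b c : 0 < c ->
  cmeas (fun x => k x * fsmooth a b c (h x)) /\
  Cintegral mu (fun x => k x * fsmooth a b c (h x)) = 0.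
Proof.
move=> c0; pose I := [set` Interval (BRight a) (BRight b)].
pose m (p : R * R) : R := gau (c * p.1) * \1_I p.2.
have m_ge0 p : 0 <= m p by rewrite mulr_ge0 ?gau_ge0// indicE.
have im : lp.-integrable setT (EFin \o m).
  apply: (@integrable_prod _ _ _ _ R leb leb (fun s => gau (c * s)) (\1_I)).
  - have := integrable_affine 0 c0 (@integrable_gaussian R).
    by congr (_.-integrable _ (EFin \o _)); apply/funext => x; rewrite addr0.
  - exact: integrable_indic_itv.
  - by move=> x; exact: gau_ge0.
  - by move=> x; rewrite indicE.
have mm : measurable_fun setT m.
  apply: measurable_funM.
    by apply: measurable_gau; apply: measurable_funM => //; exact: measurable_fst.
  have mI : measurable_fun setT (\1_I : R -> R).
    by apply: measurable_indic; exact: measurable_itv.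
  exact: (measurableT_comp mI measurable_snd).
pose F (u : T * (R * R)) : R[i] :=
  k u.1 * ((m u.2)%:C%C * expi (u.2.1 * (h u.1 - u.2.2))).
have m22 : measurable_fun setT (fun u : T * (R * R) => u.2) by exact: measurable_snd.
have mu1 : measurable_fun setT (fun u : T * (R * R) => u.1) by exact: measurable_fst.
have mF : cmeas F.
  apply: cmeasM.
    exact: (cmeas_comp mu1 (Cintegrable_meas ik)).
  apply: cmeasM; first by apply: cmeas_real; exact: (measurableT_comp mm m22).
  apply: cmeas_expi; apply: measurable_funM.
    exact: (measurableT_comp measurable_fst m22).
  apply: measurable_funB; first exact: (measurableT_comp mh mu1).
  exact: (measurableT_comp measurable_snd m22).
have nE (x : R) (p : R * R) : n1 ((m p)%:C%C * expi (p.1 * (x - p.2)) : R[i]) <= 2 * m p.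
  apply: le_trans (n1M _ _) _; rewrite n1_real ger0_norm// mulrC.
  by rewrite ler_wpM2r// n1_expi.
have FGH x p : n1 (F (x, p)) <= n1 (k x) * (2 * m p).
  by apply: le_trans (n1M _ _) _; rewrite ler_wpM2l ?n1_ge0// nE.
have im2 := integrableZl measurableT 2 im.
have m2_ge0 p : 0 <= 2 * m p by rewrite mulr_ge0.
have E : (fun x => Cintegral lp (fun p => F (x, p))) = (fun x => k x * fsmooth a b c (h x)).
  apply/funext => x; rewrite /F/= CintegralZ//.
  apply: (@dominated_Cintegrable _ _ R lp _ _ _ im2) => //.
  apply: cmeasM; first exact: cmeas_real.
  apply: cmeas_expi; apply: measurable_funM; first exact: measurable_fst.
  by apply: measurable_funB; [exact: measurable_cst|exact: measurable_snd].
split.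
  rewrite -E; exact: (@Cfubini_meas _ _ _ _ R mu lp _ _ (Cintegrable_n1 ik) im2
   (fun x => n1_ge0 _) m2_ge0 F mF FGH).
rewrite -E (@Cfubini _ _ _ _ R mu lp _ _ (Cintegrable_n1 ik) im2
   (fun x => n1_ge0 _) m2_ge0 F mF FGH) /F/=.
under eq_Cintegral => p.
  rewrite (_ : (fun x => _) = (fun x => (m p)%:C%C * expi (- (p.1 * p.2)) * (k x * expi (p.1 * h x)))).
    rewrite CintegralZ; last first.
      apply: (dominated_Cintegrable _ (integrableZl measurableT 2 (Cintegrable_n1 ik))).
        apply: cmeasM; first exact: Cintegrable_meas ik.
        by apply: cmeas_expi; exact: measurable_funM.
      move=> x /=; apply: le_trans (n1M _ _) _; rewrite mulrC ler_wpM2r ?n1_ge0//.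
      exact: n1_expi.
    rewrite k0 mulr0; over.
  by apply/funext => x; rewrite mulrBr expiD; ring.
by apply: complex_ext; rewrite /= /Rintegral integral0.
Qed.

(** Half-open intervals form a generating system stable under intersection. On one of them,
    [fsmooth] with c = 1 / (n + 1) tends to 2 pi times the indicator except at the endpoints, whose
    preimages under h are null. *)
Lemma fourier_line A : measurable A ->
  Cintegral mu (fun x => k x * (\1_A (h x))%:C%C) = 0.
Proof.
apply: (@dynkin_Cintegral0 _ _ _ mu _ (measurableTypeR R) h k (@ocitv R)) => //.
- exact: ocitvI.
- by rewrite -(k0 0); apply: eq_Cintegral => x; rewrite mul0r expi0 mulr1.
move=> _ [[a b] _ <-] /=; set I := [set` _].
have c0 n : 0 < n.+1%:R^-1 :> R by rewrite invr_gt0.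
have pi2 : 0 <= 2 * pi :> R by rewrite mulr_ge0// pi_ge0.
suff : Cintegral mu (fun x => k x * (2 * pi * \1_I (h x))%:C%C) = 0.
  under eq_Cintegral do rewrite rmorphM/= mulrCA.
  rewrite CintegralZ; last by apply: indic_Cintegrable => //; exact: measurable_itv.
  move/eqP; rewrite mulf_eq0 => /orP[|/eqP//].
  by move=> /eqP[] /eqP; rewrite mulf_eq0 pnatr_eq0/= gt_eqF// pi_gt0.
apply: (@Cintegral_cvg0 _ _ _ mu (fun n x => k x * fsmooth a b n.+1%:R^-1 (h x)) _
  (fun x => 2 * pi * n1 (k x))).
- by move=> n; have [] := smoothed a b (c0 n).
- apply: cmeasM; first exact: Cintegrable_meas ik.
  under eq_fun do rewrite rmorphM/=.
  by apply: cmeasZ; apply: cmeas_indic => //; exact: measurable_itv.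
- have null : mu.-negligible (h @^-1` [set a] `|` h @^-1` [set b]).
    have hm (c : R) : mu.-negligible (h @^-1` [set c]).
      apply/negligibleP; last exact: h0.
      by rewrite -[X in measurable X]setTI; exact: mh.
    by apply: negligibleU; exact: hm.
  move: null; apply: negligibleS => x /= hx.
  apply: contrapT => /not_orP[xa xb]; apply: hx.
  have [/eqP {}xa /eqP {}xb] := (xa, xb).
  have L : Num.sqrt (2 * pi) * smooth a b n.+1%:R^-1 (h x) @[n --> \oo] -->
      2 * pi * \1_I (h x).
    rewrite -{2}(sqr_sqrtr pi2) expr2 -mulrA.
    by apply: cvgM; [exact: cvg_cst|exact: smooth_cvg].
  have -> : (fun n => Re (k x * fsmooth a b n.+1%:R^-1 (h x))) =
     (fun n => Re (k x) * (Num.sqrt (2 * pi) * smooth a b n.+1%:R^-1 (h x))).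
    by apply/funext => n; rewrite fsmoothE//; case: (k x) => s t /=; rewrite mulr0 subr0.
  have -> : (fun n => Im (k x * fsmooth a b n.+1%:R^-1 (h x))) =
     (fun n => Im (k x) * (Num.sqrt (2 * pi) * smooth a b n.+1%:R^-1 (h x))).
    by apply/funext => n; rewrite fsmoothE//; case: (k x) => s t /=; rewrite mulr0 add0r.
  have -> : Re (k x * (2 * pi * \1_I (h x))%:C%C) = Re (k x) * (2 * pi * \1_I (h x)).
    by case: (k x) => s t /=; rewrite mulr0 subr0.
  have -> : Im (k x * (2 * pi * \1_I (h x))%:C%C) = Im (k x) * (2 * pi * \1_I (h x)).
    by case: (k x) => s t /=; rewrite mulr0 add0r.
  by split; apply: cvgM => //; exact: cvg_cst.
- exact: (integrableZl measurableT (2 * pi) (Cintegrable_n1 ik)).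
- move=> n x; rewrite fsmoothE//; apply: le_trans (n1M _ _) _.
  rewrite mulrC ler_wpM2r ?n1_ge0// n1_real normrM ger0_norm ?sqrtr_ge0//.
  rewrite -{2}(sqr_sqrtr pi2) expr2 ler_wpM2l ?sqrtr_ge0//.
  exact: smooth_bound.
- by move=> n; have [] := smoothed a b (c0 n).
Qed.

End fourier_uniqueness.

Section fourier_plane.
Variable R : realType.
Local Notation leb := (@lebesgue_measure R).
Local Notation lp := (@lebp R).

Lemma lebp_fst (a : R) : lp (fst @^-1` [set a]) = 0%E.
Proof.
have -> : fst @^-1` [set a] = [set a] `*` [set: R].
  by apply/seteqP; split=> -[x y] //= [].
have e : (leb \x leb)%E ([set a] `*` setT) = (leb [set a] * leb setT)%E.
  by apply: product_measure1E.
by rewrite [LHS]e [X in (X * _)%E](lebesgue_measure_set1 a) mul0e.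
Qed.

Lemma lebp_snd (a : R) : lp (snd @^-1` [set a]) = 0%E.
Proof.
have -> : snd @^-1` [set a] = [set: R] `*` [set a].
  by apply/seteqP; split=> -[x y] //= [].
have e : (leb \x leb)%E (setT `*` [set a]) = (leb setT * leb [set a])%E.
  by apply: product_measure1E.
by rewrite [LHS]e [X in (_ * X)%E](lebesgue_measure_set1 a) mule0.
Qed.

Lemma Cintegral_eq0 d (T : measurableType d) (mu : {measure set T -> \bar R})
    (k : T -> R[i]) : Cintegrable mu k ->
  (forall A, measurable A -> Cintegral mu (fun x => k x * (\1_A x)%:C%C) = 0) ->
  k = cst 0 %[ae mu].
Proof.
move=> ik kA; have [i1 i2] := ik.
have setE (f : T -> R) A : mu.-integrable setT (EFin \o f) -> measurable A ->
    \int[mu]_x (f x * \1_A x) = 0 -> (\int[mu]_(x in A) (f x)%:E = 0)%E.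
  move=> If mA; rewrite integral_mkcond epatch_indic.
  under [in X in _ -> X]eq_integral do rewrite -EFinM.
  move=> h; rewrite -[LHS]fineK ?[fine _]h//.
  apply: integrable_fin_num => //; apply: (le_integrable _ _ _ If) => //.
    apply/measurable_EFinP; apply: measurable_funM; last exact: measurable_indic.
    by apply/measurable_EFinP; exact: (measurable_int mu).
  move=> x _ /=; rewrite lee_fin normrM ler_piMr//.
  by rewrite indicE; case: (_ \in _); rewrite ?normr1 ?normr0.
have R0 := @integral_ae_eq _ _ _ mu setT measurableT (cst 0%E) _ i1 (measurable_cst _).
have I0 := @integral_ae_eq _ _ _ mu setT measurableT (cst 0%E) _ i2 (measurable_cst _).
have {}R0 : ae_eq mu setT (EFin \o (Re \o k)) (cst 0%E).
  apply: R0 => E _ mE; rewrite integral0; apply: setE => //.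
  have := congr1 Re (kA E mE) => /= <-; apply: eq_Rintegral => x _.
  by case: (k x) => s t /=; rewrite mulr0 subr0.
have {}I0 : ae_eq mu setT (EFin \o (Im \o k)) (cst 0%E).
  apply: I0 => E _ mE; rewrite integral0; apply: setE => //.
  have := congr1 Im (kA E mE) => /= <-; apply: eq_Rintegral => x _.
  by case: (k x) => s t /=; rewrite mulr0 add0r.
apply: filterS2 R0 I0 => x /(_ I)[r0] /(_ I)[i0] _.
exact: complex_ext.
Qed.

(** One variable at a time. First k times a character of the second coordinate is tested on sets in
    the first coordinate; then k cut off by such a set is tested in the second. This covers all
    rectangles, hence all measurable sets. *)
Lemma fourier_unique (k : R * R -> R[i]) : Cintegrable lp k ->
  (forall s t, Cintegral lp (fun u => k u * expi (s * u.1 + t * u.2)) = 0) ->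
  k = cst 0 %[ae lp].
Proof.
move=> ik k0; apply: Cintegral_eq0 => //.
have mf := @measurable_fst _ _ (measurableTypeR R) (measurableTypeR R).
have ms := @measurable_snd _ _ (measurableTypeR R) (measurableTypeR R).
have st A : measurable A -> forall t,
    Cintegral lp (fun u => k u * (\1_A u.1)%:C%C * expi (t * u.2)) = 0.
  move=> mA t; have it : Cintegrable lp (fun u => k u * expi (t * u.2)).
    apply: (dominated_Cintegrable _ (integrableZl measurableT 2 (Cintegrable_n1 ik))).
      apply: cmeasM; first exact: Cintegrable_meas ik.
      by apply: cmeas_expi; exact: measurable_funM.
    move=> x /=; apply: le_trans (n1M _ _) _; rewrite mulrC ler_wpM2r ?n1_ge0//.
    exact: n1_expi.
  have := @fourier_line _ _ R lp fst _ mf it lebp_fst _ A mA.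
  under [in X in _ -> X]eq_Cintegral do rewrite mulrAC.
  apply => s; rewrite -[RHS](k0 s t); apply: eq_Cintegral => u.
  by rewrite expiD; ring.
apply: (@dynkin_Cintegral0 _ _ _ lp _ _ idfun k
  [set A `*` B | A in measurable & B in measurable]) => //.
- exact: measurable_id.
- exact: measurable_prod_measurableType.
- move=> _ _ [A1 mA1 [B1 mB1 <-]] [A2 mA2 [B2 mB2 <-]].
  exists (A1 `&` A2); first exact: measurableI.
  by exists (B1 `&` B2); [exact: measurableI|rewrite setXI].
- by rewrite -(k0 0 0); apply: eq_Cintegral => x; rewrite !mul0r addr0 expi0 mulr1.
move=> _ [A mA [B mB <-]].
have iA : Cintegrable lp (fun u => k u * (\1_A u.1)%:C%C) by exact: indic_Cintegrable.
have := @fourier_line _ _ R lp snd _ ms iA lebp_snd (st A mA) B mB.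
move=> <-; apply: eq_Cintegral => -[x y] /=; rewrite -mulrA -rmorphM/=.
by rewrite !indicE in_setX/= -natrM mulnb.
Qed.

End fourier_plane.

Lemma subr_split (V : zmodType) (a b c : V) : a - b = (c - b) - (c - a).
Proof. by rewrite opprB [RHS]addrC addrA subrK. Qed.

Lemma lin0 (R : realType) (U V : lmodType R[i]) (A : U -> V) :
  (forall (a : R[i]) x y, A (a *: x + y) = a *: A x + A y) -> A 0 = 0.
Proof. by move=> Al; have := Al (-1) 0 0; rewrite scaler0 addr0 scaleN1r addNr. Qed.

Lemma linZ (R : realType) (U V : lmodType R[i]) (A : U -> V) (a : R[i]) x :
  (forall (a : R[i]) x y, A (a *: x + y) = a *: A x + A y) -> A (a *: x) = a *: A x.
Proof. by move=> Al; have := Al a x 0; rewrite (lin0 Al) !addr0. Qed.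

Lemma linB (R : realType) (U V : lmodType R[i]) (A : U -> V) x y :
  (forall (a : R[i]) x y, A (a *: x + y) = a *: A x + A y) ->
  A (x - y) = A x - A y.
Proof. by move=> Al; rewrite addrC -scaleN1r Al scaleN1r addrC. Qed.

Section inner_product.
Variables (R : realType) (V : preHilbertType R).
Implicit Types x y : V.

Lemma inner_continuous x y (e : R) : 0 < e -> exists2 d : R, 0 < d &
  forall x' y', rn (x' - x) <= d -> rn (y' - y) <= d ->
    n1 (inner x' y' - inner x y) <= e.
Proof.
move=> e0; pose K := 2 * (rn x + rn y + 1).
have x0 := rn_ge0 x; have y0 := rn_ge0 y.
have K0 : 0 < K by rewrite mulr_gt0// ltr_wpDl// addr_ge0.
exists (Num.min 1 (e / K)); first by rewrite lt_min ltr01 divr_gt0.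
move=> x' y'; rewrite !le_min => /andP[_ hx] /andP[hy1 hy].
have -> : inner x' y' - inner x y = inner (x' - x) y' + inner x (y' - y).
  by rewrite innerBl innerBr; ring.
apply: le_trans (n1D _ _) _.
have h1 := n1_inner_le (x' - x) y'; have h2 := n1_inner_le x (y' - y).
have hy' : rn y' <= rn y + 1.
  by have := rnD (y' - y) y; rewrite subrK => h; lra.
have dK : e = 2 * (rn x + rn y + 1) * (e / K) by rewrite mulrCA divff ?mulr1// gt_eqF.
have := rn_ge0 (x' - x); have := rn_ge0 (y' - y); have := rn_ge0 y'.
move: h1 h2 hx hy hy' x0 y0 dK; set p := rn (x' - x); set q := rn (y' - y).
set r := rn y'; set c := e / K => h1 h2 hx hy hy' x0 y0 dK r0 q0 p0.
have : p * r <= c * (rn y + 1) by apply: ler_pM.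
have : rn x * q <= rn x * c by rewrite ler_wpM2l.
by nra.
Qed.

(** As e tends to 0 the hypothesis becomes a^2 <= b a. If b < a, it already fails for the e with e
    (a + b) = a (a - b) / 2. *)
Lemma bounded_by_small (a b : R) : 0 <= a -> 0 <= b ->
  (forall e : R, 0 < e -> a ^+ 2 <= b * (a + e) + e * a) -> a <= b.
Proof.
move=> a0 b0 h; case: (ltrP b a) => // ba.
have s0 : 0 < a + b by rewrite ltr_pwDl// (le_lt_trans b0).
have ap : 0 < a by rewrite (le_lt_trans b0).
have e0 : 0 < a * (a - b) / (2 * (a + b)) by rewrite divr_gt0 ?mulr_gt0// subr_gt0.
have := h _ e0; set e := _ / _ => he.
have : e * (2 * (a + b)) = a * (a - b) by rewrite mulfVK// gt_eqF// mulr_gt0.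
have : 0 < a * (a - b) by rewrite mulr_gt0// subr_gt0.
by nra.
Qed.

End inner_product.

(** * Isometries and their extensions *)

Section isometries.
Variables (R : realType) (U V : preHilbertType R).

(** The squared norm of the defect of linearity expands into inner products of values of J.
    Replacing each by the inner product of the arguments gives the squared norm of 0. *)
Lemma iso_lin (P : set U) (J : U -> V) (a : R[i]) x y :
  (forall x y, P x -> P y -> inner (J x) (J y) = inner x y) ->
  P x -> P y -> P (a *: x + y) -> J (a *: x + y) = a *: J x + J y.
Proof.
(* The combination gets a name so that bilinear expansion leaves it intact until [iso] has been
   used. *)
move=> iso Px Py; have [w Ew] : exists w, w = a *: x + y by exists (a *: x + y).
rewrite -{1 2}Ew => Pw; apply/subr0_eq/rn_eq0.
have : inner (w - (a *: x + y)) (w - (a *: x + y)) = 0.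
  by rewrite -Ew subrr inner0r.
have := rn_sqr (J w - (a *: J x + J y)).
rewrite !(innerBl, innerBr, innerDl, innerDr, innerZl, innerZr) !iso// => -> /eqP.
by case/eqP => /eqP; rewrite sqrf_eq0 => /eqP.
Qed.

Lemma iso_rn (P : set U) (J : U -> V) x :
  (forall x y, P x -> P y -> inner (J x) (J y) = inner x y) -> P x ->
  rn (J x) = rn x.
Proof.
move=> iso Px; apply/eqP; rewrite -(@eqrXn2 _ 2) ?rn_ge0//; apply/eqP.
by have := iso x x Px Px; rewrite !rn_sqr => -[].
Qed.

Section extension.
Variables (X : Type) (D : set X) (i : X -> U) (A : X -> V).
Hypothesis cV : completes V.
Hypothesis iso : forall g g', D g -> D g' -> inner (A g) (A g') = inner (i g) (i g').

Lemma iso_diff g g' : D g -> D g' -> rn (A g - A g') = rn (i g - i g').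
Proof.
move=> Dg Dg'; apply/eqP; rewrite -(@eqrXn2 _ 2) ?rn_ge0//; apply/eqP.
have : inner (A g - A g') (A g - A g') = inner (i g - i g') (i g - i g').
  by rewrite !(innerBl, innerBr) !iso.
by rewrite !rn_sqr => -[].
Qed.

Lemma ext_isoP x : closure (i @` D) x ->
  forall g, D g -> rn (A g - ext_cont D i A x) <= rn (i g - x).
Proof.
move=> cx g Dg; rewrite -[leRHS]mul1r; apply: (@ext_contP R U V X D i A 1) => //.
by move=> h h' Dh Dh'; rewrite mul1r iso_diff.
Qed.

Lemma ext_isoE g : D g -> ext_cont D i A (i g) = A g.
Proof.
move=> Dg; apply/esym/subr0_eq/rn_eq0/eqP; rewrite eq_le rn_ge0 andbT.
have := @ext_isoP (i g) _ g Dg; rewrite subrr rn0; apply.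
by apply: subset_closure; exists g.
Qed.

Lemma ext_iso x y : closure (i @` D) x -> closure (i @` D) y ->
  inner (ext_cont D i A x) (ext_cont D i A y) = inner x y.
Proof.
move=> cx cy; apply/subr0_eq/n1_eq0.
apply/ler_addgt0Pl => e e0; rewrite addr0.
have e2 : 0 < e / 2 by rewrite divr_gt0.
have [d1 d10 h1] := inner_continuous x y e2.
have [d2 d20 h2] := inner_continuous (ext_cont D i A x) (ext_cont D i A y) e2.
pose d := Num.min d1 d2.
have d0 : 0 < d by rewrite lt_min d10.
have [_ [g Dg <-] gx] := (closureP _ _).1 cx d d0.
have [_ [g' Dg' <-] gy] := (closureP _ _).1 cy d d0.
have dd1 : d <= d1 by rewrite ge_min lexx.
have dd2 : d <= d2 by rewrite ge_min lexx orbT.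
have {}h1 := h1 (i g) (i g') (le_trans (ltW gx) dd1) (le_trans (ltW gy) dd1).
have {}h2 := h2 (A g) (A g')
  (le_trans (ext_isoP cx Dg) (le_trans (ltW gx) dd2))
  (le_trans (ext_isoP cy Dg') (le_trans (ltW gy) dd2)).
rewrite (_ : _ - _ = (inner (i g) (i g') - inner x y) -
  (inner (A g) (A g') - inner (ext_cont D i A x) (ext_cont D i A y))); last first.
  by rewrite iso//; ring.
apply: le_trans (n1D _ _) _; rewrite n1N.
by rewrite (splitr e) lerD.
Qed.

End extension.
End isometries.

(** * Total families of vectors *)

Section total.
Variables (R : realType) (I : Type).

Definition lincomb (V : lmodType R[i]) (e : I -> V) (l : seq (R[i] * I)) : V :=
  \sum_(p <- l) p.1 *: e p.2.

Definition total_family (V : preHilbertType R) (e : I -> V) :=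
  forall h, (forall i, inner (e i) h = 0) -> h = 0.

Variable V : preHilbertType R.
Implicit Types e : I -> V.

Lemma inner_lincombl e l x :
  inner (lincomb e l) x = \sum_(p <- l) (p.1^*)%C * inner (e p.2) x.
Proof.
rewrite /lincomb; elim: l => [|p l IH]; first by rewrite !big_nil inner0l.
by rewrite !big_cons innerDl innerZl IH.
Qed.

Lemma inner_lincombr e l x :
  inner x (lincomb e l) = \sum_(p <- l) p.1 * inner x (e p.2).
Proof.
rewrite /lincomb; elim: l => [|p l IH]; first by rewrite !big_nil inner0r.
by rewrite !big_cons innerDr innerZr IH.
Qed.

Lemma total_dense e : completes V -> total_family e ->
  forall x (d : R), 0 < d -> exists l, rn (lincomb e l - x) < d.
Proof.
move=> cV te x d d0.
have [|||_ [l _ <-] h] := @dense_subspace R V (range (lincomb e)) cV _ _ _ x d d0.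
- by exists [::] => //; rewrite /lincomb big_nil.
- move=> a _ _ [l _ <-] [l' _ <-].
  exists ([seq (a * p.1, p.2) | p <- l] ++ l') => //.
  rewrite /lincomb big_cat big_map/= scaler_sumr; congr (_ + _).
  by apply: eq_bigr => p _; rewrite scalerA.
- move=> h hM; apply: te => i; rewrite -[RHS](hM (e i))//.
  by exists [:: (1, i)] => //; rewrite /lincomb big_seq1 scale1r.
by exists l.
Qed.

(** Duality on a dense set: for a combination l close to y, |y|^2 is close to (l | y), which is at
    most K |l|, close to K |y|. The errors are removed by [bounded_by_small]. *)
Lemma total_bound e y (K : R) : completes V -> total_family e -> 0 <= K ->
  (forall l, n1 (inner (lincomb e l) y) <= K * rn (lincomb e l)) -> rn y <= K.
Proof.
move=> cV te K0 h; apply: bounded_by_small => //; first exact: rn_ge0.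
move=> d d0; have [l hl] := total_dense cV te y d0.
have := h l; have := Re_le_n1 (inner (lincomb e l) y).
have := congr1 Re (rn_sqr y) => /= hy.
have -> : rn y ^+ 2 = Re (inner (lincomb e l) y) + Re (inner (y - lincomb e l) y).
  by rewrite -hy -raddfD/= -innerDl addrC subrK.
have := Re_inner_le (y - lincomb e l) y; rewrite rnB.
have := rnD (lincomb e l - y) y; rewrite subrK.
have := ler_norm (Re (inner (lincomb e l) y)).
have y0 := rn_ge0 y; have l0 := rn_ge0 (lincomb e l).
move: hl y0 l0; set p := rn (_ - _); set q := rn (lincomb e l); set r := rn y.
set s := Re _; set t := Re _; set u := n1 _ => hl y0 l0 h1 h2 h3 h4 h5.
have p0 : 0 <= p := rn_ge0 _.
have : p * r <= d * r by rewrite ler_wpM2r// ltW.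
have : K * q <= K * (r + d) by rewrite ler_wpM2l//; lra.
by lra.
Qed.

End total.

Section total_operators.
Variables (R : realType) (I : Type) (U V : preHilbertType R) (e : I -> U).
Hypotheses (cU : completes U) (te : total_family e).

Lemma total_op_eq (A B : U -> V) (C : R) :
  (forall (a : R[i]) x y, A (a *: x + y) = a *: A x + A y) ->
  (forall (a : R[i]) x y, B (a *: x + y) = a *: B x + B y) ->
  (forall x, rn (A x) <= C * rn x) -> (forall x, rn (B x) <= C * rn x) ->
  (forall i, A (e i) = B (e i)) -> A =1 B.
Proof.
move=> Al Bl AC BC AB x.
have L (J : U -> V) : (forall (a : R[i]) x y, J (a *: x + y) = a *: J x + J y) ->
    (forall x y, J (x - y) = J x - J y) /\
    (forall l, J (lincomb e l) = lincomb (J \o e) l).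
  move=> Jl; split.
    by move=> u v; exact: linB.
  rewrite /lincomb; elim=> [|p l IH]; first by rewrite !big_nil (lin0 Jl).
  by rewrite !big_cons Jl IH.
have [AD Alc] := L A Al; have [BD Blc] := L B Bl.
apply/subr0_eq/rn_eq0/eqP; rewrite eq_le rn_ge0 andbT.
apply/ler_addgt0Pl => d d0; rewrite addr0.
have C1 : 0 < 2 * (`|C| + 1) by rewrite mulr_gt0// ltr_wpDl.
have [l hl] := total_dense cU te x (divr_gt0 d0 C1).
have ABl : A (lincomb e l) = B (lincomb e l).
  by rewrite Alc Blc; congr lincomb; apply/funext => i; exact: AB.
have -> : A x - B x = B (lincomb e l - x) - A (lincomb e l - x).
  by rewrite AD BD ABl; exact: subr_split.
apply: le_trans (rnD _ _) _; rewrite rnN.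
have := AC (lincomb e l - x); have := BC (lincomb e l - x).
have := rn_ge0 (lincomb e l - x).
move: hl; rewrite ltr_pdivlMr//; set p := rn (_ - _) => hl p0 h1 h2.
have : C * p <= `|C| * p by rewrite ler_wpM2r// ler_norm.
by lra.
Qed.

(** Equal Gram matrices make combinations with the same coefficients have the same inner products.
    Extending from lists of coefficients rather than from vectors spares a separate argument that
    dependent combinations have consistent images. *)
Lemma iso_total_ex (e' : I -> V) : completes V ->
  (forall i j, inner (e' i) (e' j) = inner (e i) (e j)) ->
  exists J : U -> V, (forall x y, inner (J x) (J y) = inner x y) /\
    forall i, J (e i) = e' i.
Proof.
move=> cV G.
have iso l l' : setT l -> setT l' ->
    inner (lincomb e' l) (lincomb e' l') = inner (lincomb e l) (lincomb e l').
  move=> _ _; rewrite !inner_lincombl; apply: eq_bigr => p _.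
  by rewrite !inner_lincombr; congr (_ * _); apply: eq_bigr => q _; rewrite G.
have cl x : closure (lincomb e @` setT) x.
  apply/closureP => d d0; have [l hl] := total_dense cU te x d0.
  by exists (lincomb e l) => //; exists l.
exists (ext_cont setT (lincomb e) (lincomb e')); split.
  by move=> x y; apply: ext_iso.
move=> i; have := @ext_isoE _ _ _ _ _ _ _ cV iso [:: (1, i)] Logic.I.
by rewrite /lincomb !big_seq1 !scale1r.
Qed.

End total_operators.

Section continuity.
Variables (R : realType) (U V : preHilbertType R).

Lemma continuous_rn (A : U -> V) x (e : R) : continuous A -> 0 < e ->
  exists2 d : R, 0 < d & forall y, rn (y - x) < d -> rn (A y - A x) < e.
Proof.
move=> cA e0.
have e0C : 0 < e%:C%C :> R[i] by rewrite ltr0C.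
have /cvgrPdist_lt/(_ _ e0C) := cA x.
move=> /nbhs_ballP[d /= d0 hd].
have [r rd] : exists r : R, d = r%:C%C.
  have /complex_realP : d \is Num.real by rewrite gtr0_real.
  by [].
exists r; first by rewrite rd ltr0C in d0.
move=> y yx; have := hd y; rewrite -ball_normE/= !rnE rnB rd.
by rewrite !ltcR => h; apply: h; rewrite rnB.
Qed.

Lemma bounded_continuous (A : U -> V) (C : R) :
  (forall (a : R[i]) x y, A (a *: x + y) = a *: A x + A y) ->
  (forall x, rn (A x) <= C * rn x) -> continuous A.
Proof.
move=> Al AC x; apply/cvgrPdist_lt => e e0.
have [r re] : exists r : R, e = r%:C%C.
  have /complex_realP : e \is Num.real by rewrite gtr0_real.
  by [].
have r0 : 0 < r by rewrite re ltr0C in e0.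
have C1 : 0 < `|C| + 1 by rewrite ltr_wpDl.
apply/nbhs_ballP; exists (r / (`|C| + 1))%:C%C => /=.
  by rewrite ltr0C divr_gt0.
move=> y; rewrite -ball_normE/= !rnE re !ltcR ltr_pdivlMr// => h.
rewrite (_ : rn (A x - A y) = rn (A (x - y))); last by rewrite linB.
apply: le_lt_trans (AC _) _.
have := rn_ge0 (x - y); move: h; set p := rn _ => h p0.
have : C * p <= `|C| * p by rewrite ler_wpM2r// ler_norm.
by lra.
Qed.

Lemma continuous_dense_eq (A B : U -> V) (M : set U) :
  continuous A -> continuous B ->
  (forall x (d : R), 0 < d -> exists2 m, M m & rn (m - x) < d) ->
  (forall m, M m -> A m = B m) -> A = B.
Proof.
move=> cA cB dM AB; apply/funext => x.
apply/subr0_eq/rn_eq0/eqP; rewrite eq_le rn_ge0 andbT.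
apply/ler_addgt0Pl => e e0; rewrite addr0.
have e2 : 0 < e / 2 by rewrite divr_gt0.
have [d1 d10 h1] := continuous_rn x cA e2.
have [d2 d20 h2] := continuous_rn x cB e2.
have [|m Mm] := dM x (Num.min d1 d2); first by rewrite lt_min d10.
rewrite lt_min => /andP[/h1 {}h1 /h2 {}h2].
rewrite (_ : A x - B x = (B m - B x) - (A m - A x)); last first.
  by rewrite (AB m Mm); exact: subr_split.
apply: le_trans (rnD _ _) _; rewrite rnN; lra.
Qed.

End continuity.

(** * Coherent states and waves *)

Section gaussian_schwartz.
Variables (R : realType) (ra rb ia ib : R).

(** The real part of exp(i t) times a Gaussian with complex linear exponent. The shift t keeps the
    family stable: a derivative of the cosine is a shift by pi / 2, and the imaginary part is the
    shift by - pi / 2. *)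
Definition gwave (t : R) (u : R * R) : R :=
  expR (ra * u.1 + rb * u.2 - (u.1 ^+ 2 + u.2 ^+ 2) / 2) * cos (ia * u.1 + ib * u.2 + t).

Inductive gspan : (R * R -> R) -> Prop :=
| gspan_base t : gspan (gwave t)
| gspan_coord b h : gspan h -> gspan (fun u => coord b u * h u)
| gspan_add g h : gspan g -> gspan h -> gspan (fun u => g u + h u)
| gspan_scale c h : gspan h -> gspan (fun u => c * h u).

Lemma differentiable_gwave t u : differentiable (gwave t) u.
Proof.
have d1 := @differentiable_coord R false u; have d2 := @differentiable_coord R true u.
have dl (a b c : R) : differentiable (fun u : R * R => a * u.1 + b * u.2 + c) u.
  by apply: differentiableD => //; apply: differentiableD; apply: differentiableM.
apply: differentiableM.
  apply: (@differentiable_comp _ _ _ _ (fun u : R * R =>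
    ra * u.1 + rb * u.2 - (u.1 ^+ 2 + u.2 ^+ 2) / 2) expR).
    apply: differentiableB.
      by apply: differentiableD; apply: differentiableM.
    apply: differentiableM => //; apply: differentiableD.
      exact: (@differentiable_coordX R false 2).
    exact: (@differentiable_coordX R true 2).
  by apply/derivable1_diffP.
apply: (@differentiable_comp _ _ _ _ (fun u : R * R => ia * u.1 + ib * u.2 + t) cos).
  exact: dl.
by apply/derivable1_diffP.
Qed.

Lemma derive_gwave t c u : 'D_(dir R c) (gwave t) u =
  (if c then rb else ra) * gwave t u - coord c u * gwave t u +
  (if c then ib else ia) * gwave (t + pi / 2) u.
Proof.
have [h1 h2] := is_derive_slice (@differentiable_gwave t (u.1, u.2)).
rewrite (_ : u = (u.1, u.2)) /=; last by case: u {h1 h2}.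
move: h1 h2; case: u => q p /= h1 h2.
rewrite /gwave/= addrA cosDpihalf.
move: h1 h2; rewrite /gwave/= => h1 h2.
move/@derive_val: h1 => h1; move/@derive_val: h2 => h2.
by case: c; [rewrite -[LHS]h2|rewrite -[LHS]h1];
  rewrite derive_val /GRing.scale/=; field.
Qed.

Lemma gspan_diff h : gspan h -> forall u, differentiable h u.
Proof.
elim=> {h}[t|b h _ dh|g h _ dg _ dh|c h _ dh] u.
- exact: differentiable_gwave.
- by apply: differentiableM => //; exact: differentiable_coord.
- exact: differentiableD.
- exact: differentiableM.
Qed.

Lemma gspan_derive h c : gspan h -> gspan ('D_(dir R c) h).
Proof.
elim=> {h}[t|b h sh dh|g h sg dg sh dh|k h sh dh].
- rewrite (_ : 'D_(dir R c) _ = fun u =>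
    (if c then rb else ra) * gwave t u + (-1 * (coord c u * gwave t u) +
    (if c then ib else ia) * gwave (t + pi / 2) u)).
    apply: gspan_add; first by apply: gspan_scale; exact: gspan_base.
    apply: gspan_add; last by apply: gspan_scale; exact: gspan_base.
    by apply: gspan_scale; apply: gspan_coord; exact: gspan_base.
  by apply/funext => u; rewrite derive_gwave mulN1r addrA.
- rewrite (_ : 'D_(dir R c) _ = fun u => coord b u * 'D_(dir R c) h u + (b == c)%:R * h u).
    by apply: gspan_add; [exact: gspan_coord|exact: gspan_scale].
  apply/funext => u; rewrite (@deriveM R (R * R)%type (coord b) h).
  + by rewrite derive_coord /GRing.scale/=; ring.
  + by apply: diff_derivable; exact: differentiable_coord.
  + by apply: diff_derivable; exact: gspan_diff.
- rewrite (_ : 'D_(dir R c) _ = fun u => 'D_(dir R c) g u + 'D_(dir R c) h u).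
    exact: gspan_add.
  by apply/funext => u; rewrite deriveD//; apply: diff_derivable; exact: gspan_diff.
- rewrite (_ : 'D_(dir R c) _ = fun u => k * 'D_(dir R c) h u).
    exact: gspan_scale.
  by apply/funext => u; rewrite deriveZ//; apply: diff_derivable; exact: gspan_diff.
Qed.

Let bnd (A : R) (u : R * R) : R :=
  expR (A * (`|u.1| + `|u.2|) - (u.1 ^+ 2 + u.2 ^+ 2) / 2).

Let bnd_le (A B : R) u : A <= B -> bnd A u <= bnd B u.
Proof. by move=> AB; rewrite ler_expR lerD2r ler_wpM2r. Qed.

(** A coordinate is at most exp(|u_1| + |u_2|), so each coordinate factor only raises A by 1 and the
    Gaussian decay is kept. *)
Let gspan_bnd h : gspan h ->
  exists M A, [/\ 0 <= M, 0 <= A & forall u, `|h u| <= M * bnd A u].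
Proof.
elim=> {h}[t|b h _ [M [A [M0 A0 hM]]]|g h _ [M [A [M0 A0 hM]]] _ [N [B [N0 B0 hN]]]|
  c h _ [M [A [M0 A0 hM]]]].
- exists 1, (`|ra| + `|rb|); split=> [//||u]; first exact: addr_ge0.
  rewrite mul1r /gwave normrM (ger0_norm (expR_ge0 _)).
  rewrite -[leRHS]mulr1; apply: ler_pM; [exact: expR_ge0|exact: normr_ge0| |exact: cos_max].
    rewrite ler_expR lerD2r.
    have h1 : ra * u.1 <= `|ra| * `|u.1| by rewrite -normrM ler_norm.
    have h2 : rb * u.2 <= `|rb| * `|u.2| by rewrite -normrM ler_norm.
    have h3 : 0 <= `|ra| * `|u.2| by rewrite mulr_ge0.
    have h4 : 0 <= `|rb| * `|u.1| by rewrite mulr_ge0.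
    by lra.
- exists M, (A + 1); split=> // [|u]; first by rewrite addr_ge0.
  rewrite normrM; have : `|coord b u| <= expR (`|u.1| + `|u.2|).
    apply: (@le_trans _ _ (`|u.1| + `|u.2|)).
      by case: b => /=; rewrite ?lerDl ?lerDr.
    by have := expR_ge1Dx (`|u.1| + `|u.2|); lra.
  move=> hc; apply: (le_trans (ler_pM (normr_ge0 _) (normr_ge0 _) hc (hM u))).
  rewrite mulrCA ler_wpM2l// /bnd -expRD ler_expR.
  by rewrite le_eqVlt; apply/orP; left; apply/eqP; ring.
- exists (M + N), (Num.max A B); split=> [||u].
  + exact: addr_ge0.
  + by rewrite le_max A0.
  apply: (le_trans (ler_normD _ _)); rewrite mulrDl lerD//.
    apply: (le_trans (hM u)); rewrite ler_wpM2l// bnd_le// le_max lexx//.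
  apply: (le_trans (hN u)); rewrite ler_wpM2l// bnd_le// le_max lexx orbT//.
- exists (`|c| * M), A; split=> // [|u]; first exact: mulr_ge0.
  by rewrite normrM -mulrA ler_wpM2l.
Qed.

Lemma gspan_bound h : gspan h -> exists M, forall u, `|h u| <= M.
Proof.
(* Each coordinate contributes A |x| - x^2 / 2 <= A^2 / 2 to the exponent. *)
move=> /gspan_bnd[M [A [M0 A0 hM]]]; exists (M * expR (A ^+ 2)) => u.
apply: (le_trans (hM u)); rewrite ler_wpM2l// ler_expR.
rewrite -(real_normK (num_real u.1)) -(real_normK (num_real u.2)).
have := sqr_ge0 (`|u.1| - A); have := sqr_ge0 (`|u.2| - A).
by rewrite !sqrrB; lra.
Qed.

Lemma rschwartz_gwave t : rschwartz (gwave t).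
Proof.
apply: (rschwartz_coind (C := gspan)); last exact: gspan_base.
move=> g sg; split.
- exact: gspan_diff.
- exact: gspan_bound.
- by move=> b; exact: gspan_coord.
- by move=> b; exact: gspan_derive.
Qed.

End gaussian_schwartz.

Section coherent.
Variable R : realType.
Implicit Types a b al be : R[i].

Definition coh2 a b (u : R * R) : R[i] := coh a u.1 * coh b u.2.

Lemma coh2E a b u : coh2 a b u =
  cexp (a * (u.1)%:C%C + b * (u.2)%:C%C - ((u.1 ^+ 2 + u.2 ^+ 2) / 2)%:C%C).
Proof.
by rewrite /coh2 /coh -cexpD; congr cexp; rewrite mulrDl rmorphD/=; ring.
Qed.

Lemma schwartz_coh2 a b : schwartz R (coh2 a b).
Proof.
case: a b => ra ia [rb ib]; split.
  have := @rschwartz_gwave R ra rb ia ib 0; congr rschwartz.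
  apply/funext => u; rewrite [RHS]/comp coh2E /cexp /gwave /=.
  rewrite mul0r subr0; congr (expR _ * cos _); ring.
have := @rschwartz_gwave R ra rb ia ib (- (pi / 2)); congr rschwartz.
apply/funext => u; rewrite [RHS]/comp coh2E /cexp /gwave /=.
rewrite mul0r addr0 cosD cosN sinN cos_pihalf sin_pihalf mulr0 sub0r mulrN1 opprK.
congr (expR _ * sin _); ring.
Qed.

End coherent.

Section scaled_measure.
Context d (T : measurableType d) (R : realType).
Variables (m : {measure set T -> \bar R}) (k : {nonneg R}).
Hypothesis k0 : 0 < k%:num.

Lemma integrable_mscale (f : T -> \bar R) :
  (mscale k m).-integrable setT f <-> m.-integrable setT f.
Proof.
have E : measurable_fun setT f ->
    (\int[mscale k m]_x `|f x| = k%:num%:E * \int[m]_x `|f x|)%E.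
  by move=> mf; apply: ge0_integral_mscale => //; exact: measurableT_comp.
split=> /integrableP[mf fi]; apply/integrableP; split=> //.
  move: fi; rewrite E//; have : (0 <= \int[m]_x `|f x|)%E by exact: integral_ge0.
  case: (\int[m]_x `|f x|)%E => [r||] // _.
    by move=> _; rewrite ltry.
  by rewrite gt0_muley ?lte_fin.
by rewrite E//; apply: lte_mul_pinfty; rewrite ?lee_fin ?ltW.
Qed.

Lemma Rintegral_mscale (f : T -> R) : m.-integrable setT (EFin \o f) ->
  \int[mscale k m]_x f x = k%:num * \int[m]_x f x.
Proof.
move=> fi; have fi' := (integrable_mscale _).2 fi.
have mf := measurable_int m fi.
rewrite /Rintegral integralE [in RHS]integralE.
rewrite !ge0_integral_mscale//; [|exact: measurable_funeneg|exact: measurable_funepos].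
have [p n] := (integrable_pos_fin_num measurableT fi, integrable_neg_fin_num measurableT fi).
by rewrite -muleBr// ?fin_num_adde_defr// fineM// fin_numB p n.
Qed.

Lemma Cintegrable_mscale (f : T -> R[i]) :
  Cintegrable (mscale k m) f <-> Cintegrable m f.
Proof. by split=> -[f1 f2]; split; exact/integrable_mscale. Qed.

Lemma Cintegral_mscale (f : T -> R[i]) : Cintegrable m f ->
  Cintegral (mscale k m) f = (k%:num)%:C%C * Cintegral m f.
Proof.
by move=> [f1 f2]; apply: complex_ext; rewrite /= Rintegral_mscale//=; ring.
Qed.

Lemma ae_mscale (P : T -> Prop) :
  {ae m, forall x, P x} -> {ae mscale k m, forall x, P x}.
Proof.
move=> [A [mA A0 PA]]; exists A; split=> //.
by rewrite /mscale/= A0 mule0.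
Qed.

End scaled_measure.

Section coherent_families.
Variable R : realType.
Implicit Types a b al be : R[i].
Local Notation leb := (@lebesgue_measure R).
Local Notation lp := (@lebp R).
Local Notation mu2 := (mu2 R).
Local Notation mu1 := (mu1 R).
Local Notation cls1 := (@toL2 _ _ R mu1).

Let n2_gt0 : 0 < (4 * pi : R)^-1. Proof. by rewrite invr_gt0 mulr_gt0// pi_gt0. Qed.
Let n1_gt0 : 0 < (Num.sqrt (4 * pi : R))^-1.
Proof. by rewrite invr_gt0 sqrtr_gt0 mulr_gt0// pi_gt0. Qed.

Lemma mu2_integrable F : Cintegrable mu2 F <-> Cintegrable lp F.
Proof. exact: (@Cintegrable_mscale _ _ R lp (NngNum (@norm2_ge0 R)) n2_gt0). Qed.

Lemma mu2_Cintegral F : Cintegrable lp F ->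
  Cintegral mu2 F = ((4 * pi)^-1)%:C%C * Cintegral lp F.
Proof. exact: (@Cintegral_mscale _ _ R lp (NngNum (@norm2_ge0 R)) n2_gt0). Qed.

Lemma mu1_integrable F : Cintegrable mu1 F <-> Cintegrable leb F.
Proof. exact: (@Cintegrable_mscale _ _ R leb (NngNum (@norm1_ge0 R)) n1_gt0). Qed.

Lemma mu1_Cintegral F : Cintegrable leb F ->
  Cintegral mu1 F = ((Num.sqrt (4 * pi))^-1)%:C%C * Cintegral leb F.
Proof. exact: (@Cintegral_mscale _ _ R leb (NngNum (@norm1_ge0 R)) n1_gt0). Qed.

Lemma mu2_ae (P : R * R -> Prop) :
  {ae lp, forall x, P x} -> {ae mu2, forall x, P x}.
Proof. exact: (@ae_mscale _ _ R lp (NngNum (@norm2_ge0 R))). Qed.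

Lemma rapid_L2 g : rapid g -> g \in L2fun mu2.
Proof.
move=> [mg [M M0 gM]]; apply: (@L2fun_bound _ _ R mu2 g (fun u => M ^+ 2 * Jp u)) => //.
  have := integrableZl measurableT (M ^+ 2) (@integrable_Jp R).
  exact: (@integrable_mscale _ _ R lp (NngNum (@norm2_ge0 R)) n2_gt0 _).2.
move=> u; have J0 := Jp_ge0 u.
have J1 : Jp u <= 1.
  rewrite /Jp -[leRHS]mulr1; apply: ler_pM; rewrite ?jp_le1//; exact/ltW/jp_gt0.
apply: (@le_trans _ _ ((M * Jp u) ^+ 2)).
  by rewrite !expr2; apply: ler_pM; rewrite ?n1_ge0.
by rewrite exprMn ler_wpM2l ?sqr_ge0// expr2 ler_piMl.
Qed.

Lemma schwartz_L2 g : schwartz R g -> g \in L2fun mu2.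
Proof. by move=> /rapid_schwartz; exact: rapid_L2. Qed.

Lemma Cintegral_prod (a b : R -> R[i]) : Cintegrable leb a -> Cintegrable leb b ->
  Cintegrable lp (fun u => a u.1 * b u.2) /\
  Cintegral lp (fun u => a u.1 * b u.2) = Cintegral leb a * Cintegral leb b.
Proof.
move=> ia ib; have mF : cmeas (fun u : R * R => a u.1 * b u.2).
  apply: cmeasM.
    exact: (cmeas_comp (h := fst) measurable_fst (Cintegrable_meas ia)).
  exact: (cmeas_comp (h := snd) measurable_snd (Cintegrable_meas ib)).
have FGH x y : n1 (a (x, y).1 * b (x, y).2) <= n1 (a x) * n1 (b y) by exact: n1M.
split.
  exact: (@Cfubini_prod_integrable _ _ _ _ R leb leb _ _ (Cintegrable_n1 ia)
    (Cintegrable_n1 ib) (fun=> n1_ge0 _) (fun=> n1_ge0 _) _ mF FGH).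
have := @Cfubini1 _ _ _ _ R leb leb _ _ (Cintegrable_n1 ia)
    (Cintegrable_n1 ib) (fun=> n1_ge0 _) (fun=> n1_ge0 _) _ mF FGH.
rewrite -[Cintegral (_ \x _)%E _]/(Cintegral lp _) => <-.
by under eq_Cintegral do rewrite /= CintegralZ//; rewrite CintegralZr.
Qed.

Lemma conj_coh a x : ((coh a x)^*)%C = coh (a^*)%C x.
Proof.
rewrite /coh cexp_conj; congr cexp; case: a => u v.
by apply: complex_ext => /=; ring.
Qed.

Let sq2 : 0 < Num.sqrt 2 :> R. Proof. by rewrite sqrtr_gt0. Qed.
Let sq2E : Num.sqrt 2 ^+ 2 = 2 :> R. Proof. by rewrite sqr_sqrtr. Qed.

Lemma coh_pair a c x :
  ((coh a x)^*)%C * coh c x = coh ((a^*%C + c) * (Num.sqrt 2)^-1%:C%C) (Num.sqrt 2 * x + 0).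
Proof.
rewrite conj_coh /coh -cexpD; congr cexp; rewrite addr0 exprMn sq2E.
have e : (Num.sqrt 2)^-1%:C%C * (Num.sqrt 2 * x)%:C%C = x%:C%C :> R[i].
  by rewrite -(rmorphM (real_complex R))/= mulKf ?gt_eqF.
rewrite -[_ * _ * _]mulrA e.
by apply: complex_ext => /=; case: a c => [a1 a2] [c1 c2] /=; field.
Qed.

Lemma coh_pair_integral a c :
  Cintegrable leb (fun x => ((coh a x)^*)%C * coh c x) /\
  Cintegral leb (fun x => ((coh a x)^*)%C * coh c x) =
    (Num.sqrt pi)%:C%C * cexp ((a^*%C + c) ^+ 2 / 4).
Proof.
rewrite (_ : (fun x => _) =
  fun x => coh ((a^*%C + c) * (Num.sqrt 2)^-1%:C%C) (Num.sqrt 2 * x + 0)); last first.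
  by apply/funext => x; exact: coh_pair.
split; first exact: (Cintegrable_affine 0 sq2 (@Cintegrable_coh _ _)).
rewrite (Cintegral_affine 0 sq2 (@Cintegrable_coh _ _)) Cintegral_coh mulrA.
rewrite -(rmorphM (real_complex R)) /= sqrtrM// mulKf ?gt_eqF//; congr (_ * cexp _).
rewrite exprMn -(rmorphXn (real_complex R)) /= exprVn sq2E -mulrA; congr (_ * _).
by rewrite -halfC -invfM -natrM.
Qed.

Lemma coh_L2 a : coh a \in L2fun mu1.
Proof.
have [ic _] := coh_pair_integral a a.
apply: L2funP; first exact: cmeas_coh.
have [+ _] := (mu1_integrable _).2 ic.
apply: eq_integrable => // x _.
by case: (coh a x) => s t; rewrite /sqn/=; congr (_%:E); ring.
Qed.

Definition ecoh a : L2R R := cls1 (coh a).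

(** The factor 1/2 is sqrt pi divided by the normalization sqrt (4 pi). *)
Lemma ecoh_inner a c : inner (ecoh a) (ecoh c) = 2^-1 * cexp ((a^*%C + c) ^+ 2 / 4).
Proof.
have [i1 i2] := coh_pair_integral a c.
rewrite inner_toL2 ?coh_L2// mu1_Cintegral// i2 mulrA -(rmorphM (real_complex R))/=.
congr (_ * _); rewrite sqrtrM// (_ : Num.sqrt 4 = 2) ?halfC.
  by congr (_%:C)%C; rewrite invfM -mulrA mulVf ?mulr1// gt_eqF// sqrtr_gt0 pi_gt0.
by rewrite (_ : 4 = 2 ^+ 2) ?sqrtr_sqr ?ger0_norm// -natrX.
Qed.

Lemma h0E : @h0 R = fun x => (Num.sqrt 2)%:C%C * coh 0 x.
Proof.
apply/funext => x; rewrite /h0 /coh mul0r sub0r (rmorphM (real_complex R))/=.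
by rewrite expR_cexp; congr (_ * cexp _); apply: complex_ext; rewrite /= ?oppr0//; field.
Qed.

End coherent_families.

(** * Gram matrix and totality of the waves *)

Section waves.
Variable R : realType.
Implicit Types a b al be : R[i].
Local Notation lp := (@lebp R).
Local Notation mu2 := (mu2 R).
Local Notation mu1 := (mu1 R).
Local Notation cls2 := (@toL2 _ _ R mu2).
Local Notation S2 := (schwartz R).

Definition isq2 : R[i] := (Num.sqrt 2)^-1%:C%C.
Definition iu : R[i] := (0 +i* 1)%C.

Lemma isq2_sqr : isq2 ^+ 2 = 2^-1.
Proof. by rewrite /isq2 -(rmorphXn (real_complex R))/= exprVn sqr_sqrtr// halfC. Qed.

Lemma iu_sqr : iu ^+ 2 = -1.
Proof. by apply: complex_ext; rewrite /= ?mul0r ?mulr0 ?mul1r ?sub0r ?addr0 ?oppr0. Qed.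

Lemma isq2_conj : (isq2^*)%C = isq2.
Proof. by apply: complex_ext; rewrite /= ?oppr0. Qed.

Lemma iu_conj : (iu^*)%C = - iu.
Proof. by apply: complex_ext; rewrite /= ?oppr0. Qed.

(* The preimage of [coh al (x) coh be] under the Wigner transformation. *)
Definition wave al be (u : R * R) : R[i] :=
  cexp ((al - be) ^+ 2 / 4) * coh2 ((al + be) * isq2) (- iu * ((al - be) * isq2)) u.

Lemma schwartz_wave al be : S2 (wave al be).
Proof. exact/schwartzZ/schwartz_coh2. Qed.

(** The linear relations between labels and exponents in [wave] are inverted. In particular
    Gaussians times arbitrary plane waves are multiples of waves. *)
Lemma coh2_wave a b : exists al be, forall u,
  coh2 a b u = cexp (b ^+ 2 / 2) * wave al be u.
Proof.
exists ((a + iu * b) * isq2), ((a - iu * b) * isq2) => u.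
rewrite /wave mulrA -cexpD.
have -> : ((a + iu * b) * isq2 + (a - iu * b) * isq2) * isq2 = a.
  have e := isq2_sqr; rewrite (_ : _ * _ = 2 * a * isq2 ^+ 2); last by ring.
  by rewrite e; field.
have -> : - iu * (((a + iu * b) * isq2 - (a - iu * b) * isq2) * isq2) = b.
  rewrite (_ : _ * _ = - (2 * b) * iu ^+ 2 * isq2 ^+ 2); last by ring.
  by rewrite iu_sqr isq2_sqr; field.
rewrite (_ : _ + _ = 0) ?cexp0 ?mul1r//.
rewrite (_ : _ - _ = 2 * b * iu * isq2); last by ring.
by rewrite !exprMn iu_sqr isq2_sqr; field.
Qed.

Lemma conjX (z : R[i]) : ((z ^+ 2)^*)%C = (z^*)%C ^+ 2. Proof. exact: rmorphXn. Qed.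
Lemma conjM (z w : R[i]) : ((z * w)^*)%C = (z^*)%C * (w^*)%C. Proof. exact: rmorphM. Qed.
Lemma conjD (z w : R[i]) : ((z + w)^*)%C = (z^*)%C + (w^*)%C. Proof. exact: rmorphD. Qed.
Lemma conjB (z w : R[i]) : ((z - w)^*)%C = (z^*)%C - (w^*)%C. Proof. exact: rmorphB. Qed.
Lemma conjN (z : R[i]) : ((- z)^*)%C = - (z^*)%C. Proof. exact: rmorphN. Qed.
Lemma conj_nat n : ((n%:R : R[i])^*)%C = n%:R. Proof. exact: rmorph_nat. Qed.
Lemma conjV (z : R[i]) : ((z^-1)^*)%C = ((z^*)%C)^-1. Proof. exact: fmorphV. Qed.

(** With A, B the conjugates of al, be, the exponent is a quadratic form in A - B, al' - be' and A +
    B + al' + be'. The prefactors complete it to (X + Y)^2 / 8 + (X - Y)^2 / 8 = (X^2 + Y^2) / 4,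
    where X = A + al' and Y = B + be'. *)
Lemma wave_pair al be al' be' :
  Cintegrable lp (fun u => ((wave al be u)^*)%C * wave al' be' u) /\
  Cintegral lp (fun u => ((wave al be u)^*)%C * wave al' be' u) =
    pi%:C%C * (cexp ((al^*%C + al') ^+ 2 / 4) * cexp ((be^*%C + be') ^+ 2 / 4)).
Proof.
pose k := (cexp ((al - be) ^+ 2 / 4))^*%C * cexp ((al' - be') ^+ 2 / 4).
rewrite (_ : (fun u => _) = fun u => k *
  ((coh ((al + be) * isq2) u.1)^*%C * coh ((al' + be') * isq2) u.1 *
  ((coh (- iu * ((al - be) * isq2)) u.2)^*%C * coh (- iu * ((al' - be') * isq2)) u.2)));
  last first.
  by apply/funext => u; rewrite /wave /coh2 (conjM (cexp _)) (conjM (coh _ _)) /k; ring.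
have [i1 e1] := coh_pair_integral ((al + be) * isq2) ((al' + be') * isq2).
have [i2 e2] := coh_pair_integral (- iu * ((al - be) * isq2)) (- iu * ((al' - be') * isq2)).
have [ip ep] := Cintegral_prod i1 i2.
split; first exact: CintegrableZ.
rewrite CintegralZ// ep e1 e2 [X in _ * X]mulrACA -(rmorphM (real_complex R))/= -expr2 sqr_sqrtr ?pi_ge0//.
rewrite [LHS]mulrCA; congr (_ * _); rewrite /k cexp_conj -!cexpD; congr cexp.
rewrite !(conjM, conjX, conjD, conjN, conjB, conjV, conj_nat, iu_conj, isq2_conj).
move: (al^*)%C (be^*)%C => A B.
rewrite (_ : (A + B) * isq2 + (al' + be') * isq2 = (A + B + al' + be') * isq2); last by ring.
rewrite (_ : - - iu * _ + _ = (A - B - al' + be') * iu * isq2); last by ring.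
by rewrite !exprMn isq2_sqr iu_sqr; field.
Qed.

Definition ewave (p : R[i] * R[i]) : L2R2 R := cls2 (wave p.1 p.2).

Lemma ewave_inner p q :
  inner (ewave p) (ewave q) = inner (ecoh p.1) (ecoh q.1) * inner (ecoh p.2) (ecoh q.2).
Proof.
have [i1 e1] := wave_pair p.1 p.2 q.1 q.2.
rewrite inner_toL2 ?schwartz_L2//; [|exact: schwartz_wave..].
rewrite mu2_Cintegral// e1 !ecoh_inner mulrA.
have -> : ((4 * pi)^-1)%:C%C * pi%:C%C = 2^-1 * 2^-1 :> R[i].
  rewrite halfC -!(rmorphM (real_complex R))/= invfM -mulrA mulVf ?gt_eqF ?pi_gt0//.
  by congr (_%:C)%C; field.
by rewrite mulrACA.
Qed.

Lemma coh2_conj00 a b u (s t : R) :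
  ((coh2 (- iu * s%:C%C) (- iu * t%:C%C) u)^*)%C = ((coh2 0 0 u)^*)%C * expi (s * u.1 + t * u.2).
Proof.
rewrite !coh2E !cexp_conj expiE -cexpD; congr cexp.
by apply: complex_ext => /=; ring.
Qed.

(** Multiplying by the nowhere vanishing Gaussian [coh2 0 0] reduces the claim to injectivity of the
    Fourier transformation on L^1. Square integrability of h is not presupposed, so that the lemma
    can be applied to a Wigner transform minus its candidate. *)
Lemma wave_unique h : cmeas h ->
  Cintegrable lp (fun u => ((coh2 0 0 u)^*)%C * h u) ->
  (forall al be, Cintegral lp (fun u => ((wave al be u)^*)%C * h u) = 0) ->
  (forall al be, Cintegrable lp (fun u => ((wave al be u)^*)%C * h u)) ->
  h = cst 0 %[ae lp].
Proof.
move=> mh ih h0 hi.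
have k0 : (fun u => ((coh2 0 0 u)^*)%C * h u) = cst 0 %[ae lp].
  apply: fourier_unique => // s t.
  have [al [be E]] := coh2_wave (- iu * s%:C%C) (- iu * t%:C%C).
  under eq_Cintegral => u do rewrite mulrAC -coh2_conj00// E conjM -mulrA.
  by rewrite CintegralZ// h0 mulr0.
case: k0 => A [mA A0 kA]; exists A; split=> // u /= hu; apply: kA => k0; apply: hu => _.
have /eqP := k0 Logic.I; rewrite mulf_eq0 => /orP[|/eqP hu //].
by rewrite coh2E cexp_conj (negbTE (cexp_neq0 _)).
Qed.

Lemma ewave_total : total_family ewave.
Proof.
move=> h hw; rewrite -(toL2_of h).
have hL := ofL2_in h; have mh := L2fun_meas hL.
have ci g : S2 g -> Cintegrable lp (fun u => ((g u)^*)%C * ofL2 h u).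
  move=> Sg; apply/mu2_integrable; apply: Cintegrable_conjM => //.
  exact: schwartz_L2.
have h0 : ofL2 h = cst 0 %[ae lp].
  apply: wave_unique => //.
  - exact/ci/schwartz_coh2.
  - move=> al be; have := hw (al, be); rewrite -{1}(toL2_of h) /ewave inner_toL2//; last first.
      exact/schwartz_L2/schwartz_wave.
    rewrite mu2_Cintegral; last exact/ci/schwartz_wave.
    move/eqP; rewrite mulf_eq0 => /orP[|/eqP//].
    by move=> /eqP[] /eqP; rewrite invr_eq0 mulf_eq0 pnatr_eq0/= gt_eqF// pi_gt0.
  - by move=> al be; exact/ci/schwartz_wave.
have sL : (fun=> 0) \in L2fun mu2 := schwartz_L2 (@schwartz0 R).
have -> : (0 : L2R2 R) = cls2 (fun=> 0).
  apply/esym/rn_eq0/eqP; rewrite -sqrf_eq0 rn_toL2//.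
  by rewrite /Rintegral (eq_integral (cst 0%E)) ?integral0// => x _; rewrite /sqn/= expr0n addr0.
by apply: toL2_ext => //; exact: mu2_ae h0.
Qed.

End waves.

#[local] Opaque cexp expi.

(** * The Wigner transformation *)

Section wigner_theory.
Variable R : realType.
Implicit Types a b al be : R[i].
Local Notation leb := (@lebesgue_measure R).
Local Notation lp := (@lebp R).
Local Notation S2 := (schwartz R).
Local Notation s := (isq2 R).
Local Notation i := (iu R).

Let sq2 : 0 < Num.sqrt 2 :> R. Proof. by rewrite sqrtr_gt0. Qed.
Let s2 := isq2_sqr R.
Let i2 := iu_sqr R.

Lemma schwartz_conjM f g : S2 f -> S2 g -> Cintegrable lp (fun u => (f u)^*%C * g u).
Proof.
move=> Sf Sg; apply: (mu2_integrable _).1.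
by apply: Cintegrable_conjM; exact: schwartz_L2.
Qed.

Lemma sqrt2C : (Num.sqrt 2)%:C%C = 2 * s.
Proof.
rewrite /isq2 -(rmorph_nat (real_complex R)) -(rmorphM (real_complex R))/=; congr (_%:C)%C.
by rewrite -{2}(sqr_sqrtr (ler0n R 2)) expr2 mulfK// gt_eqF.
Qed.

Lemma expi_iu (t : R) : expi t = cexp (i * t%:C%C).
Proof. by rewrite expiE; congr cexp; apply: complex_ext => /=; ring. Qed.

Lemma coh_expi b (t z : R) : coh b z * expi (t * z) = coh (b + i * t%:C%C) z.
Proof.
by rewrite /coh expi_iu -cexpD; congr cexp; rewrite (rmorphM (real_complex R))/=; ring.
Qed.

Lemma divs (x : R) : (x / Num.sqrt 2)%:C%C = x%:C%C * s.
Proof. by rewrite (rmorphM (real_complex R)). Qed.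

Let sqrt2pi_inv : (Num.sqrt (2 * pi))^-1%:C%C * (Num.sqrt (2 * pi))%:C%C = 1 :> R[i].
Proof.
by rewrite -(rmorphM (real_complex R))/= mulVf// gt_eqF// sqrtr_gt0 mulr_gt0// pi_gt0.
Qed.

(** The integral in z is that of a coherent state whose parameter is shifted by i (x - y) / sqrt
    2. *)
Lemma wigner_wave al be : wigner (wave al be) = coh2 al be.
Proof.
apply/funext => -[x y]; rewrite /wigner.
pose b := - i * ((al - be) * s).
pose k := cexp ((al - be) ^+ 2 / 4) * coh ((al + be) * s) ((x + y) / Num.sqrt 2).
under eq_Cintegral => z.
  rewrite (_ : _ * _ = k * coh (b + i * ((x - y) / Num.sqrt 2)%:C%C) z); last first.
    by rewrite -coh_expi /wave /coh2 /k [(x - y) * z / _]mulrAC /=; ring.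
  over.
rewrite CintegralZ; last exact: Cintegrable_coh.
rewrite Cintegral_coh [LHS](_ : _ = ((Num.sqrt (2 * pi))^-1%:C%C * (Num.sqrt (2 * pi))%:C%C) *
  (k * cexp ((b + i * ((x - y) / Num.sqrt 2)%:C%C) ^+ 2 / 2))); last by ring.
rewrite sqrt2pi_inv mul1r /k.
rewrite coh2E -!cexpD; congr cexp; rewrite /b /= !divs.
rewrite !(rmorphM (real_complex R), rmorphD (real_complex R), rmorphB (real_complex R),
  rmorphN (real_complex R), rmorphXn (real_complex R)) /= -halfC -/s.
move: x%:C%C y%:C%C => X Y.
rewrite (_ : _ + i * _ = i * s * (X - Y - (al - be))); last by ring.
rewrite (_ : (X + Y) * s * ((X + Y) * s) = s ^+ 2 * (X + Y) ^+ 2); last by ring.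
rewrite (_ : (al + be) * s * _ = s ^+ 2 * ((al + be) * (X + Y))); last by ring.
by rewrite !exprMn s2 i2; field.
Qed.

Lemma coh_bound a x : n1 (coh a x) <= 2 * expR (Re a ^+ 2 / 2).
Proof.
apply: le_trans (n1_coh _ _) _; rewrite ler_wpM2l// ler_expR.
by have := sqr_ge0 (Re a - x); rewrite sqrrB; lra.
Qed.

Section transform.
Variable g : R * R -> R[i].
Hypothesis Sg : S2 g.

Let mg : cmeas g. Proof. exact: cmeas_schwartz. Qed.

Let wk (u : (R * R) * R) : R[i] :=
  g ((u.1.1 + u.1.2) / Num.sqrt 2, u.2) * expi ((u.1.1 - u.1.2) * u.2 / Num.sqrt 2).

Let m11 : measurable_fun setT (fun u : (R * R) * R => u.1.1).
Proof. exact: (measurableT_comp measurable_fst measurable_fst). Qed.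
Let m12 : measurable_fun setT (fun u : (R * R) * R => u.1.2).
Proof. exact: (measurableT_comp measurable_snd measurable_fst). Qed.
Let m2 : measurable_fun setT (fun u : (R * R) * R => u.2).
Proof. exact: measurable_snd. Qed.

Let mwk : cmeas wk.
Proof.
apply: cmeasM.
  apply: (cmeas_comp (h := fun u : (R * R) * R =>
    ((u.1.1 + u.1.2) / Num.sqrt 2, u.2)) _ mg).
  apply/measurable_fun_pair => //.
  by apply: measurable_funM => //; exact: measurable_funD.
apply: cmeas_expi; apply: measurable_funM => //.
by apply: measurable_funM => //; exact: measurable_funB.
Qed.

Let wk_bound : exists2 M, 0 <= M & forall p z, n1 (wk (p, z)) <= M * jp z.
Proof.
have [_ [M M0 hM]] := rapid_schwartz Sg.
exists (2 * M) => [|p z]; first by rewrite mulr_ge0.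
apply: le_trans (n1M _ _) _; rewrite mulrC -[leRHS]mulrA; apply: ler_pM; rewrite ?n1_ge0 ?n1_expi//.
apply: le_trans (hM _) _; rewrite ler_wpM2l// /Jp/=.
by rewrite ler_piMl ?jp_le1// ltW// jp_gt0.
Qed.

Let ck : R[i] := ((Num.sqrt (2 * pi))^-1)%:C%C.

Let wignerE p : wigner g p = ck * Cintegral leb (fun z => wk (p, z)).
Proof. by case: p. Qed.

Let wk_integrable p : Cintegrable leb (fun z => wk (p, z)).
Proof.
have [M M0 hM] := wk_bound.
apply: (@dominated_Cintegrable _ _ R leb _ (fun z => M * jp z)) => //.
  by case: mwk => h1 h2; split; [exact: measurable_fun_pair2 h1|exact: measurable_fun_pair2 h2].
exact: integrable_jpM.
Qed.

Lemma wigner_bounded : exists2 M, 0 <= M & forall p, n1 (wigner g p) <= M.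
Proof.
have [M M0 hM] := wk_bound; exists (n1 ck * \int[leb]_z (M * jp z)).
  rewrite mulr_ge0 ?n1_ge0//; apply: Rintegral_ge0 => z _.
  by rewrite mulr_ge0// ltW// jp_gt0.
move=> p; rewrite wignerE; apply: le_trans (n1M _ _) _; rewrite ler_wpM2l ?n1_ge0//.
apply: n1_Cintegral_le => //; last exact: integrable_jpM.
exact: Cintegrable_meas (wk_integrable p).
Qed.

Let coh2_integrable al be : Cintegrable lp (coh2 al be).
Proof. by have [] := Cintegral_prod (@Cintegrable_coh R al) (@Cintegrable_coh R be). Qed.

Let F1 al be (u : (R * R) * R) : R[i] := (coh2 al be u.1)^*%C * wk u.

Let mF1 al be : cmeas (F1 al be).
Proof.
apply: cmeasM => //; apply: cmeas_conj.
exact: (cmeas_comp (h := fst) measurable_fst (Cintegrable_meas (coh2_integrable al be))).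
Qed.

Let F1_bound al be : exists2 M, 0 <= M &
  forall p z, n1 (F1 al be (p, z)) <= n1 (coh2 al be p) * (M * jp z).
Proof.
have [M M0 hM] := wk_bound; exists M => // p z; apply: le_trans (n1M _ _) _.
by rewrite n1_conj ler_wpM2l ?n1_ge0.
Qed.

Let F1E al be p : Cintegral leb (fun z => F1 al be (p, z)) =
  (coh2 al be p)^*%C * Cintegral leb (fun z => wk (p, z)).
Proof. by rewrite -CintegralZ. Qed.

(** The kernel is not integrable in p. It is multiplied by a Gaussian in p so that Fubini gives
    measurability, and the Gaussian is divided out afterwards. *)
Lemma cmeas_wigner : cmeas (wigner g).
Proof.
have [M M0 hM] := F1_bound 0 0.
have h := @Cfubini_meas _ _ _ _ R lp leb _ _ (Cintegrable_n1 (coh2_integrable 0 0))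
  (integrable_jpM M) (fun=> n1_ge0 _) (fun z => mulr_ge0 M0 (ltW (jp_gt0 z))) _ (mF1 0 0) hM.
rewrite (_ : wigner g = fun p => ck * ((cexp ((p.1 ^+ 2 + p.2 ^+ 2) / 2)%:C%C) *
  Cintegral leb (fun z => F1 0 0 (p, z)))).
  apply: cmeasZ; apply: cmeasM => //; apply: cmeas_cexp; apply: cmeas_real.
  apply: measurable_funM => //; apply: measurable_funD; apply: measurable_funX.
    exact: measurable_fst.
  exact: measurable_snd.
apply/funext => p; rewrite wignerE F1E; congr (_ * _); rewrite mulrA coh2E cexp_conj -cexpD.
rewrite (_ : _ + _ = 0) ?cexp0 ?mul1r//.
by apply: complex_ext => /=; ring.
Qed.

(** The integrand [F1] at (x, y, z) after the substitution x = sqrt 2 q - y, with v = (y, (q, z)):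
    the argument (x + y) / sqrt 2 of g becomes q, and the phase becomes (q - sqrt 2 y) z. *)
Let F2 al be (v : R * (R * R)) : R[i] :=
  (coh al (Num.sqrt 2 * v.2.1 + - v.1) * coh be v.1)^*%C * g v.2 *
  expi ((v.2.1 - Num.sqrt 2 * v.1) * v.2.2).

Let mF2 al be : cmeas (F2 al be).
Proof.
have n1' : measurable_fun setT (fun v : R * (R * R) => v.1) by exact: measurable_fst.
have n2 : measurable_fun setT (fun v : R * (R * R) => v.2) by exact: measurable_snd.
have n21 : measurable_fun setT (fun v : R * (R * R) => v.2.1).
  exact: (measurableT_comp measurable_fst n2).
have n22 : measurable_fun setT (fun v : R * (R * R) => v.2.2).
  exact: (measurableT_comp measurable_snd n2).
apply: cmeasM.
  apply: cmeasM; last exact: (cmeas_comp n2 mg).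
  apply: cmeas_conj; apply: cmeasM; last exact: (cmeas_comp n1' (@cmeas_coh R be)).
  apply: (cmeas_comp (h := fun v : R * (R * R) => Num.sqrt 2 * v.2.1 + - v.1) _ (@cmeas_coh R al)).
  apply: measurable_funD; first exact: measurable_funM.
  exact: measurableT_comp.
apply: cmeas_expi; apply: measurable_funM => //.
by apply: measurable_funB => //; exact: measurable_funM.
Qed.

Let F2_bound al be y u : n1 (F2 al be (y, u)) <=
  (2 * expR (Re al ^+ 2 / 2) * n1 (coh be y)) * (2 * n1 (g u)).
Proof.
rewrite /F2 /=; apply: le_trans (n1M _ _) _.
rewrite [2 * n1 (g u)]mulrC [leRHS]mulrA; apply: ler_pM; rewrite ?n1_ge0 ?n1_expi//.
apply: le_trans (n1M _ _) _; rewrite ler_wpM2r ?n1_ge0// n1_conj.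
by apply: le_trans (n1M _ _) _; rewrite ler_wpM2r ?n1_ge0// coh_bound.
Qed.

(** At fixed (q, z) only Gaussians in y remain. Their product is the conjugate of a coherent state
    at sqrt 2 y with parameter [ga], and its integral reassembles the wave. *)
Let F2_int al be (u : R * R) : Cintegral leb (fun y => F2 al be (y, u)) =
  (Num.sqrt pi)%:C%C * ((wave al be u)^*%C * g u).
Proof.
case: u => q z.
pose ga := be * s - al * s + q%:C%C + i * z%:C%C.
pose k := cexp (2 * s * al * q%:C%C - q%:C%C ^+ 2 - i * q%:C%C * z%:C%C).
have E y : F2 al be (y, (q, z)) = g (q, z) * (k * coh ga (Num.sqrt 2 * y + 0))^*%C.
  rewrite /F2 /= mulrAC mulrC; congr (_ * _).
  have -> : expi ((q - Num.sqrt 2 * y) * z) = (expi (- ((q - Num.sqrt 2 * y) * z)))^*%C.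
    by rewrite expi_conj opprK.
  rewrite -(conjM (coh al _ * _)); congr (_^*)%C.
  rewrite /coh expi_iu -!cexpD; congr cexp; rewrite addr0 /ga.
  rewrite !(rmorphM (real_complex R), rmorphD (real_complex R), rmorphB (real_complex R),
    rmorphN (real_complex R), rmorphXn (real_complex R)) /= -halfC sqrt2C.
  move: q%:C%C z%:C%C y%:C%C => Q Z Y.
  rewrite (_ : (be * s - al * s + Q + i * Z) * (2 * s * Y) =
    s ^+ 2 * (2 * (be - al) * Y) + (Q + i * Z) * (2 * s * Y)); last by ring.
  rewrite (_ : 2 * s * Y * (2 * s * Y) = s ^+ 2 * (4 * Y ^+ 2)); last by ring.
  rewrite (_ : (2 * s * Q - Y) * (2 * s * Q - Y) = s ^+ 2 * (4 * Q ^+ 2) - 4 * s * Q * Y + Y ^+ 2); last by ring.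
  by rewrite s2; move: s i => S I; field.
under eq_Cintegral do rewrite E.
have ic : Cintegrable leb (fun y => k * coh ga (Num.sqrt 2 * y + 0)).
  by apply: CintegrableZ; exact: (Cintegrable_affine 0 sq2 (@Cintegrable_coh R ga)).
rewrite CintegralZ; last first.
  apply: (dominated_Cintegrable _ (Cintegrable_n1 ic)).
    exact/cmeas_conj/(Cintegrable_meas ic).
  by move=> y /=; rewrite n1_conj.
rewrite Cintegral_conj; last exact: ic.
rewrite CintegralZ; last exact: (Cintegrable_affine 0 sq2 (@Cintegrable_coh R ga)).
rewrite (Cintegral_affine 0 sq2 (@Cintegrable_coh R ga)) Cintegral_coh.
have -> : (Num.sqrt 2)^-1%:C%C * ((Num.sqrt (2 * pi))%:C%C * cexp (ga ^+ 2 / 2)) =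
    (Num.sqrt pi)%:C%C * cexp (ga ^+ 2 / 2) :> R[i].
  by rewrite mulrA -(rmorphM (real_complex R))/= sqrtrM// mulKf ?gt_eqF.
have cr : ((Num.sqrt pi)%:C%C^*)%C = (Num.sqrt pi)%:C%C :> R[i].
  by apply: complex_ext; rewrite /= ?oppr0.
suff ew : k * cexp (ga ^+ 2 / 2) = wave al be (q, z).
  by rewrite [k * _]mulrCA ew (conjM (_%:C)%C) cr; ring.
rewrite /k /wave coh2E -!cexpD; congr cexp; rewrite /ga /=.
rewrite !(rmorphM (real_complex R), rmorphD (real_complex R), rmorphXn (real_complex R)) /= -halfC.
move: q%:C%C z%:C%C => Q Z.
rewrite (_ : (_ + i * Z) ^+ 2 = s ^+ 2 * (be - al) ^+ 2 + 2 * (be - al) * s * (Q + i * Z)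
  + Q ^+ 2 + 2 * i * Q * Z + i ^+ 2 * Z ^+ 2); last by ring.
by rewrite s2 i2; move: s i => S I; field.
Qed.

(** This computes the adjoint of the Wigner transformation on Gaussians. The rotation of the plane
    is performed as an affine substitution in x at fixed y, after which Fubini lets y be integrated
    first. *)
Lemma wigner_pair al be :
  Cintegral lp (fun p => (coh2 al be p)^*%C * wigner g p) =
  Cintegral lp (fun u => (wave al be u)^*%C * g u).
Proof.
have [M M0 hM] := F1_bound al be.
have MJ0 z : 0 <= M * jp z by rewrite mulr_ge0// ltW// jp_gt0.
pose phi p := Cintegral leb (fun z => F1 al be (p, z)).
have mphi : cmeas phi := @Cfubini_meas _ _ _ _ R lp leb _ _ (Cintegrable_n1 (coh2_integrable al be))
  (integrable_jpM M) (fun=> n1_ge0 _) MJ0 _ (mF1 al be) hM.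
pose I := \int[leb]_z (M * jp z).
have I0 : 0 <= I by apply: Rintegral_ge0 => z _.
have phi_bound x y : n1 (phi (x, y)) <= n1 (coh al x) * (n1 (coh be y) * I).
  apply: (@le_trans _ _ (n1 (coh2 al be (x, y)) * I)).
    exact: (@Cfubini_bound _ _ _ _ R leb _ _ (integrable_jpM M) _ (mF1 al be) hM (x, y)).
  by rewrite mulrA ler_wpM2r// n1M.
have iH : leb.-integrable setT (EFin \o (fun y => n1 (coh be y) * I)).
  have := integrableZl measurableT I (Cintegrable_n1 (@Cintegrable_coh R be)).
  by congr (_.-integrable _ _); apply/funext => y /=; rewrite -EFinM mulrC.
have HI0 y : 0 <= n1 (coh be y) * I by rewrite mulr_ge0 ?n1_ge0.
have iphi : Cintegrable lp phi := @Cfubini_prod_integrable _ _ _ _ R leb leb _ _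
  (Cintegrable_n1 (@Cintegrable_coh R al)) iH (fun=> n1_ge0 _) HI0 phi mphi phi_bound.
rewrite (_ : (fun p => _) = fun p => ck * phi p); last first.
  by apply/funext => p; rewrite wignerE /phi F1E mulrCA.
rewrite CintegralZ//.
have := @Cfubini2 _ _ _ _ R leb leb _ _
  (Cintegrable_n1 (@Cintegrable_coh R al)) iH (fun=> n1_ge0 _) HI0 phi mphi phi_bound.
rewrite -[Cintegral (_ \x _)%E _]/(Cintegral lp _) => <-.
have [_ [N N0 hN]] := rapid_schwartz Sg.
pose B y := 2 * expR (Re al ^+ 2 / 2) * n1 (coh be y) * 2.
have B0 y : 0 <= B y by rewrite !mulr_ge0 ?n1_ge0 ?expR_ge0.
under eq_Cintegral => y.
  have -> : Cintegral leb (fun x => phi (x, y)) =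
      (Num.sqrt 2)%:C%C * Cintegral lp (fun u => F2 al be (y, u)).
    have i1 : Cintegrable leb (fun x => phi (x, y)) := @Cfubini_integrable1 _ _ _ _ R leb _ _
      (Cintegrable_n1 (@Cintegrable_coh R al)) phi mphi phi_bound y.
    have := Cintegral_affine (- y) sq2 i1.
    have e2 : (Num.sqrt 2)%:C%C * (Num.sqrt 2)^-1%:C%C = 1 :> R[i].
      by rewrite -(rmorphM (real_complex R))/= divff// gt_eqF.
    move/(congr1 (fun t => (Num.sqrt 2)%:C%C * t)); rewrite mulrA e2 mul1r => <-.
    congr (_ * _).
    have m2y : cmeas (fun u : R * R => F2 al be (y, u)).
      by case: (mF2 al be) => h1 h2; split;
        [exact: measurable_fun_pair2 h1|exact: measurable_fun_pair2 h2].
    have b2y q z : n1 (F2 al be (y, (q, z))) <= (B y * N * jp q) * jp z.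
      apply: le_trans (F2_bound _ _ _ _) _; rewrite mulrA -/(B y).
      by rewrite -[leRHS]mulrA -[leRHS]mulrA ler_wpM2l//; exact: hN.
    have BN q : 0 <= B y * N * jp q by apply: mulr_ge0; [exact: mulr_ge0 (B0 y) N0|exact: ltW (jp_gt0 q)].
    have := @Cfubini1 _ _ _ _ R leb leb _ _ (integrable_jpM (B y * N)) (@integrable_jp R)
      BN (fun z => ltW (jp_gt0 z)) _ m2y b2y.
    rewrite -[Cintegral (_ \x _)%E _]/(Cintegral lp _) => <-.
    apply: eq_Cintegral => q; apply: eq_Cintegral => z.
    rewrite /F1 /F2 /wk /coh2/= -mulrA subrK.
    have s0 : Num.sqrt 2 != 0 :> R by rewrite gt_eqF.
    have a1 : Num.sqrt 2 * q / Num.sqrt 2 = q by rewrite mulrAC divff ?mul1r.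
    have a2 : (Num.sqrt 2 * q - y - y) * (z / Num.sqrt 2) = (q - Num.sqrt 2 * y) * z.
      rewrite -addrA -opprD (_ : y + y = Num.sqrt 2 ^+ 2 * y).
        by move: (Num.sqrt 2) s0 => r r0; field.
      by rewrite sqr_sqrtr//; ring.
    by rewrite a1 a2 mulrA.
  over.
have iG : leb.-integrable setT (EFin \o (fun y => 2 * expR (Re al ^+ 2 / 2) * n1 (coh be y))).
  exact: (integrableZl measurableT _ (Cintegrable_n1 (@Cintegrable_coh R be))).
have iHg : lp.-integrable setT (EFin \o (fun u => 2 * n1 (g u))).
  exact: (integrableZl measurableT _ (Cintegrable_n1 (rapid_integrable (rapid_schwartz Sg)))).
have G0 y : 0 <= 2 * expR (Re al ^+ 2 / 2) * n1 (coh be y) by rewrite !mulr_ge0 ?n1_ge0 ?expR_ge0.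
have H0 u : 0 <= 2 * n1 (g u) by rewrite mulr_ge0 ?n1_ge0.
rewrite CintegralZ; last first.
  exact: (@Cfubini_integrable _ _ _ _ R leb lp _ _ iG iHg G0 H0 _ (mF2 al be) (F2_bound al be)).
rewrite (@Cfubini _ _ _ _ R leb lp _ _ iG iHg G0 H0 _ (mF2 al be) (F2_bound al be)).
under eq_Cintegral do rewrite F2_int.
rewrite CintegralZ; last first.
  exact: schwartz_conjM (schwartz_wave al be) Sg.
(* The constants cancel: (2 pi)^(-1/2) from the transform, sqrt 2 from the substitution and sqrt pi
   from the Gaussian integral. *)
rewrite !mulrA -!(rmorphM (real_complex R))/= sqrtrM// [X in X%:C%C](_ : _ = 1) ?mul1r//.
have : Num.sqrt pi != 0 :> R by rewrite gt_eqF// sqrtr_gt0 pi_gt0.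
have : Num.sqrt 2 != 0 :> R by rewrite gt_eqF.
by move: (Num.sqrt pi) (Num.sqrt 2) => p r r0 p0; field; rewrite p0.
Qed.

End transform.
End wigner_theory.

Section L2_scale.
Context d (T : measurableType d) (R : realType).
Variable mu : {measure set T -> \bar R}.

Lemma L2fun0 : (fun=> 0) \in @L2fun _ _ R mu.
Proof. exact: (rpred0 (@L2fun _ _ R mu)). Qed.

Lemma toL2_0 : toL2 mu (fun=> 0 : R[i]) = 0.
Proof.
have := toL2_lin (-1) L2fun0 L2fun0; rewrite scaleN1r addNr => <-.
by congr toL2; apply/funext => x; rewrite mulr0 addr0.
Qed.

Lemma toL2_scale (f : T -> R[i]) (k : R[i]) : f \in L2fun mu ->
  toL2 mu (fun u => k * f u) = k *: toL2 mu f.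
Proof.
move=> fL; have := toL2_lin k fL L2fun0; rewrite toL2_0 addr0 => <-.
by congr toL2; apply/funext => u; rewrite addr0.
Qed.

Lemma L2fun_ae (f g : T -> R[i]) : cmeas f -> g \in L2fun mu ->
  f = g %[ae mu] -> f \in L2fun mu.
Proof.
move=> mf gL fg; apply: L2funP => //.
have msqn (h : T -> R[i]) : cmeas h -> measurable_fun setT (@sqn R \o h).
  by move=> [h1 h2]; apply: measurable_funD; exact: measurable_funX.
have /integrableP[_ gi] := L2fun_sqn gL.
apply/integrableP; split; first exact/measurable_EFinP/msqn.
apply: le_lt_trans gi; rewrite le_eqVlt; apply/orP; left; apply/eqP.
apply: ae_eq_integral => //.
- by apply: measurableT_comp => //; exact/measurable_EFinP/msqn.
- by apply: measurableT_comp => //; exact/measurable_EFinP/msqn/(L2fun_meas gL).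
- by apply: filterS fg => x E _ /=; rewrite E.
Qed.

End L2_scale.

Lemma iso_inj (R : realType) (U V : preHilbertType R) (J : U -> V) :
  (forall x y, inner (J x) (J y) = inner x y) -> injective J.
Proof.
move=> Ji x y E; apply/subr0_eq/rn_eq0; have := rn_sqr (x - y).
rewrite !(innerBl, innerBr) -(Ji x x) -(Ji x y) -(Ji y x) -(Ji y y) E !subrr.
by move=> /(congr1 Re)/= /esym/eqP; rewrite sqrf_eq0 => /eqP.
Qed.

(** * Unitarity of the Wigner transformation *)

Section wigner_unitary.
Variable R : realType.
Implicit Types a b al be : R[i].
Local Notation leb := (@lebesgue_measure R).
Local Notation lp := (@lebp R).
Local Notation S2 := (schwartz R).
Local Notation mu2 := (mu2 R).
Local Notation cls2 := (@toL2 _ _ R mu2).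
Local Notation ewave := (@ewave R).
Local Notation W := (@W R).
Local Notation Winv := (@Winv R).
Local Notation cL2 := (@L2_complete _ _ R mu2).

Definition eten (p : R[i] * R[i]) : L2R2 R := cls2 (coh2 p.1 p.2).

Lemma mu1_conjM f g : f \in L2fun (mu1 R) -> g \in L2fun (mu1 R) ->
  Cintegrable leb (fun x => (f x)^*%C * g x).
Proof. by move=> fL gL; exact: (mu1_integrable _).1 (Cintegrable_conjM fL gL). Qed.

Lemma mu2_conjM f g : f \in L2fun mu2 -> g \in L2fun mu2 ->
  Cintegrable lp (fun u => (f u)^*%C * g u).
Proof. by move=> fL gL; exact: (mu2_integrable _).1 (Cintegrable_conjM fL gL). Qed.

Lemma inner_cls2 f g : f \in L2fun mu2 -> g \in L2fun mu2 ->
  inner (cls2 f) (cls2 g) = ((4 * pi)^-1)%:C%C * Cintegral lp (fun u => (f u)^*%C * g u).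
Proof.
move=> fL gL; rewrite inner_toL2// mu2_Cintegral//.
exact: mu2_conjM.
Qed.

Lemma inner_prod (a b a' b' : R -> R[i]) :
  a \in L2fun (mu1 R) -> b \in L2fun (mu1 R) ->
  a' \in L2fun (mu1 R) -> b' \in L2fun (mu1 R) ->
  (fun u => a u.1 * b u.2) \in L2fun mu2 /\
  inner (cls2 (fun u => a u.1 * b u.2)) (cls2 (fun u => a' u.1 * b' u.2)) =
  inner (toL2 (mu1 R) a) (toL2 (mu1 R) a') * inner (toL2 (mu1 R) b) (toL2 (mu1 R) b').
Proof.
have L c c' : c \in L2fun (mu1 R) -> c' \in L2fun (mu1 R) ->
    (fun u => c u.1 * c' u.2) \in L2fun mu2.
  move=> cL cL'; apply: L2funP.
    apply: cmeasM.
      exact: (cmeas_comp (h := fst) measurable_fst (L2fun_meas cL)).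
    exact: (cmeas_comp (h := snd) measurable_snd (L2fun_meas cL')).
  have i1 := mu1_conjM cL cL.
  have i2 := mu1_conjM cL' cL'.
  have [ip _] := Cintegral_prod i1 i2.
  have [+ _] := (mu2_integrable _).2 ip.
  apply: eq_integrable => // -[x y] _.
  rewrite -[LHS]/((Re ((c x)^*%C * c x * ((c' y)^*%C * c' y)))%:E) /=.
  by case: (c x) (c' y) => [r t] [r' t']; rewrite /sqn/=; congr (_%:E); ring.
move=> aL bL aL' bL'; split; first exact: L.
rewrite inner_cls2 ?L// !inner_toL2//.
have i1 := mu1_conjM aL aL'.
have i2 := mu1_conjM bL bL'.
have [ip ep] := Cintegral_prod i1 i2.
rewrite [X in _ * X = _](_ : _ = Cintegral lp (fun u => (a u.1)^*%C * a' u.1 *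
  ((b u.2)^*%C * b' u.2))); last by apply: eq_Cintegral => u; rewrite conjM; ring.
rewrite ep !mu1_Cintegral// mulrACA; congr (_ * _).
rewrite -(rmorphM (real_complex R))/= -invfM -expr2 sqr_sqrtr//.
by rewrite mulr_ge0 ?pi_ge0.
Qed.

Lemma eten_inner p q :
  inner (eten p) (eten q) = inner (ecoh p.1) (ecoh q.1) * inner (ecoh p.2) (ecoh q.2).
Proof. by have [] := inner_prod (coh_L2 p.1) (coh_L2 p.2) (coh_L2 q.1) (coh_L2 q.2). Qed.

Lemma ewave_eten p : ewave p = cexp ((p.1 - p.2) ^+ 2 / 4) *:
  eten ((p.1 + p.2) * isq2 R, - iu R * ((p.1 - p.2) * isq2 R)).
Proof. by rewrite -toL2_scale//; exact/schwartz_L2/schwartz_coh2. Qed.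

Lemma eten_total : total_family eten.
Proof. by move=> h hh; apply: ewave_total => p; rewrite ewave_eten innerZl hh mulr0. Qed.

(** U comes from the equality of the Gram matrices. By [wigner_pair], the Wigner transform of g and
    U g have the same pairings with all Gaussians, so they agree almost everywhere; this also proves
    that the transform is square integrable. *)
Lemma wigner_iso_ex : exists U : L2R2 R -> L2R2 R,
  [/\ forall x y, inner (U x) (U y) = inner x y,
      forall p, U (ewave p) = eten p &
      forall g, S2 g -> wigner g \in L2fun mu2 /\ cls2 (wigner g) = U (cls2 g)].
Proof.
have [U [Ui Uw]] := iso_total_ex cL2 (@ewave_total R) cL2
  (fun p q => etrans (eten_inner p q) (esym (ewave_inner p q))).
exists U; split=> // g Sg; pose k := ofL2 (U (cls2 g)).
have kL : k \in L2fun mu2 := ofL2_in _.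
have mw := cmeas_wigner Sg.
have [M M0 hM] := wigner_bounded Sg.
have iw a b : Cintegrable lp (fun u => (coh2 a b u)^*%C * wigner g u).
  have ic := rapid_integrable (rapid_schwartz (schwartz_coh2 a b)).
  apply: (dominated_Cintegrable _ (integrableZl measurableT M (Cintegrable_n1 ic))).
    by apply: cmeasM => //; exact/cmeas_conj/(Cintegrable_meas ic).
  move=> u /=; apply: le_trans (n1M _ _) _; rewrite n1_conj mulrC.
  by rewrite ler_wpM2r ?n1_ge0.
have ik a b : Cintegrable lp (fun u => (coh2 a b u)^*%C * k u).
  exact: mu2_conjM (schwartz_L2 (schwartz_coh2 a b)) kL.
have E a b : (fun u => (coh2 a b u)^*%C * (wigner g u - k u)) =
    (fun u => (coh2 a b u)^*%C * wigner g u - (coh2 a b u)^*%C * k u).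
  by apply/funext => u; rewrite mulrBr.
have id a b : Cintegrable lp (fun u => (coh2 a b u)^*%C * (wigner g u - k u)).
  by rewrite E; apply: CintegrableD => //; exact: CintegrableN.
have z a b : Cintegral lp (fun u => (coh2 a b u)^*%C * (wigner g u - k u)) = 0.
  rewrite E CintegralB//; apply/eqP; rewrite subr_eq0; apply/eqP.
  rewrite wigner_pair//.
  have n : ((4 * pi)^-1)%:C%C != 0 :> R[i].
    by rewrite eq_complex/= eqxx andbT invr_eq0 mulf_neq0// gt_eqF// pi_gt0.
  have cL := schwartz_L2 (schwartz_coh2 a b); have gL := schwartz_L2 Sg.
  have vL := schwartz_L2 (schwartz_wave a b).
  apply: (mulfI n); rewrite -(inner_cls2 vL gL) -(inner_cls2 cL kL).
  by rewrite toL2_of -[cls2 (coh2 a b)]/(eten (a, b)) -Uw Ui.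
have wE al be u : wave al be u = cexp ((al - be) ^+ 2 / 4) *
   coh2 ((al + be) * isq2 R) (- iu R * ((al - be) * isq2 R)) u by [].
have wk : wigner g = k %[ae mu2].
  have : (fun u => wigner g u - k u) = cst 0 %[ae lp].
    apply: wave_unique => //.
    - by apply: cmeasD => //; apply: cmeasN; exact: L2fun_meas kL.
    - move=> al be; under eq_Cintegral => u do rewrite wE conjM -mulrA.
      by rewrite CintegralZ// z mulr0.
    - move=> al be; rewrite (_ : (fun u => _) = fun u => (cexp ((al - be) ^+ 2 / 4))^*%C *
        ((coh2 ((al + be) * isq2 R) (- iu R * ((al - be) * isq2 R)) u)^*%C * (wigner g u - k u))).
        exact: CintegrableZ.
      by apply/funext => u; rewrite wE conjM mulrA.
  move=> /mu2_ae[A [mA A0 h]]; exists A; split=> // u hu; apply: h => /= E'.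
  by apply: hu => /E' /= /subr0_eq.
have wL : wigner g \in L2fun mu2 := @L2fun_ae _ _ R mu2 (wigner g) k mw kL wk.
by split=> //; rewrite -(toL2_of (U _)); apply: toL2_ext.
Qed.

Lemma lincomb_schwartz (I : Type) (F : I -> R * R -> R[i]) l : (forall i, S2 (F i)) ->
  exists2 g, S2 g & lincomb (fun i => cls2 (F i)) l = cls2 g.
Proof.
move=> SF; elim: l => [|p l [g Sg IH]].
  exists (fun=> 0); first exact: schwartz0.
  by rewrite /lincomb big_nil toL2_0.
exists (fun u => p.1 * F p.2 u + g u); first by apply: schwartzD => //; exact: schwartzZ.
by rewrite toL2_lin ?schwartz_L2// -IH /lincomb big_cons.
Qed.

Lemma schwartz_dense x : closure (cls2 @` S2) x.
Proof.
apply/closureP => e e0; have [l hl] := total_dense cL2 (@ewave_total R) x e0.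
have [g Sg E] := lincomb_schwartz l (fun p : R[i] * R[i] => schwartz_wave p.1 p.2).
by exists (cls2 g); [exists g|rewrite -E].
Qed.

Let wigner_iso g g' : S2 g -> S2 g' ->
  inner (cls2 (wigner g)) (cls2 (wigner g')) = inner (cls2 g) (cls2 g').
Proof.
have [U [Ui _ UE]] := wigner_iso_ex => Sg Sg'.
by have [_ ->] := UE g Sg; have [_ ->] := UE g' Sg'.
Qed.

Lemma W_cls g : S2 g -> W (cls2 g) = cls2 (wigner g).
Proof. by move=> Sg; rewrite /Defs.W (ext_isoE cL2 wigner_iso). Qed.

Lemma W_inner x y : inner (W x) (W y) = inner x y.
Proof. by apply: (ext_iso cL2 wigner_iso); exact: schwartz_dense. Qed.

Lemma W_wave p : W (ewave p) = eten p.
Proof. by rewrite W_cls ?wigner_wave//; exact: schwartz_wave. Qed.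

Lemma total_iso_eq (V : preHilbertType R) (I : Type) (e : I -> L2R2 R) (A B : L2R2 R -> V) :
  total_family e -> (forall x y, inner (A x) (A y) = inner x y) ->
  (forall x y, inner (B x) (B y) = inner x y) -> (forall i, A (e i) = B (e i)) -> A =1 B.
Proof.
move=> te Ai Bi AB; apply: (total_op_eq (C := 1) cL2 te) => //.
- by move=> a x y; apply: (iso_lin (P := setT)).
- by move=> a x y; apply: (iso_lin (P := setT)).
- by move=> x; rewrite mul1r (iso_rn (P := setT)).
- by move=> x; rewrite mul1r (iso_rn (P := setT)).
Qed.

(** With the two families exchanged, the same construction gives an isometry U from [eten] to
    [ewave], and W after U fixes a total family. *)
Lemma W_surj y : exists x, W x = y.
Proof.
have [U [Ui Uw]] := iso_total_ex cL2 eten_total cL2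
  (fun p q => etrans (ewave_inner p q) (esym (eten_inner p q))).
exists (U y); apply: (total_iso_eq (A := W \o U) (B := id) eten_total) => //.
  by move=> x z; rewrite /= W_inner.
by move=> p; rewrite /= Uw W_wave.
Qed.

Lemma W_inj : injective W.
Proof. exact: iso_inj W_inner. Qed.

Lemma WinvK y : W (Winv y) = y.
Proof.
have [x <-] := W_surj y.
by rewrite [LHS]pinvK// inE; exists x.
Qed.

Lemma WK x : Winv (W x) = x.
Proof. by apply: W_inj; rewrite WinvK. Qed.

Lemma Winv_inner x y : inner (Winv x) (Winv y) = inner x y.
Proof. by rewrite -W_inner !WinvK. Qed.

Lemma Winv_eten p : Winv (eten p) = ewave p.
Proof. by rewrite -W_wave WK. Qed.

End wigner_unitary.

(** * The left regular representation *)

Section phase_transform.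
Variable R : realType.
Implicit Types a b al be : R[i].
Local Notation lp := (@lebp R).
Local Notation lq := (@lebq R).
Local Notation S2 := (schwartz R).
Local Notation s := (isq2 R).
Local Notation i := (iu R).

Section triple.
Variables h f g : R * R -> R[i].
Hypotheses (Sh : S2 h) (Sf : S2 f) (Sg : S2 g).

Let F (x : ((R * R) * (R * R)) * (R * R)) : R[i] :=
  f x.1.2 * g x.1.1 * ((h x.2)^*%C * expi (phase x.2 x.1.2 x.1.1)).

Let mF : cmeas F.
Proof.
have q1 : measurable_fun setT (fun x : ((R * R) * (R * R)) * (R * R) => x.1).
  exact: measurable_fst.
have q2 : measurable_fun setT (fun x : ((R * R) * (R * R)) * (R * R) => x.2).
  exact: measurable_snd.
have q12 : measurable_fun setT (fun x : ((R * R) * (R * R)) * (R * R) => x.1.2).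
  exact: (measurableT_comp measurable_snd q1).
have q11 : measurable_fun setT (fun x : ((R * R) * (R * R)) * (R * R) => x.1.1).
  exact: (measurableT_comp measurable_fst q1).
apply: cmeasM.
  apply: cmeasM; first exact: (cmeas_comp q12 (cmeas_schwartz Sf)).
  exact: (cmeas_comp q11 (cmeas_schwartz Sg)).
apply: cmeasM; first exact/cmeas_conj/(cmeas_comp q2 (cmeas_schwartz Sh)).
apply: cmeas_expi.
by apply: measurable_funD; first apply: measurable_funD; exact: measurable_symp.
Qed.

Let G (z : (R * R) * (R * R)) : R := n1 (g z.1) * n1 (f z.2).
Let H (u : R * R) : R := 2 * n1 (h u).

Let iG : lq.-integrable setT (EFin \o G).
Proof.
exact: (@integrable_prod _ _ _ _ R lp lp _ _
  (Cintegrable_n1 (rapid_integrable (rapid_schwartz Sg)))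
  (Cintegrable_n1 (rapid_integrable (rapid_schwartz Sf)))
  (fun=> n1_ge0 _) (fun=> n1_ge0 _)).
Qed.

Let iH : lp.-integrable setT (EFin \o H).
Proof.
exact: (integrableZl measurableT 2 (Cintegrable_n1 (rapid_integrable (rapid_schwartz Sh)))).
Qed.

Let G0 z : 0 <= G z. Proof. by rewrite mulr_ge0 ?n1_ge0. Qed.
Let H0 u : 0 <= H u. Proof. by rewrite mulr_ge0 ?n1_ge0. Qed.

Let FGH z u : n1 (F (z, u)) <= G z * H u.
Proof.
apply: le_trans (n1M _ _) _; apply: ler_pM; rewrite ?n1_ge0//.
  by rewrite [G z]mulrC n1M.
by apply: le_trans (n1M _ _) _; rewrite n1_conj mulrC ler_wpM2r ?n1_ge0 ?n1_expi.
Qed.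

Let pair_integrable v w : Cintegrable lp (fun u => (h u)^*%C * expi (phase u v w)).
Proof.
apply: (@dominated_Cintegrable _ _ R lp _ H) => //.
  apply: cmeasM; first exact/cmeas_conj/cmeas_schwartz.
  apply: cmeas_expi.
  by apply: measurable_funD; first apply: measurable_funD; apply: measurable_symp => //;
    exact: measurable_cst.
by move=> u; apply: le_trans (n1M _ _) _; rewrite n1_conj mulrC ler_wpM2r ?n1_ge0 ?n1_expi.
Qed.

Let slice_integrable v : Cintegrable lp (fun w =>
  Cintegral lp (fun u => g w * ((h u)^*%C * expi (phase u v w)))).
Proof.
pose Fv (x : (R * R) * (R * R)) : R[i] := g x.1 * ((h x.2)^*%C * expi (phase x.2 v x.1)).
have q1 : measurable_fun setT (fun x : (R * R) * (R * R) => x.1) by exact: measurable_fst.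
have q2 : measurable_fun setT (fun x : (R * R) * (R * R) => x.2) by exact: measurable_snd.
have mFv : cmeas Fv.
  apply: cmeasM; first exact: (cmeas_comp q1 (cmeas_schwartz Sg)).
  apply: cmeasM; first exact/cmeas_conj/(cmeas_comp q2 (cmeas_schwartz Sh)).
  apply: cmeas_expi.
  by apply: measurable_funD; first apply: measurable_funD; apply: measurable_symp => //;
    exact: measurable_cst.
apply: (@Cfubini_integrable _ _ _ _ R lp lp _ _
  (Cintegrable_n1 (rapid_integrable (rapid_schwartz Sg))) iH (fun=> n1_ge0 _) H0 Fv mFv).
move=> w u; apply: le_trans (n1M _ _) _; rewrite ler_wpM2l ?n1_ge0//.
by apply: le_trans (n1M _ _) _; rewrite n1_conj mulrC ler_wpM2r ?n1_ge0 ?n1_expi.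
Qed.

(** Fubini on R^6 makes u the innermost variable and v the outermost, so that f is left as a weight
    on an integral that can be evaluated at fixed v. *)
Lemma twisted_pair :
  Cintegrable lp (fun v => f v * Cintegral lp (fun w => g w *
    Cintegral lp (fun u => (h u)^*%C * expi (phase u v w)))) /\
  Cintegral lp (fun u => (h u)^*%C * twisted f g u) =
  c4 R * Cintegral lp (fun v => f v * Cintegral lp (fun w => g w *
    Cintegral lp (fun u => (h u)^*%C * expi (phase u v w)))).
Proof.
have rf := rapid_schwartz Sf; have rg := rapid_schwartz Sg.
pose phi z := Cintegral lp (fun u => F (z, u)).
have mphi : cmeas phi := @Cfubini_meas _ _ _ _ R lq lp _ _ iG iH G0 H0 F mF FGH.
have phib z := @Cfubini_bound _ _ _ _ R lp _ _ iH F mF FGH z.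
have [_ [M1 M10 hM1]] := rf; have [_ [M2 M20 hM2]] := rg.
have I0 : 0 <= \int[lp]_u H u by apply: Rintegral_ge0.
have phiJ x y : n1 (phi (x, y)) <= (M2 * M1 * \int[lp]_u H u) * Jp x * Jp y.
  apply: le_trans (phib _) _.
  rewrite (_ : _ * Jp y = (M2 * Jp x * (M1 * Jp y)) * \int[lp]_u H u); last by ring.
  by rewrite ler_wpM2r//; apply: ler_pM; rewrite ?n1_ge0.
have E v : f v * Cintegral lp (fun w => g w *
    Cintegral lp (fun u => (h u)^*%C * expi (phase u v w))) = Cintegral lp (fun w => phi (w, v)).
  have -> : (fun w => g w * Cintegral lp (fun u => (h u)^*%C * expi (phase u v w))) =
      (fun w => Cintegral lp (fun u => g w * ((h u)^*%C * expi (phase u v w)))).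
    by apply/funext => w; rewrite CintegralZ//; exact: pair_integrable.
  rewrite -CintegralZ; last exact: slice_integrable.
  apply: eq_Cintegral => w; rewrite -CintegralZ; last first.
    by apply: CintegrableZ; exact: pair_integrable.
  by apply: eq_Cintegral => u; rewrite /F /= -mulrA.
move/funext: E => ->.
split.
  have ms : cmeas (fun x : (R * R) * (R * R) => phi (x.2, x.1)).
    apply: (cmeas_comp (h := fun x : (R * R) * (R * R) => (x.2, x.1)) _ mphi).
    by apply/measurable_fun_pair; [exact: measurable_snd|exact: measurable_fst].
  apply: (JJ_iter_integrable ms (M := M2 * M1 * \int[lp]_u H u)).
  by move=> x y /=; rewrite mulrAC.
rewrite (_ : (fun u => (h u)^*%C * twisted f g u) = fun u => c4 R * Cintegral lq (fun z => F (z, u))); last first.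
  apply/funext => u; rewrite twistedE// mulrCA; congr (_ * _).
  rewrite -CintegralZ; last exact: tker_integrable.
  by apply: eq_Cintegral => z; rewrite /F /tker/=; ring.
have h1 := @Cfubini2 _ _ _ _ R lq lp _ _ iG iH G0 H0 F mF FGH.
have h2 := @Cfubini1 _ _ _ _ R lq lp _ _ iG iH G0 H0 F mF FGH.
rewrite CintegralZ; last first.
  have mF' : cmeas (fun x : (R * R) * ((R * R) * (R * R)) => F (x.2, x.1)).
    apply: (cmeas_comp (h := fun x : (R * R) * ((R * R) * (R * R)) => (x.2, x.1)) _ mF).
    by apply/measurable_fun_pair; [exact: measurable_snd|exact: measurable_fst].
  apply: (@Cfubini_integrable _ _ _ _ R lp lq _ _ iH iG H0 G0 _ mF').
  by move=> u z; rewrite mulrC; exact: FGH.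
congr (_ * _); rewrite h1 -h2.
by rewrite -[LHS](JJ2 mphi phiJ).
Qed.

End triple.

(** The factor k_al(v). Together with the label sqrt 2 [zc v] - al it describes on coherent states
    the reflection that sends psi to exp(i (sqrt 2 v_2 x - v_1 v_2)) psi(sqrt 2 v_1 - x); note that
    2 s is sqrt 2. *)
Definition kap al (v : R * R) : R[i] :=
  cexp (2 * s * al * (v.1)%:C%C - (v.1)%:C%C ^+ 2 - i * (v.1)%:C%C * (v.2)%:C%C).

Definition zc (v : R * R) : R[i] := (v.1)%:C%C + i * (v.2)%:C%C.

(** The phase is affine in u, so this is a Gaussian integral in each coordinate. Completing the
    squares reflects the first label and leaves the second one alone. *)
Lemma phase_wave al be v w :
  Cintegrable lp (fun u => (wave al be u)^*%C * expi (phase u v w)) /\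
  Cintegral lp (fun u => (wave al be u)^*%C * expi (phase u v w)) =
  (2 * pi)%:C%C * (kap al v * wave (2 * s * zc v - al) be w)^*%C.
Proof.
pose A := (al + be) * s + i * (w.2 - v.2)%:C%C.
pose B := - i * ((al - be) * s) + i * (v.1 - w.1)%:C%C.
pose K := cexp ((al - be) ^+ 2 / 4) * expi (- symp v w).
have E u : (wave al be u)^*%C * expi (phase u v w) = (K * (coh A u.1 * coh B u.2))^*%C.
  have -> : expi (phase u v w) = (expi (- symp v w) * expi ((w.2 - v.2) * u.1) *
      expi ((v.1 - w.1) * u.2))^*%C.
    rewrite -!expiD expi_conj; congr expi; rewrite /phase /symp; ring.
  rewrite -(conjM (wave al be u)); congr (_^*)%C.
  by rewrite -!coh_expi /wave /coh2 /K; ring.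
have [ip ep] := Cintegral_prod (@Cintegrable_coh R A) (@Cintegrable_coh R B).
have iK : Cintegrable lp (fun u => K * (coh A u.1 * coh B u.2)) by exact: CintegrableZ.
split.
  rewrite (_ : (fun u => _) = fun u => (K * (coh A u.1 * coh B u.2))^*%C).
    apply: (dominated_Cintegrable _ (Cintegrable_n1 iK)).
      exact/cmeas_conj/(Cintegrable_meas iK).
    by move=> u /=; rewrite n1_conj.
  by apply/funext => u; exact: E.
under eq_Cintegral do rewrite E.
rewrite Cintegral_conj// CintegralZ// ep !Cintegral_coh.
have -> : (2 * pi)%:C%C = ((2 * pi)%:C^*)%C :> R[i] by apply: complex_ext; rewrite /= ?oppr0.
rewrite -(conjM (2 * pi)%:C%C); congr (_^*)%C.
have -> : (2 * pi)%:C%C = (Num.sqrt (2 * pi))%:C%C * (Num.sqrt (2 * pi))%:C%C :> R[i].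
  by rewrite -(rmorphM (real_complex R))/= -expr2 sqr_sqrtr// mulr_ge0// pi_ge0.
rewrite [LHS](_ : _ = (Num.sqrt (2 * pi))%:C%C * (Num.sqrt (2 * pi))%:C%C *
  (K * (cexp (A ^+ 2 / 2) * cexp (B ^+ 2 / 2)))); last by ring.
congr (_ * _); rewrite /K /kap /wave coh2E expi_iu -!cexpD; congr cexp.
rewrite /A /B /symp /zc.
rewrite !(rmorphM (real_complex R), rmorphD (real_complex R), rmorphB (real_complex R),
  rmorphN (real_complex R), rmorphXn (real_complex R)) /= -halfC.
move: (v.1)%:C%C (v.2)%:C%C (w.1)%:C%C (w.2)%:C%C => V1 V2 W1 W2.
(* The expansions isolate the powers s^2 and i^2; once these are evaluated, the identity is
   polynomial with s and i free. *)
rewrite (_ : ((al + be) * s + i * (W2 - V2)) ^+ 2 = s ^+ 2 * (al + be) ^+ 2 +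
  2 * s * (al + be) * i * (W2 - V2) + i ^+ 2 * (W2 - V2) ^+ 2); last by ring.
rewrite (_ : (- i * ((al - be) * s) + i * (V1 - W1)) ^+ 2 = i ^+ 2 * ((V1 - W1) ^+ 2
  - 2 * s * (al - be) * (V1 - W1) + s ^+ 2 * (al - be) ^+ 2)); last by ring.
rewrite (_ : (2 * s * (V1 + i * V2) - al - be) ^+ 2 = s ^+ 2 * (4 * (V1 ^+ 2 + 2 * i * V1 * V2
  + i ^+ 2 * V2 ^+ 2)) - 4 * s * (V1 + i * V2) * (al + be) + (al + be) ^+ 2); last by ring.
rewrite (_ : (2 * s * (V1 + i * V2) - al + be) * s * W1 = s ^+ 2 * (2 * (V1 + i * V2) * W1)
  - (al - be) * s * W1); last by ring.
rewrite (_ : - i * ((2 * s * (V1 + i * V2) - al - be) * s) * W2 =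
  - s ^+ 2 * (2 * (i * V1 + i ^+ 2 * V2) * W2) + i * (al + be) * s * W2); last by ring.
rewrite !isq2_sqr !iu_sqr; move: s i => S J; by field.
Qed.

Lemma ecoh_inner_zc al al' v : (kap al v)^*%C * kap al' v *
    inner (ecoh (2 * s * zc v - al)) (ecoh (2 * s * zc v - al')) = inner (ecoh al) (ecoh al').
Proof.
rewrite !ecoh_inner /kap cexp_conj -!cexpD mulrCA -cexpD; congr (_ * cexp _).
have cr (x : R) : (x%:C%C^*)%C = x%:C%C :> R[i] by apply: complex_ext; rewrite /= ?oppr0.
rewrite /zc !(conjM, conjX, conjD, conjN, conjB, conjV, conj_nat, iu_conj, isq2_conj, cr).
move: (v.1)%:C%C (v.2)%:C%C (al^*)%C => V1 V2 A.
rewrite (_ : (_ - A + _) ^+ 2 = 16 * s ^+ 2 * V1 ^+ 2 - 8 * s * V1 * (A + al') + (A + al') ^+ 2);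
  last by ring.
by rewrite isq2_sqr; move: s i => S J; field.
Qed.

Definition gam v (p : R[i] * R[i]) : L2R2 R :=
  kap p.1 v *: ewave (2 * s * zc v - p.1, p.2).

Lemma gam_inner v p q : inner (gam v p) (gam v q) = inner (ewave p) (ewave q).
Proof.
rewrite /gam innerZl innerZr !ewave_inner/= -(ecoh_inner_zc p.1 q.1 v).
by rewrite mulrA mulrA.
Qed.

Lemma inner_wave_twisted p f g : S2 f -> S2 g ->
  Cintegrable lp (fun v => f v * inner (gam v p) (toL2 (mu2 R) g)) /\
  inner (ewave p) (toL2 (mu2 R) (twisted f g)) =
  (2^-1 / pi)%:C%C * Cintegral lp (fun v => f v * inner (gam v p) (toL2 (mu2 R) g)).
Proof.
move=> Sf Sg; have gL := schwartz_L2 Sg; have pi0 : (pi : R) != 0 by rewrite gt_eqF// pi_gt0.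
have [it et] := twisted_pair (schwartz_wave p.1 p.2) Sf Sg.
(* The constant is 2 pi from [phase_wave] times 4 pi from the normalized inner product. Multiplied
   later by 1 / (4 pi^2) and 1 / (4 pi), it leaves 1 / (2 pi). *)
have E v : f v * Cintegral lp (fun w => g w *
    Cintegral lp (fun u => (wave p.1 p.2 u)^*%C * expi (phase u v w))) =
    (8 * pi ^+ 2)%:C%C * (f v * inner (gam v p) (toL2 (mu2 R) g)).
  rewrite mulrCA; congr (_ * _); rewrite /gam innerZl inner_cls2//; last exact/schwartz_L2/schwartz_wave.
  have -> : (fun w => g w * Cintegral lp (fun u => (wave p.1 p.2 u)^*%C * expi (phase u v w))) =
     (fun w => ((2 * pi)%:C%C * (kap p.1 v)^*%C) * ((wave (2 * s * zc v - p.1) p.2 w)^*%C * g w)).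
    apply/funext => w; have [_ ->] := phase_wave p.1 p.2 v w.
    by rewrite (conjM (kap _ _)); ring.
  rewrite CintegralZ; last exact: mu2_conjM (schwartz_L2 (schwartz_wave _ _)) gL.
  rewrite [RHS]mulrCA mulrA [RHS]mulrA [_ * (kap _ _)^*%C]mulrC; congr (_ * _).
  rewrite -[RHS]mulrA; congr (_ * _).
  rewrite -(rmorphM (real_complex R))/=; congr (_%:C)%C.
  by move: (pi : R) pi0 => p' p0; field; rewrite ?p0.
rewrite (funext E) in it et.
have e8 : (8 * pi ^+ 2)%:C%C != 0 :> R[i].
  by rewrite eq_complex/= eqxx andbT mulf_neq0// expf_neq0.
have it' : Cintegrable lp (fun v => f v * inner (gam v p) (toL2 (mu2 R) g)).
  have := CintegrableZ (8 * pi ^+ 2)%:C%C^-1 it.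
  by congr (Cintegrable _ _); apply/funext => v; rewrite mulKf.
split=> //; rewrite (inner_cls2 (schwartz_L2 (schwartz_wave _ _))
  (schwartz_L2 (schwartz_twisted Sf Sg))).
rewrite et CintegralZ// /c4 !mulrA -!(rmorphM (real_complex R))/=; congr (_%:C%C * _).
by move: (pi : R) pi0 => p' p0; field; rewrite ?p0.
Qed.

(** By duality it suffices to test on combinations of waves; for each v the transformed combination
    has the same norm. The constant is thus governed by the integral of [n1 (f v)], with a factor 2
    from [n1_inner_le]. *)
Lemma twisted_norm_bound f : S2 f -> exists2 C, 0 <= C &
  forall g, S2 g -> rn (toL2 (mu2 R) (twisted f g)) <= C * rn (toL2 (mu2 R) g).
Proof.
move=> Sf; have fi := rapid_integrable (rapid_schwartz Sf).
pose K := n1 ((2^-1 / pi)%:C%C : R[i]).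
pose I := \int[lp]_v n1 (f v).
have K0 : 0 <= K := n1_ge0 _.
have I0 : 0 <= I by apply: Rintegral_ge0 => v _; exact: n1_ge0.
exists (K * (I * 2)); first by rewrite !mulr_ge0.
move=> g Sg; pose y := toL2 (mu2 R) g.
apply: (total_bound (@L2_complete _ _ R (mu2 R)) (@ewave_total R)).
  by rewrite !mulr_ge0 ?rn_ge0.
move=> l; have Ig p : Cintegrable lp (fun v => f v * inner (gam v p) y).
  by have [] := inner_wave_twisted p Sf Sg.
have Il : Cintegrable lp (fun v => f v * inner (lincomb (gam v) l) y) /\
    inner (lincomb (@ewave R) l) (toL2 (mu2 R) (twisted f g)) =
    (2^-1 / pi)%:C%C * Cintegral lp (fun v => f v * inner (lincomb (gam v) l) y).
  have E v : f v * inner (lincomb (gam v) l) y =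
      \sum_(p <- l) (p.1^*)%C * (f v * inner (gam v p.2) y).
    by rewrite inner_lincombl mulr_sumr; apply: eq_bigr => p _; rewrite mulrCA.
  rewrite (funext E); split.
    by apply: (@Cintegrable_sum _ _ _ lp _ l (fun p v => (p.1^*)%C * (f v * inner (gam v p.2) y))) => p;
      exact: CintegrableZ.
  rewrite (@Cintegral_sum _ _ _ lp _ l (fun p v => (p.1^*)%C * (f v * inner (gam v p.2) y))); last first.
    by move=> p; exact: CintegrableZ.
  rewrite inner_lincombl mulr_sumr; apply: eq_bigr => p _.
  by rewrite CintegralZ//; have [_ ->] := inner_wave_twisted p.2 Sf Sg; rewrite mulrCA.
have [il ->] := Il.
have gl v : rn (lincomb (gam v) l) = rn (lincomb (@ewave R) l).
  apply/eqP; rewrite -(@eqrXn2 _ 2) ?rn_ge0//; apply/eqP.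
  suff : inner (lincomb (gam v) l) (lincomb (gam v) l) =
      inner (lincomb (@ewave R) l) (lincomb (@ewave R) l) by rewrite !rn_sqr => -[].
  rewrite !inner_lincombl; apply: eq_bigr => p _; rewrite !inner_lincombr.
  by congr (_ * _); apply: eq_bigr => q _; rewrite gam_inner.
apply: le_trans (n1M _ _) _; rewrite -!mulrA ler_wpM2l//.
apply: (@le_trans _ _ (\int[lp]_v (2 * (rn (lincomb (@ewave R) l) * rn y) * n1 (f v)))).
  apply: n1_Cintegral_le; first exact: Cintegrable_meas il.
    exact: (integrableZl measurableT _ (Cintegrable_n1 fi)).
  move=> v; apply: le_trans (n1M _ _) _; rewrite mulrC ler_wpM2r ?n1_ge0//.
  by rewrite -(gl v); exact: n1_inner_le.
rewrite RintegralZl//; last exact: Cintegrable_n1 fi.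
by rewrite -/I le_eqVlt; apply/orP; left; apply/eqP; ring.
Qed.

End phase_transform.

(** * Extension of bounded linear maps *)

Section linear_extension.
Variables (R : realType) (U V : preHilbertType R) (X : Type).
Variables (D : set X) (i : X -> U) (A : X -> V) (C : R) (comb : R[i] -> X -> X -> X).
Hypotheses (cV : completes V) (C0 : 0 <= C).
Hypothesis combD : forall a g g', D g -> D g' -> D (comb a g g').
Hypothesis icomb : forall a g g', D g -> D g' -> i (comb a g g') = a *: i g + i g'.
Hypothesis Acomb : forall a g g', D g -> D g' -> A (comb a g g') = a *: A g + A g'.
Hypothesis AC : forall g, D g -> rn (A g) <= C * rn (i g).
Hypothesis iD : forall x, closure (i @` D) x.

Local Notation E := (ext_cont D i A).

Let near_ext x g : D g -> rn (A g - E x) <= C * rn (i g - x).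
Proof.
move=> Dg; apply: ext_contP => // h h' Dh Dh'.
have := AC (combD (-1) Dh' Dh); rewrite icomb// Acomb// !scaleN1r.
by rewrite addrC (addrC (- i h')).
Qed.

Lemma ext_linE g : D g -> E (i g) = A g.
Proof.
move=> Dg; apply/esym/subr0_eq/rn_eq0/eqP; rewrite eq_le rn_ge0 andbT.
by have := near_ext (i g) Dg; rewrite subrr rn0 mulr0.
Qed.

Let small (r K : R) : 0 <= r -> 0 <= K -> (forall e : R, 0 < e -> r <= K * e) -> r = 0.
Proof.
move=> r0 K0 h; apply/eqP; rewrite eq_le r0 andbT; apply/ler_addgt0Pl => e e0.
have K1 : 0 < K + 1 by rewrite ltr_wpDl.
have := h (e / (K + 1)) (divr_gt0 e0 K1); move=> /le_trans; rewrite addr0; apply.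
by rewrite mulrA ler_pdivrMr// mulrC ler_pM2l// lerDl.
Qed.

(** X carries no linear structure of its own: [comb] supplies combinations inside D, on which i and
    A are linear. Three approximations, of x, of y and of the combination, then bound the defect by
    a multiple of e. *)
Lemma ext_lin (a : R[i]) x y : E (a *: x + y) = a *: E x + E y.
Proof.
apply/subr0_eq/rn_eq0; have n0 := n1_ge0 a.
apply: (@small _ (C * ((n1 a + 1) * 2))); [exact: rn_ge0| |].
  by rewrite !mulr_ge0 ?addr_ge0.
move=> e e0.
have [_ [g Dg <-] gx] := (closureP _ _).1 (@iD x) e e0.
have [_ [g' Dg' <-] gy] := (closureP _ _).1 (@iD y) e e0.
have h1 := near_ext x Dg; have h2 := near_ext y Dg'.
have h3 := near_ext (a *: x + y) (combD a Dg Dg').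
rewrite icomb// Acomb// in h3.
have e1 : a *: i g + i g' - (a *: x + y) = a *: (i g - x) + (i g' - y).
  by rewrite scalerBr opprD addrACA.
rewrite e1 in h3.
rewrite (_ : E _ - _ = (a *: (A g - E x) + (A g' - E y)) - (a *: A g + A g' - E (a *: x + y)));
  last by rewrite scalerBr addrACA -opprD; exact: subr_split.
apply: le_trans (rnD _ _) _; rewrite rnN.
have k1 := rnD (a *: (A g - E x)) (A g' - E y).
have k2 := rnZ_le a (A g - E x).
have k3 := rnD (a *: (i g - x)) (i g' - y).
have k4 := rnZ_le a (i g - x).
move: h1 h2 h3 k1 k2 k3 k4 gx gy.
move: (rn (A g - E x)) (rn (A g' - E y)) (rn (a *: A g + A g' - E (a *: x + y))).
move: (rn (a *: (A g - E x) + (A g' - E y))) (rn (a *: (A g - E x))) (rn (a *: (i g - x))).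
move: (rn (a *: (i g - x) + (i g' - y))) (rn (i g - x)) (rn (i g' - y)).
move=> r p q S T t P Q Z h1 h2 h3 k1 k2 k3 k4 gx gy.
have m1 : n1 a * P <= n1 a * (C * p) by rewrite ler_wpM2l.
have m2 : n1 a * (C * p) <= n1 a * (C * e) by rewrite !ler_wpM2l// ltW.
have m3 : C * q <= C * e by rewrite ler_wpM2l// ltW.
have m4 : n1 a * p <= n1 a * e by rewrite ler_wpM2l// ltW.
have m5 : C * r <= C * (n1 a * e + e) by rewrite ler_wpM2l//; lra.
nra.
Qed.

Lemma ext_bound x : rn (E x) <= C * rn x.
Proof.
apply/ler_addgt0Pl => e e0.
have K0 : 0 < 2 * (C + 1) by rewrite mulr_gt0// ltr_wpDl.
have [_ [g Dg <-] gx] := (closureP _ _).1 (@iD x) _ (divr_gt0 e0 K0).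
have h1 := near_ext x Dg; have h2 := AC Dg.
have h3 := rnD (A g) (E x - A g); rewrite addrC subrK rnB in h3.
have h4 := rnD (i g - x) x; rewrite subrK in h4.
move: h1 h2 h3 h4 gx; rewrite ltr_pdivlMr//.
have := rn_ge0 (i g - x).
move: (rn (A g - E x)) (rn (i g - x)) (rn (A g)) (rn (E x)) (rn (i g)) (rn x).
move=> a b c d f g' b0 h1 h2 h3 h4 h5.
have : C * f <= C * (b + g') by rewrite ler_wpM2l.
nra.
Qed.

End linear_extension.

(** * Tensor products and the operator P *)

Section tensor_theory.
Variable R : realType.
Implicit Types a b : R[i].
Local Notation mu1 := (mu1 R).
Local Notation mu2 := (mu2 R).
Local Notation cls1 := (@toL2 _ _ R mu1).
Local Notation cls2 := (@toL2 _ _ R mu2).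
Local Notation cL1 := (@L2_complete _ _ R mu1).
Local Notation cL2 := (@L2_complete _ _ R mu2).
Local Notation eten := (@eten R).
Local Notation ecoh := (@ecoh R).
Implicit Types phi psi : L2R R.

Lemma tensor_inner phi psi phi' psi' :
  inner (tensor phi psi) (tensor phi' psi') = inner phi phi' * inner psi psi'.
Proof.
have [_] := inner_prod (ofL2_in phi) (ofL2_in psi) (ofL2_in phi') (ofL2_in psi').
by rewrite !toL2_of.
Qed.

Lemma rn_eq0_inner (V : preHilbertType R) (x : V) : inner x x = 0 -> x = 0.
Proof.
by move=> h; apply: rn_eq0; move: h; rewrite rn_sqr => -[] /eqP; rewrite sqrf_eq0 => /eqP.
Qed.

Lemma tensor_cls (f g : R -> R[i]) : f \in L2fun mu1 -> g \in L2fun mu1 ->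
  tensor (cls1 f) (cls1 g) = cls2 (fun u => f u.1 * g u.2).
Proof.
move=> fL gL; apply/subr0_eq/rn_eq0_inner; rewrite innerBl !innerBr.
have o1 := ofL2_in (cls1 f); have o2 := ofL2_in (cls1 g).
have [_ ->] := inner_prod o1 o2 o1 o2.
have [_ ->] := inner_prod o1 o2 fL gL.
have [_ ->] := inner_prod fL gL o1 o2.
have [_ ->] := inner_prod fL gL fL gL.
by rewrite !toL2_of !subrr.
Qed.

Lemma eten_tensor p : eten p = tensor (ecoh p.1) (ecoh p.2).
Proof. by rewrite /ecoh tensor_cls//; exact: coh_L2. Qed.

(** Representatives of a combination agree only almost everywhere; pairing with the total family
    [eten] avoids handling null sets in the plane. *)
Lemma tensor_linl a phi phi' psi :
  tensor (a *: phi + phi') psi = a *: tensor phi psi + tensor phi' psi.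
Proof.
apply/subr0_eq/(@eten_total R) => p.
rewrite eten_tensor innerBr innerDr innerZr !tensor_inner innerDr innerZr.
by rewrite mulrDl -mulrA subrr.
Qed.

Lemma tensor_linr a phi psi psi' :
  tensor phi (a *: psi + psi') = a *: tensor phi psi + tensor phi psi'.
Proof.
apply/subr0_eq/(@eten_total R) => p.
rewrite eten_tensor innerBr innerDr innerZr !tensor_inner innerDr innerZr.
by rewrite mulrDr mulrCA subrr.
Qed.

Lemma tensorZl a phi psi : tensor (a *: phi) psi = a *: tensor phi psi.
Proof. by apply: (linZ (A := fun x => tensor x psi)) => b x y; exact: tensor_linl. Qed.

Lemma tensorZr a phi psi : tensor phi (a *: psi) = a *: tensor phi psi.
Proof. by apply: linZ => b x y; exact: tensor_linr. Qed.

Lemma rn_tensor phi psi : rn (tensor phi psi) = rn phi * rn psi.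
Proof.
apply/eqP; rewrite -(@eqrXn2 _ 2) ?mulr_ge0 ?rn_ge0//; apply/eqP.
have := tensor_inner phi psi phi psi; rewrite !rn_sqr -(rmorphM (real_complex R))/=.
by move=> [->]; rewrite exprMn.
Qed.

(** If h is orthogonal to all coherent states, then h (x) h is orthogonal to all [eten], so its norm
    |h|^2 is zero. *)
Lemma ecoh_total : total_family ecoh.
Proof.
move=> h hh; apply/rn_eq0.
have : tensor h h = 0.
  by apply: eten_total => p; rewrite eten_tensor tensor_inner !hh mul0r.
move=> /(congr1 (@rn R _)); rewrite rn_tensor rn0 => /eqP.
by rewrite mulf_eq0 orbb => /eqP.
Qed.

Definition e0 : L2R R := cls1 (@h0 R).

Lemma e0E : e0 = (Num.sqrt 2)%:C%C *: ecoh 0.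
Proof. by rewrite /e0 h0E toL2_scale// coh_L2. Qed.

Lemma ecoh_norm0 : inner (ecoh 0) (ecoh 0) = 2^-1.
Proof.
rewrite ecoh_inner; have -> : (0 : R[i])^*%C + 0 = 0.
  by apply: complex_ext; rewrite /= ?oppr0 addr0.
by rewrite expr0n mul0r cexp0 mulr1.
Qed.

Lemma sqrt2_conjM : ((Num.sqrt 2)%:C^*)%C * (Num.sqrt 2)%:C%C = 2 :> R[i].
Proof.
have -> : ((Num.sqrt 2)%:C^*)%C = (Num.sqrt 2)%:C%C :> R[i].
  by apply: complex_ext; rewrite /= ?oppr0.
by rewrite -(rmorphM (real_complex R))/= -expr2 sqr_sqrtr// rmorph_nat.
Qed.

Lemma e0_norm : inner e0 e0 = 1.
Proof.
by rewrite e0E innerZl innerZr mulrA sqrt2_conjM ecoh_norm0 divff// pnatr_eq0.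
Qed.

Lemma rn_e0 : rn e0 = 1.
Proof.
apply/eqP; rewrite -(@eqrXn2 _ 2) ?rn_ge0//; apply/eqP.
by have := e0_norm; rewrite rn_sqr expr1n => -[].
Qed.

Lemma eten_dense x (d : R) : 0 < d -> exists2 m, range (lincomb eten) m & rn (m - x) < d.
Proof.
move=> d0; have [l hl] := total_dense cL2 (@eten_total R) x d0.
by exists (lincomb eten l) => //; exists l.
Qed.

Lemma lincomb_lin (U V : lmodType R[i]) (I : Type) (e : I -> U) (A : U -> V) l :
  linear A -> A (lincomb e l) = lincomb (A \o e) l.
Proof.
move=> Al; rewrite /lincomb; elim: l => [|p l IH]; first by rewrite !big_nil (lin0 Al).
by rewrite !big_cons Al IH.
Qed.

(** Combinations of elementary tensors are dense. This uniqueness is what makes the operators chosen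
    by [get] computable. *)
Lemma bounded_op_eq (V : preHilbertType R) (A B : L2R2 R -> V) :
  bounded_op A -> bounded_op B -> (forall phi psi, A (tensor phi psi) = B (tensor phi psi)) ->
  A = B.
Proof.
move=> [Al Ac] [Bl Bc] AB; apply: (continuous_dense_eq Ac Bc eten_dense).
move=> _ [l _ <-]; rewrite (lincomb_lin _ _ Al) (lincomb_lin _ _ Bl).
by congr lincomb; apply/funext => p /=; rewrite eten_tensor AB.
Qed.

(** The adjoint of the isometry phi -> phi (x) h_0 exists, is bounded and has the defining property
    of P; by uniqueness it is the operator chosen by [get]. *)
Lemma Pop_adj F psi : inner psi (Pop F) = inner (tensor psi e0) F.
Proof.
have Ji x y : inner (tensor x e0) (tensor y e0) = inner x y.
  by rewrite tensor_inner e0_norm mulr1.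
have /choice[P PE] := fun F => @adjoint_ex R _ _ (fun phi => tensor phi e0) cL1
  (fun a x y => tensor_linl a x y e0) Ji F.
have Pl : linear P.
  move=> a x y; apply: inner_ext => z.
  by rewrite PE !(innerDr, innerZr) !PE.
have Pb x : rn (P x) <= 1 * rn x.
  rewrite mul1r; have := Re_inner_le (tensor (P x) e0) x.
  rewrite -PE rn_sqr/= rn_tensor rn_e0 mulr1 expr2; have := rn_ge0 (P x); rewrite le_eqVlt => /orP[/eqP <- _|p0].
    exact: rn_ge0.
  by rewrite ler_pM2l.
have PT : bounded_op P /\ forall phi psi, P (tensor phi psi) = inner (cls1 (@h0 R)) psi *: phi.
  split; first by split=> //; exact: bounded_continuous Pl Pb.
  move=> phi psi'; apply: inner_ext => z.
  by rewrite PE tensor_inner innerZr mulrC.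
have [Pb' PT'] := getPex (ex_intro [set T | bounded_op T /\
  forall phi psi, T (tensor phi psi) = inner (cls1 (@h0 R)) psi *: phi] P PT).
rewrite -PE; congr (inner _ (_ F)); rewrite /Pop.
by apply: bounded_op_eq => //; [case: PT|move=> phi psi'; rewrite PT'; case: PT => _ ->].
Qed.

Lemma Pop_lin a x y : Pop (a *: x + y) = a *: Pop x + Pop y :> L2R R.
Proof.
by apply: inner_ext => z; rewrite !(innerDr, innerZr) !Pop_adj !(innerDr, innerZr).
Qed.

Lemma Pop_bound x : rn (Pop x : L2R R) <= rn x.
Proof.
have := Re_inner_le (tensor (Pop x) e0) x.
rewrite -Pop_adj rn_sqr/= rn_tensor rn_e0 mulr1 expr2.
have := rn_ge0 (Pop x : L2R R); rewrite le_eqVlt => /orP[/eqP <- _|p0].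
  exact: rn_ge0.
by rewrite ler_pM2l.
Qed.

Lemma Pop_tensor phi psi : Pop (tensor phi psi) = inner e0 psi *: phi.
Proof. by apply: inner_ext => z; rewrite Pop_adj tensor_inner innerZr mulrC. Qed.

End tensor_theory.

(** * Factorization of the left regular representation *)

Section left_multiplication.
Variable R : realType.
Local Notation lp := (@lebp R).
Local Notation S2 := (schwartz R).
Local Notation cls2 := (@toL2 _ _ R (mu2 R)).
Local Notation cL1 := (@L2_complete _ _ R (mu1 R)).
Local Notation cL2 := (@L2_complete _ _ R (mu2 R)).
Local Notation ewave := (@ewave R).
Local Notation eten := (@eten R).
Local Notation ecoh := (@ecoh R).
Local Notation W := (@W R).
Local Notation Winv := (@Winv R).
Local Notation e0 := (e0 R).

Definition comb (a : R[i]) (g g' : R * R -> R[i]) (u : R * R) : R[i] := a * g u + g' u.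

Lemma schwartz_comb a g g' : S2 g -> S2 g' -> S2 (comb a g g').
Proof. by move=> Sg Sg'; apply: schwartzD => //; exact: schwartzZ. Qed.

Lemma cls2_comb a g g' : S2 g -> S2 g' -> cls2 (comb a g g') = a *: cls2 g + cls2 g'.
Proof. by move=> Sg Sg'; rewrite -toL2_lin//; exact: schwartz_L2. Qed.

Lemma twisted_combr f a g g' : S2 f -> S2 g -> S2 g' ->
  twisted f (comb a g g') = comb a (twisted f g) (twisted f g').
Proof.
move=> Sf Sg Sg'; apply/funext => u.
have rf := rapid_schwartz Sf; have rg := rapid_schwartz Sg; have rg' := rapid_schwartz Sg'.
have rc := rapid_schwartz (schwartz_comb a Sg Sg').
rewrite /comb !twistedE//.
have i1 := tker_integrable u rf rg; have i2 := tker_integrable u rf rg'.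
rewrite mulrCA -mulrDr -(CintegralZ a i1) -(CintegralDf (CintegrableZ a i1) i2).
by congr (_ * _); apply: eq_Cintegral => z; rewrite /tker /comb; ring.
Qed.

Section fixed.
Variables (f : R * R -> R[i]) (Sf : S2 f).

Let C := s2val (cid2 (twisted_norm_bound Sf)).
Let C0 : 0 <= C. Proof. exact: (s2valP (cid2 (twisted_norm_bound Sf))). Qed.
Let fC g : S2 g -> rn (cls2 (twisted f g)) <= C * rn (cls2 g).
Proof. exact: (s2valP' (cid2 (twisted_norm_bound Sf))). Qed.

Let Acomb a g g' : S2 g -> S2 g' ->
  cls2 (twisted f (comb a g g')) = a *: cls2 (twisted f g) + cls2 (twisted f g').
Proof.
by move=> Sg Sg'; rewrite twisted_combr// cls2_comb//; exact: schwartz_twisted.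
Qed.

Lemma lreg_cls g : S2 g -> lreg f (cls2 g) = cls2 (twisted f g).
Proof.
exact: (ext_linE cL2 C0 schwartz_comb cls2_comb Acomb fC (@schwartz_dense R)).
Qed.

Lemma lreg_lin a x y : lreg f (a *: x + y) = a *: lreg f x + lreg f y.
Proof.
exact: (ext_lin cL2 C0 schwartz_comb cls2_comb Acomb fC (@schwartz_dense R)).
Qed.

Lemma lreg_bound : exists2 K, 0 <= K & forall x, rn (lreg f x) <= K * rn x.
Proof.
exists C => // x.
exact: (ext_bound cL2 C0 schwartz_comb cls2_comb Acomb fC (@schwartz_dense R)).
Qed.

#[local] Opaque Defs.W Defs.Winv Defs.lreg Defs.tensor.

Definition wop x := W (lreg f (Winv x)).

Lemma Winv_lin a x y : Winv (a *: x + y) = a *: Winv x + Winv y.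
Proof. by apply: (iso_lin (P := setT)) => // x' y' _ _; exact: Winv_inner. Qed.

Lemma W_lin a x y : W (a *: x + y) = a *: W x + W y.
Proof. by apply: (iso_lin (P := setT)) => // x' y' _ _; exact: W_inner. Qed.

Lemma rn_W x : rn (W x) = rn x.
Proof. by apply: (iso_rn (P := setT)) => // x' y' _ _; exact: W_inner. Qed.

Lemma rn_Winv x : rn (Winv x) = rn x.
Proof. by apply: (iso_rn (P := setT)) => // x' y' _ _; exact: Winv_inner. Qed.

Lemma wop_lin a x y : wop (a *: x + y) = a *: wop x + wop y.
Proof. by rewrite /wop Winv_lin lreg_lin W_lin. Qed.

Lemma wop_bound : exists2 K, 0 <= K & forall x, rn (wop x) <= K * rn x.
Proof.
have [K K0 hK] := lreg_bound; exists K; first exact: K0.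
by move=> x; rewrite /wop rn_W; have := hK (Winv x); rewrite rn_Winv.
Qed.

Lemma wop_factor : exists m : R[i] -> R[i] -> R[i], forall p q,
  inner (eten q) (wop (eten p)) = m q.1 p.1 * inner (ecoh q.2) (ecoh p.2).
Proof.
pose X q1 p1 v := f v * ((kap q1 v)^*%C * inner (ecoh (2 * isq2 R * zc v - q1)) (ecoh p1)).
exists (fun q1 p1 => (2^-1 / pi)%:C%C * Cintegral lp (X q1 p1)) => p q.
have gE (p' q' : R[i] * R[i]) v :
    f v * inner (gam v q') (ewave p') = X q'.1 p'.1 v * inner (ecoh q'.2) (ecoh p'.2).
  by rewrite /gam innerZl ewave_inner /X !mulrA.
(* Integrability is read off from the pairing with second labels 0, where the second factor is the
   nonzero constant 1/2. *)
have iX : Cintegrable lp (X q.1 p.1).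
  have [i1 _] := inner_wave_twisted (q.1, 0) Sf (schwartz_wave p.1 0).
  have := CintegrableZ 2 i1; congr (Cintegrable _ _); apply/funext => v.
  by rewrite -[toL2 _ _]/(ewave (p.1, 0)) gE/= ecoh_norm0 mulrCA divff ?mulr1.
rewrite /wop Winv_eten -W_wave W_inner.
rewrite lreg_cls; last exact: schwartz_wave.
have [_ ->] := inner_wave_twisted q Sf (schwartz_wave p.1 p.2).
rewrite -[toL2 _ _]/(ewave p).
under eq_Cintegral do rewrite gE.
by rewrite CintegralZr// mulrA.
Qed.

(** The operator A on the first factor, recovered by feeding h_0 into the second factor and
    projecting it away. *)
Definition schop (phi : L2R R) : L2R R := Pop (wop (tensor phi e0)).

Lemma schop_lin a x y : schop (a *: x + y) = a *: schop x + schop y.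
Proof. by rewrite /schop tensor_linl wop_lin Pop_lin. Qed.

Lemma schop_bound : exists2 K, 0 <= K & forall x, rn (schop x) <= K * rn x.
Proof.
have [K K0 hK] := wop_bound; exists K; first exact: K0.
move=> x.
by apply: le_trans (Pop_bound _) _; apply: le_trans (hK _) _; rewrite rn_tensor rn_e0 mulr1.
Qed.

(** Equality holds on pairs of coherent states by comparison of matrix coefficients; it then extends
    by density to the first factor, and afterwards to the second. *)
Lemma wop_tensor phi psi : wop (tensor phi psi) = tensor (schop phi) psi.
Proof.
have [m mE] := wop_factor.
have coh_case a b : wop (tensor (ecoh a) (ecoh b)) = tensor (schop (ecoh a)) (ecoh b).
  apply/subr0_eq; apply: eten_total => q; rewrite innerBr; apply/eqP; rewrite subr_eq0; apply/eqP.
  have := mE (a, b) q; rewrite [eten (a, b)]eten_tensor => ->.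
  rewrite (eten_tensor q) tensor_inner; congr (_ * _).
  (* The coefficient m is evaluated at second labels 0. As h_0 = sqrt 2 e_0, the factor 2 that
     appears compensates (e_0 | e_0) = 1/2. *)
  rewrite /schop Pop_adj e0E !tensorZr.
  rewrite (linZ _ _ wop_lin) innerZl innerZr mulrA sqrt2_conjM.
  have := mE (a, 0) (q.1, 0); rewrite !eten_tensor/= => ->.
  by rewrite ecoh_norm0 mulrCA divff ?mulr1// pnatr_eq0.
have [K K0 hK] := wop_bound; have [K' K'0 hK'] := schop_bound.
have step b phi' : wop (tensor phi' (ecoh b)) = tensor (schop phi') (ecoh b).
  pose M := Num.max (K * rn (ecoh b)) (K' * rn (ecoh b)).
  apply: (total_op_eq (C := M) cL1 (@ecoh_total R)
    (A := fun x => wop (tensor x (ecoh b))) (B := fun x => tensor (schop x) (ecoh b))).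
  - by move=> a x y; rewrite tensor_linl wop_lin.
  - by move=> a x y; rewrite schop_lin tensor_linl.
  - move=> x; apply: le_trans (hK _) _; rewrite rn_tensor mulrCA mulrC.
    by rewrite ler_wpM2r ?rn_ge0// le_max lexx.
  - move=> x; rewrite rn_tensor; apply: (@le_trans _ _ (K' * rn x * rn (ecoh b))).
      by rewrite ler_wpM2r ?rn_ge0.
    by rewrite mulrAC ler_wpM2r ?rn_ge0// le_max lexx orbT.
  - by move=> a; exact: coh_case.
pose M := Num.max (K * rn phi) (rn (schop phi)).
apply: (total_op_eq (C := M) cL1 (@ecoh_total R)
  (A := fun x => wop (tensor phi x)) (B := fun x => tensor (schop phi) x)).
- by move=> a x y; rewrite tensor_linr wop_lin.
- by move=> a x y; rewrite tensor_linr.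
- move=> x; apply: le_trans (hK _) _; rewrite rn_tensor mulrA.
  by rewrite ler_wpM2r ?rn_ge0// le_max lexx.
- by move=> x; rewrite rn_tensor ler_wpM2r ?rn_ge0// le_max lexx orbT.
- by move=> b; exact: step.
Qed.

(** [wop] itself witnesses the property that [get] selects, and two bounded operators with this
    property coincide. *)
Lemma wop_tensor_op : wop = tensor_op schop idfun.
Proof.
have [K K0 hK] := wop_bound.
have wT : bounded_op wop /\
    forall phi psi, wop (tensor phi psi) = tensor (schop phi) (idfun psi).
  split; last exact: wop_tensor.
  by split; [exact: wop_lin|exact: bounded_continuous wop_lin hK].
have [Tb TT] := getPex (ex_intro [set T | bounded_op T /\
  forall phi psi, T (tensor phi psi) = tensor (schop phi) (idfun psi)] wop wT).
apply: bounded_op_eq => //; [by case: wT|move=> phi psi].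
by rewrite [RHS]TT wop_tensor.
Qed.

End fixed.
End left_multiplication.

Lemma hilbert_completes (R : realType) (H : hilbertType R) : completes H.
Proof.
move=> u cu.
have /cauchy_cvg ucvg : cauchy (u @ \oo).
  apply/cauchy_exP => e e0.
  have [r re] : exists r : R, e = r%:C%C.
    by have /complex_realP : e \is Num.real by rewrite gtr0_real.
  have r0 : 0 < r by rewrite re ltr0C in e0.
  have [N hN] := cu r r0; exists (u N), N => // n /= Nn.
  by rewrite -ball_normE/= rnE re ltcR hN.
exists (lim (u @ \oo)) => e e0.
have e0C : 0 < e%:C%C :> R[i] by rewrite ltr0C.
have /cvgrPdist_lt/(_ _ e0C) := ucvg.
move=> [N _ hN]; exists N => n Nn.
by have := hN n Nn; rewrite /= rnE ltcR rnB.
Qed.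

(** * The GNS representation *)

Section vacuum.
Variable R : realType.
Local Notation lp := (@lebp R).
Local Notation S2 := (schwartz R).
Local Notation mu2 := (mu2 R).
Local Notation cls2 := (@toL2 _ _ R mu2).
Local Notation cL2 := (@L2_complete _ _ R mu2).
Local Notation ewave := (@ewave R).
Local Notation ecoh := (@ecoh R).
Local Notation W := (@W R).
Local Notation Winv := (@Winv R).
Local Notation e0 := (e0 R).
Local Notation f0 := (@f0 R).

Lemma f0_wave : f0 = fun u => 2 * wave 0 0 u.
Proof.
apply/funext => u; rewrite /f0 /wave subrr expr0n mul0r cexp0 mul1r coh2E.
rewrite (rmorphM (real_complex R))/= rmorph_nat expR_cexp; congr (_ * cexp _).
by rewrite !(add0r, mul0r, mulr0, sub0r) -(rmorphN (real_complex R))/= mulNr.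
Qed.

Lemma schwartz_f0 : S2 f0.
Proof. by rewrite f0_wave; apply: schwartzZ; exact: schwartz_wave. Qed.

Lemma cls2_f0 : cls2 f0 = 2 *: ewave (0, 0).
Proof. by rewrite f0_wave toL2_scale//; exact/schwartz_L2/schwartz_wave. Qed.

Lemma f0_conj u : ((f0 u)^*)%C = f0 u.
Proof. by apply: complex_ext; rewrite /= ?oppr0. Qed.

#[local] Opaque Defs.W Defs.Winv Defs.lreg Defs.tensor Defs.Pop.

(* The operator W^-1 (1 (x) |h_0)(h_0|) W, which turns out to be the twisted
   product by [f0] on the right. *)
Definition vacop x : L2R2 R := Winv (tensor (Pop (W x)) e0).

Lemma vacop_inner x y : inner x (vacop y) = inner (Pop (W x)) (Pop (W y)).
Proof. by rewrite /vacop -W_inner WinvK inner_conj -Pop_adj -inner_conj. Qed.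

Lemma vacop_adj x y : inner (vacop x) y = inner x (vacop y).
Proof. by rewrite inner_conj !vacop_inner -inner_conj. Qed.

Lemma vacopK x : vacop (vacop x) = vacop x.
Proof. by rewrite {1}/vacop {2}/vacop WinvK Pop_tensor e0_norm scale1r. Qed.

Lemma vacop_tensor phi : vacop (Winv (tensor phi e0)) = Winv (tensor phi e0).
Proof. by rewrite /vacop WinvK Pop_tensor e0_norm scale1r. Qed.

(** In the Wigner picture the two operators act on different tensor factors; commutation is checked
    on the total family [eten]. *)
Lemma vacop_lreg f x : S2 f -> vacop (lreg f x) = lreg f (vacop x).
Proof.
move=> Sf; apply: (@W_inj R); rewrite /vacop WinvK.
have -> : W (lreg f (Winv (tensor (Pop (W x)) e0))) = tensor (schop f (Pop (W x))) e0.
  exact: (wop_tensor Sf).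
apply: (congr1 (fun t => tensor t e0)).
have -> : W (lreg f x) = wop f (W x) by rewrite /wop WK.
have [K K0 hK] := wop_bound Sf; have [K' K'0 hK'] := schop_bound Sf.
pose M := Num.max K K'.
apply: (total_op_eq (C := M) cL2 (@eten_total R)
  (A := fun y => Pop (wop f y)) (B := fun y => schop f (Pop y))).
- by move=> a y z; rewrite (wop_lin Sf) Pop_lin.
- by move=> a y z; rewrite Pop_lin (schop_lin Sf).
- move=> y; apply: le_trans (Pop_bound _) _; apply: le_trans (hK _) _.
  by rewrite ler_wpM2r ?rn_ge0// le_max lexx.
- move=> y; apply: le_trans (hK' _) _; apply: (@le_trans _ _ (K' * rn y)).
    by rewrite ler_wpM2l// Pop_bound.
  by rewrite ler_wpM2r ?rn_ge0// le_max lexx orbT.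
move=> p; rewrite eten_tensor (wop_tensor Sf) !Pop_tensor.
by rewrite (linZ _ _ (schop_lin Sf)).
Qed.

(** Up to a constant and conjugation, the left side is the matrix coefficient of the reflection at v
    between e_al and the vacuum e_0. As a function of v it is again a wave. *)
Lemma kap_vac al v : kap al v * cexp ((2 * isq2 R * zc v - al) ^+ 2 / 4) = wave al 0 v.
Proof.
rewrite /kap /wave coh2E -!cexpD; congr cexp; rewrite /zc.
rewrite !(rmorphM (real_complex R), rmorphD (real_complex R), rmorphXn (real_complex R)) /= -halfC.
move: (v.1)%:C%C (v.2)%:C%C => V1 V2.
rewrite (_ : (2 * isq2 R * (V1 + iu R * V2) - al) ^+ 2 = 4 * isq2 R ^+ 2 * (V1 ^+ 2
  + 2 * iu R * V1 * V2 + iu R ^+ 2 * V2 ^+ 2) - 4 * isq2 R * (V1 + iu R * V2) * al + al ^+ 2);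
  last by ring.
rewrite isq2_sqr iu_sqr subr0 addr0; move: (isq2 R) (iu R) => S J.
by field.
Qed.

Lemma ecoh_inner0 a : inner (ecoh a) (ecoh 0) = 2^-1 * ((cexp (a ^+ 2 / 4))^*)%C.
Proof.
rewrite ecoh_inner addr0 cexp_conj; congr (_ * cexp _).
by rewrite !(conjM, conjX, conjV, conj_nat).
Qed.

(** The pairing of G_v w_(a,b) with [f0] is the conjugate of w_(a,0)(v) times (e_b | e_0), by
    [kap_vac]. Integration against g turns it into (w_(a,0) | g) (e_b | e_0), which is what
    projection of the second factor on h_0 produces. *)
Lemma twisted_f0 g : S2 g -> cls2 (twisted g f0) = vacop (cls2 g).
Proof.
move=> Sg; apply/subr0_eq/(@ewave_total R) => p; rewrite innerBr; apply/eqP.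
rewrite subr_eq0; apply/eqP.
have pi0 : (pi : R) != 0 by rewrite gt_eqF// pi_gt0.
have [_ ->] := inner_wave_twisted p Sg schwartz_f0.
have E v : g v * inner (gam v p) (cls2 f0) =
    inner (ecoh p.2) (ecoh 0) * ((wave p.1 0 v)^*%C * g v).
  rewrite cls2_f0 innerZr /gam innerZl ewave_inner/=.
  rewrite (ecoh_inner0 (2 * isq2 R * zc v - p.1)) -(kap_vac p.1 v) (conjM (kap _ _)).
  move: ((kap p.1 v)^*)%C ((cexp _)^*)%C (inner _ _) (g v) => A B J G.
  by field.
under eq_Cintegral do rewrite E.
have wL := schwartz_L2 (schwartz_wave p.1 0); have gL := schwartz_L2 Sg.
rewrite CintegralZ; last exact: mu2_conjM wL gL.
have := inner_cls2 wL gL; set I := Cintegral _ _ => EI.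
have {EI}EI : I = (4 * pi)%:C%C * inner (ewave (p.1, 0)) (cls2 g).
  rewrite /Defs.L2 -[cls2 (wave p.1 0)]/(ewave (p.1, 0)) in EI *.
  by rewrite EI mulrA -(rmorphM (real_complex R))/= divff ?mul1r// mulf_neq0.
rewrite EI /vacop -[RHS]W_inner W_wave WinvK eten_tensor tensor_inner Pop_adj.
rewrite e0E tensorZr innerZl innerZr.
have -> : tensor (ecoh p.1) (ecoh 0) = W (ewave (p.1, 0)).
  by rewrite W_wave eten_tensor.
rewrite W_inner.
rewrite [RHS](_ : _ = (((Num.sqrt 2)%:C^*)%C * (Num.sqrt 2)%:C%C) *
  (inner (ewave (p.1, 0)) (cls2 g) * inner (ecoh p.2) (ecoh 0))); last by ring.
rewrite sqrt2_conjM mulrCA [RHS]mulrA mulrC; congr (_ * _).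
rewrite mulrA; congr (_ * _).
rewrite -(rmorphM (real_complex R))/= -(rmorph_nat (real_complex R)); congr (_%:C)%C.
by move: (pi : R) pi0 => q q0; field; rewrite ?q0.
Qed.

Lemma vacopZ (a : R[i]) x : vacop (a *: x) = a *: vacop x.
Proof.
rewrite /vacop (linZ _ _ (@W_lin R)) (linZ _ _ (@Pop_lin R)) tensorZl.
exact: (linZ _ _ (@Winv_lin R)).
Qed.

Lemma vacop_wave a : vacop (ewave (a, 0)) = ewave (a, 0).
Proof.
rewrite /vacop W_wave eten_tensor Pop_tensor tensorZl e0E tensorZr scalerA innerZl ecoh_norm0.
rewrite mulrAC sqrt2_conjM divff ?pnatr_eq0// scale1r.
by have := Winv_eten (a, 0); rewrite eten_tensor.
Qed.

Lemma vacop_f0 : vacop (cls2 f0) = cls2 f0.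
Proof.
by rewrite cls2_f0 vacopZ vacop_wave. Qed.

(** The phase is invariant under cyclic permutation of its three arguments and [f0] is real, so both
    sides are the same triple integral after Fubini. *)
Lemma triple_cyclic f g : S2 f -> S2 g ->
  inner (cls2 f0) (cls2 (twisted (fun u => (g u)^*%C) f)) = inner (cls2 g) (cls2 (twisted f f0)).
Proof.
move=> Sf Sg; have Sgc := schwartz_conj Sg; have S0 := schwartz_f0.
rewrite (inner_cls2 (schwartz_L2 S0) (schwartz_L2 (schwartz_twisted Sgc Sf))).
rewrite (inner_cls2 (schwartz_L2 Sg) (schwartz_L2 (schwartz_twisted Sf S0))).
apply: (congr1 (fun z => _ * z)).
have [i1 e1] := twisted_pair S0 Sgc Sf.
apply: (etrans e1); apply: (etrans (esym (CintegralZ _ i1))).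
apply: eq_Cintegral => v {e1 i1}.
have rf := rapid_schwartz Sf; have r0 := rapid_schwartz S0.
rewrite (twistedE v rf r0) mulrCA; apply: (congr1 (fun z => _ * (_ * z))).
have [M hM] := tker_bound rf r0.
have mt : cmeas (tker f f0 v) by apply: cmeas_tker; [case: rf|case: r0].
apply: etrans (JJ2 mt (hM v)); apply: eq_Cintegral => w.
have i0 : Cintegrable lp (fun u => (f0 u)^*%C * expi (phase u v w)).
  apply: (@dominated_Cintegrable _ _ R lp _ (fun u => 2 * n1 (f0 u))).
  - apply: cmeasM; first exact/cmeas_conj/cmeas_schwartz.
    apply: cmeas_expi.
    by apply: measurable_funD; first apply: measurable_funD; apply: measurable_symp => //;
      exact: measurable_cst.
  - exact: (integrableZl measurableT 2 (Cintegrable_n1 (rapid_integrable r0))).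
  - by move=> u; apply: le_trans (n1M _ _) _; rewrite n1_conj mulrC ler_wpM2r ?n1_ge0 ?n1_expi.
apply: (etrans (esym (CintegralZ _ i0))).
apply: eq_Cintegral => u; rewrite f0_conj /tker mulrA.
have -> : phase u v w = phase v w u by rewrite /phase /symp; ring.
exact: erefl.
Qed.

Lemma continuous_ae0 (phi : R * R -> R) : continuous phi ->
  {ae lp, forall u, phi u = 0} -> forall u, phi u = 0.
Proof.
move=> cphi [A [mA A0 hA]] u; apply: contrapT => /eqP nz.
have : \forall v \near u, phi v != 0.
  by apply: (cphi u [set y | y != 0]); apply: open_nbhs_nbhs; split=> //; exact: open_neq.
move=> /nbhs_ballP[e /= ep he].
pose B1 := [set` `]u.1 - e, u.1 + e[]; pose B2 := [set` `]u.2 - e, u.2 + e[].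
have BA : B1 `*` B2 `<=` A.
  move=> v [/= h1 h2]; apply: hA => /= v0.
  have : phi v != 0; last by rewrite v0 eqxx.
  by apply: he; split; rewrite /= -ball_normE/= distrC ltr_distl; move: h1 h2;
    rewrite /B1 /B2/= !in_itv/=.
have m1 : measurable (B1 : set (measurableTypeR R)) by exact: measurable_itv.
have m2 : measurable (B2 : set (measurableTypeR R)) by exact: measurable_itv.
have mB : measurable (B1 `*` B2 : set (measurableTypeR R * measurableTypeR R)).
  exact: measurableX.
have : (lp (B1 `*` B2) <= 0)%E by rewrite -A0; apply: le_measure; rewrite ?inE.
have E : lp (B1 `*` B2) = (@lebesgue_measure R B1 * @lebesgue_measure R B2)%E.
  exact: product_measure1E.
rewrite E !lebesgue_measure_itv/= !lte_fin.
have l (x : R) : x - e < x + e by rewrite ltrD2l gtrN.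
by rewrite !l -!EFinB -EFinM lee_fin leNgt mulr_gt0// subr_gt0.
Qed.

(** Two continuous functions that differ at a point differ on a square, which has positive measure.
    This leads from equality of classes back to the equality of functions that [K] demands. *)
Lemma schwartz_ae_eq g h : S2 g -> S2 h -> g = h %[ae mu2] -> g = h.
Proof.
move=> Sg Sh [A [mA A0 hA]].
have A0' : lp A = 0%E.
  have := A0; rewrite /Defs.mu2 /mscale /= => /eqP; rewrite mule_eq0 => /orP[|/eqP//].
  by rewrite eqe invr_eq0 mulf_eq0 pnatr_eq0/= gt_eqF// pi_gt0.
have [cg1 cg2] := schwartz_continuous Sg; have [ch1 ch2] := schwartz_continuous Sh.
apply/funext => u; apply: complex_ext; apply/eqP; rewrite -subr_eq0; apply/eqP.
  apply: (@continuous_ae0 (fun u => Re (g u) - Re (h u))).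
    by move=> v; apply: cvgB; [exact: cg1|exact: ch1].
  by exists A; split=> // v hv; apply: hA => E; apply: hv; rewrite /= (E Logic.I) subrr.
apply: (@continuous_ae0 (fun u => Im (g u) - Im (h u))).
  by move=> v; apply: cvgB; [exact: cg2|exact: ch2].
by exists A; split=> // v hv; apply: hA => E; apply: hv; rewrite /= (E Logic.I) subrr.
Qed.

Lemma K_vac g : S2 g -> K g <-> vacop (cls2 g) = cls2 g.
Proof.
move=> Sg; split=> [[_ E]|E]; first by rewrite -twisted_f0// E.
split=> //; have St := schwartz_twisted Sg schwartz_f0.
apply: schwartz_ae_eq => //.
have h1 := @toL2K _ _ R mu2 _ (schwartz_L2 St); have h2 := @toL2K _ _ R mu2 _ (schwartz_L2 Sg).
rewrite twisted_f0// E in h1.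
exact: ae_eq_trans (ae_eq_sym h1) h2.
Qed.

End vacuum.

(** * Intertwining with the GNS representation *)

Section gns.
Variables (R : realType) (H : hilbertType R) (eta : (R * R -> R[i]) -> H).
Hypothesis gnsH : is_gns eta.
Local Notation S2 := (schwartz R).
Local Notation cls2 := (@toL2 _ _ R (mu2 R)).
Local Notation cL1 := (@L2_complete _ _ R (mu1 R)).
Local Notation ecoh := (@ecoh R).
Local Notation Winv := (@Winv R).
Local Notation e0 := (e0 R).
Local Notation K := (@K R).
Local Notation clK := (closure (cls2 @` K)).
Local Notation V := (V eta).

#[local] Opaque Defs.W Defs.Winv Defs.lreg Defs.tensor Defs.Pop.

Let cH := @hilbert_completes R H.

(** Right multiplication by [f0] is the orthogonal projection [vacop], which fixes [f0]. It can thus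
    be dropped from omega; cyclicity moves g to the left of the inner product and restores [vacop]
    on the right, and idempotence distributes it over both arguments. *)
Lemma gns_inner_vac f g : S2 f -> S2 g ->
  inner (eta g) (eta f) = inner (vacop (cls2 g)) (vacop (cls2 f)).
Proof.
move=> Sf Sg; have St := schwartz_twisted (schwartz_conj Sg) Sf.
apply: (etrans (gns_inner gnsH Sf Sg)); rewrite /omega.
apply: (etrans (congr1 (inner _) (twisted_f0 St))).
apply: (etrans (esym (vacop_adj _ _))).
apply: (etrans (congr1 (fun x => inner x _) (vacop_f0 R))).
apply: (etrans (triple_cyclic Sf Sg)).
apply: (etrans (congr1 (inner _) (twisted_f0 Sf))).
by rewrite [RHS]vacop_adj vacopK.
Qed.

Lemma rn_eta g : S2 g -> rn (eta g) = rn (vacop (cls2 g)).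
Proof.
move=> Sg; apply/eqP; rewrite -(@eqrXn2 _ 2) ?rn_ge0//; apply/eqP.
by have := gns_inner_vac Sg Sg; rewrite !rn_sqr => -[].
Qed.

Lemma eta_K g g' : K g -> K g' -> inner (eta g) (eta g') = inner (cls2 g) (cls2 g').
Proof.
move=> Kg Kg'; have [Sg _] := Kg; have [Sg' _] := Kg'.
by rewrite gns_inner_vac// ((K_vac Sg).1 Kg) ((K_vac Sg').1 Kg').
Qed.

Lemma V_inner x y : clK x -> clK y -> inner (V x) (V y) = inner x y.
Proof. exact: (ext_iso cH eta_K). Qed.

Lemma V_near x g : clK x -> K g -> rn (eta g - V x) <= rn (cls2 g - x).
Proof. by move=> cx; exact: (ext_isoP cH eta_K cx). Qed.

Lemma VinvK x : clK x -> Vinv eta (V x) = x.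
Proof.
move=> cx; rewrite /Vinv pinvKV ?inE// => y z; rewrite !inE => cy cz E.
apply/subr0_eq/rn_eq0_inner.
by rewrite !(innerBl, innerBr) -!V_inner// E !subrr.
Qed.

Section fixed.
Variables (f : R * R -> R[i]) (Sf : S2 f).

Let eta_comb a g g' : S2 g -> S2 g' -> eta (comb a g g') = a *: eta g + eta g'.
Proof. exact: (gns_linear gnsH). Qed.

Let A g := eta (twisted f g).

Let A_comb a g g' : S2 g -> S2 g' -> A (comb a g g') = a *: A g + A g'.
Proof.
by move=> Sg Sg'; rewrite /A twisted_combr// eta_comb//; exact: schwartz_twisted.
Qed.

(** The norm of [eta g] is that of [vacop] applied to the class of g, and [vacop] commutes with left
    multiplication, so the bound of [lreg f] carries over to the quotient. *)
Lemma eta_twisted_bound : exists2 C, 0 <= C &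
  forall g, S2 g -> rn (eta (twisted f g)) <= C * rn (eta g).
Proof.
have [C C0 hC] := lreg_bound Sf; exists C => // g Sg.
rewrite !rn_eta//; last exact: schwartz_twisted.
by rewrite -lreg_cls// vacop_lreg.
Qed.

Let iD x : closure (eta @` S2) x.
Proof. by rewrite (gns_dense gnsH). Qed.

Lemma pi_omega_eta g : S2 g -> pi_omega eta f (eta g) = eta (twisted f g).
Proof.
have [C C0 hC] := eta_twisted_bound.
exact: (ext_linE (i := eta) (A := A) cH C0 (@schwartz_comb R) eta_comb A_comb hC (@iD)).
Qed.

Lemma pi_omega_lin a x y :
  pi_omega eta f (a *: x + y) = a *: pi_omega eta f x + pi_omega eta f y.
Proof.
have [C C0 hC] := eta_twisted_bound.
exact: (ext_lin (i := eta) (A := A) cH C0 (@schwartz_comb R) eta_comb A_comb hC (@iD)).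
Qed.

Lemma pi_omega_bound : exists2 C, 0 <= C & forall x, rn (pi_omega eta f x) <= C * rn x.
Proof.
have [C C0 hC] := eta_twisted_bound; exists C => // x.
exact: (ext_bound (i := eta) (A := A) cH C0 (@schwartz_comb R) eta_comb A_comb hC (@iD)).
Qed.

Lemma K_twisted g : K g -> K (twisted f g).
Proof.
move=> Kg; have [Sg _] := Kg; have St := schwartz_twisted Sf Sg.
by apply/(K_vac St); rewrite -lreg_cls// vacop_lreg// ((K_vac Sg).1 Kg).
Qed.

Lemma lreg_clK x : clK x -> clK (lreg f x).
Proof.
move=> cx; have [C C0 hC] := lreg_bound Sf.
have C1 : 0 < C + 1 by rewrite ltr_wpDl.
apply/closureP => e eE; have [_ [g Kg <-] gx] := (closureP _ _).1 cx _ (divr_gt0 eE C1).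
have [Sg _] := Kg; exists (lreg f (cls2 g)).
  by exists (twisted f g); [exact: K_twisted|rewrite lreg_cls].
rewrite -(linB _ _ (lreg_lin Sf)); apply: le_lt_trans (hC _) _.
move: gx; rewrite ltr_pdivlMr//; apply: le_lt_trans.
by rewrite mulrC ler_wpM2l ?rn_ge0// lerDl.
Qed.

(** On [K] both sides are [eta (twisted f g)]. For x in the closure, approximation by g in [K] costs
    C |g - x| on one side and C' |g - x| on the other. *)
Lemma pi_omega_V x : clK x -> pi_omega eta f (V x) = V (lreg f x).
Proof.
move=> cx; have cfx := lreg_clK cx.
have [C C0 hC] := lreg_bound Sf; have [C' C'0 hC'] := pi_omega_bound.
have C1 : 0 < C + C' + 1 by rewrite ltr_wpDl// addr_ge0.
apply/subr0_eq/rn_eq0/eqP; rewrite eq_le rn_ge0 andbT.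
apply/ler_addgt0Pl => e eE; rewrite addr0.
have [_ [g Kg <-] gx] := (closureP _ _).1 cx _ (divr_gt0 eE C1).
have [Sg _] := Kg.
rewrite (subr_split _ _ (eta (twisted f g))); apply: le_trans (rnD _ _) _; rewrite rnN.
have h1 := V_near cfx (K_twisted Kg).
have h2 := hC (cls2 g - x); rewrite (linB _ _ (lreg_lin Sf)) lreg_cls// in h2.
have h3 := hC' (eta g - V x); rewrite (linB _ _ pi_omega_lin) pi_omega_eta// in h3.
have h4 := V_near cx Kg.
move: gx; rewrite ltr_pdivlMr// => gx.
have h5 : C' * rn (eta g - V x) <= C' * rn (cls2 g - x) by rewrite ler_wpM2l.
move: h1 h2 h3 h5 gx (rn_ge0 (cls2 g - x)).
move: (rn (cls2 g - x)) (rn (eta g - V x)) => p q; lra.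
Qed.

(** The function sqrt 2 w_(a,0) is the preimage of e_a (x) h_0. Finite combinations of such
    functions are Schwartz and fixed by [vacop], hence belong to [K], and they approximate every phi
    (x) h_0. *)
Lemma clK_tensor phi : clK (Winv (tensor phi e0)).
Proof.
apply/closureP => e eE; have [l hl] := total_dense cL1 (@ecoh_total R) phi eE.
exists (Winv (tensor (lincomb ecoh l) e0)); last first.
  rewrite -(linB _ _ (@Winv_lin R)) rn_Winv.
  rewrite -(linB (A := fun p => tensor p e0)); last by move=> a x y; rewrite tensor_linl.
  by rewrite rn_tensor rn_e0 mulr1.
pose F (a : R[i]) u : R[i] := (Num.sqrt 2)%:C%C * wave a 0 u.
have SF a : S2 (F a) by apply: schwartzZ; exact: schwartz_wave.
have [g Sg E] := lincomb_schwartz l SF.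
have FE a : cls2 (F a) = Winv (tensor (ecoh a) e0).
  rewrite toL2_scale ?schwartz_L2//; last exact: schwartz_wave.
  rewrite -[toL2 _ _]/(ewave (a, 0)) -Winv_eten eten_tensor e0E tensorZr.
  by rewrite (linZ _ _ (@Winv_lin R)).
have LE : Winv (tensor (lincomb ecoh l) e0) = cls2 g.
  rewrite -E (lincomb_lin _ _ (A := fun p => Winv (tensor p e0))); last first.
    by move=> a x y; rewrite tensor_linl Winv_lin.
  by congr lincomb; apply/funext => a; rewrite /= FE.
exists g => //; apply/(K_vac Sg).
by rewrite -LE vacop_tensor.
Qed.

(** Starting from a vector in the closure of [K], the intertwining relation replaces [pi_omega] by
    [lreg] inside V, and V then cancels against its inverse. *)
Lemma pi_s_schop : pi_s eta f = schop f.
Proof.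
apply/funext => phi; rewrite /pi_s /=.
have -> : Qop phi = tensor phi e0 by [].
have c := @clK_tensor phi.
by rewrite (pi_omega_V c) (VinvK (lreg_clK c)).
Qed.

End fixed.
End gns.

Theorem theorem2 (R : realType) (H : hilbertType R)
    (eta : (R * R -> R[i]) -> H) (gnsH : is_gns eta)
    (f : R * R -> R[i]) (Sf : schwartz R f) :
  @W R \o lreg f \o @Winv R = tensor_op (pi_s eta f) idfun.
Proof. by rewrite (pi_s_schop gnsH Sf) -(wop_tensor_op Sf). Qed.
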